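(* Let $A,N_1,\dots,N_q\in\mathbb R^{n\times n}$, $B\in\mathbb R^{n\times m}$, $C\in\mathbb R^{p\times n}$ be such that $(A,B,N_i)$ is stabilizable and $(A,C,N_i)$ is observable. Let $P>0$ satisfy $$A^\top P^{-1}+P^{-1}A+\sum_{i,j=1}^q N_i^\top P^{-1}N_jk_{ij}-C^\top C+P^{-1}BB^\top P^{-1}\le 0,$$ and let $Q>0$ be the stabilizing solution of $$A^\top Q+QA+\sum_{i,j=1}^q N_i^\top QN_jk_{ij}+C^\top C-QBB^\top Q=0.$$ Let $1\le r<n$, let $\sigma_1\ge\dots\ge\sigma_n>0$ be the square roots of the eigenvalues of $PQ$, and let $(A_r,B_r,C_r,N_{i,r})$ be the coefficients of the reduced system obtained by LQG balanced truncation. Let $T>0$, $u\in L^2_T$, let $x=x(\cdot,0,u)$, $y=y(\cdot,0,u)$ be the state and output of the full system and $y_r=y_r(\cdot,0,u)$ the output of the reduced system, both with zero initial state and control $u$. Let $\gamma_T>0$ be a constant such that $\|y_r(\cdot,0,w)\|_{L^2_T}\le\gamma_T\|w\|_{L^2_T}$ for all $w\in L^2_T$. Then $$\|y-y_r\|_{L^2_T}\le 2(1+\gamma_T)\sum_{k=r+1}^n\frac{\sigma_k}{\sqrt{1+\sigma_k^2}}\left(\left\|\begin{bmatrix}u\\ y\end{bmatrix}\right\|_{L^2_T}^2+\mathbb E\left[x(T)^\top Qx(T)\right]\right)^{1/2}.$$ If additionally $u\in L^2$ and $x\in L^2$, then $$\|y-y_r\|_{L^2_T}\le 2(1+\gamma_T)\sum_{k=r+1}^n\frac{\sigma_k}{\sqrt{1+\sigma_k^2}}\left\|\begin{bmatrix}u\\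 y\end{bmatrix}\right\|_{L^2}.$$
   Context: Probability setting: $(\Omega,\mathcal F,(\mathcal F_t)_{t\ge0},\mathbb P)$ is a filtered probability space with right-continuous complete filtration; $W=(W_1,\dots,W_q)^\top$ is an adapted $\mathbb R^q$-valued mean-zero Wiener process with covariance matrix $K=(k_{ij})$, i.e. $\mathbb E[W(t)W(t)^\top]=Kt$, whose increments $W(t+h)-W(t)$ are independent of $\mathcal F_t$. For adapted processes, $\|v\|_{L^2_T}^2=\mathbb E\int_0^T\|v(s)\|_2^2ds$; $v\in L^2_T$ means this is finite, and $L^2$ denotes the case $T=\infty$. Full system: $dx(t)=[Ax(t)+Bu(t)]dt+\sum_{i=1}^qN_ix(t)dW_i(t)$, $x(0)=x_0\in\mathbb R^n$, $y(t)=Cx(t)$. Its state and output are written $x(\cdot,x_0,u)$, $y(\cdot,x_0,u)$. Definitions: $(A,N_i)$ is stable (mean square asymptotically) if there are $M\ge1$, $c>0$ with $\mathbb E\|x(t,x_0,0)\|_2^2\le Me^{-ct}\|x_0\|_2^2$ for all $x_0$, $t\ge0$. $(A,B,N_i)$ is stabilizable if for every $x_0$ there is $u\in L^2$ with $x(\cdot,x_0,u)\in L^2$. $(A,C,N_i)$ is observable if $y(t,x_0,0)=0$ a.s. for all $t\ge0$ implies $x_0=0$. A solution $Q$ of the Riccati equation is stabilizing if $(A-BB^\top Q,N_i)$ is stable; under the assumptions of the claim a stabilizing solution exists and is positive definite. LQG balanced truncation: choose a nonsingular $S_b\in\mathbb R^{n\times n}$ with $S_bPS_b^\top=S_b^{-\top}QS_b^{-1}=\Sigma_n=\operatorname{diag}(\sigma_1,\dots,\sigma_n)$,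 and put $(A_n,N_{i,n},B_n,C_n)=(S_bAS_b^{-1},S_bN_iS_b^{-1},S_bB,CS_b^{-1})$. Then $A_r,N_{i,r}$ are the upper-left $r\times r$ blocks of $A_n,N_{i,n}$, $B_r$ consists of the first $r$ rows of $B_n$, and $C_r$ of the first $r$ columns of $C_n$. The reduced system with control $w$ is $dx_r(t)=[A_rx_r(t)+B_rw(t)]dt+\sum_{i=1}^qN_{i,r}x_r(t)dW_i(t)$, $x_r(0)=x_{0,r}$, $y_r(t)=C_rx_r(t)$, with output written $y_r(\cdot,x_{0,r},w)$. *)

(* Defs.v *)
From HB Require Import structures.
From mathcomp Require Import all_boot all_order all_algebra.
From mathcomp Require Import all_classical all_reals all_analysis.

Set Implicit Arguments.
Unset Strict Implicit.
Unset Printing Implicit Defensive.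

Import Order.TTheory GRing.Theory Num.Theory.
Import numFieldNormedType.Exports.

Local Open Scope classical_set_scope.
Local Open Scope ring_scope.

Section Matrices.
Context {R : realType}.

(* The library's norm on matrices is the max norm, hence this Euclidean one. *)
Definition sqnorm2 k (v : 'cV[R]_k) : R := \sum_(i < k) v i 0 ^+ 2.

Definition quad_form k (M : 'M[R]_k) (v : 'cV[R]_k) : R := (v^T *m M *m v) 0 0.

Definition posdef k (M : 'M[R]_k) : Prop :=
  M^T = M /\ forall v : 'cV[R]_k, v != 0 -> 0 < quad_form M v.

Definition negsemidef k (M : 'M[R]_k) : Prop :=
  M^T = M /\ forall v : 'cV[R]_k, quad_form M v <= 0.

Definition gen_lyap n q (A : 'M[R]_n) (N : 'I_q -> 'M[R]_n) (K : 'M[R]_q)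
    (X : 'M[R]_n) : 'M[R]_n :=
  A^T *m X + X *m A + \sum_(i < q) \sum_(j < q) K i j *: ((N i)^T *m X *m N j).

Definition lead_ord r n (hr : (r < n)%N) : 'I_r -> 'I_n := widen_ord (ltnW hr).

Definition trunc_mx r n (hr : (r < n)%N) (M : 'M[R]_n) : 'M[R]_r :=
  mxsub (lead_ord hr) (lead_ord hr) M.

Definition trunc_rows r n m (hr : (r < n)%N) (M : 'M[R]_(n, m)) : 'M[R]_(r, m) :=
  rowsub (lead_ord hr) M.

Definition trunc_cols r n p (hr : (r < n)%N) (M : 'M[R]_(p, n)) : 'M[R]_(p, r) :=
  colsub (lead_ord hr) M.

End Matrices.

Section Stochastic.
Context {d : measure_display} {Omega : measurableType d} {R : realType}.
Variable Pr : probability Omega R.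
Local Notation mu := (@lebesgue_measure R).

Definition usual_filtration (F : R -> set (set Omega)) : Prop :=
  [/\ forall t, 0 <= t -> sigma_algebra setT (F t) /\ F t `<=` measurable,
      forall s t, 0 <= s -> s <= t -> F s `<=` F t,
      forall t, 0 <= t -> \bigcap_(s in `]t, +oo[) F s `<=` F t &
      forall t, 0 <= t -> Pr.-negligible `<=` F t].

Variable F : R -> set (set Omega).

Definition rv_measurable (G : set (set Omega)) (X : Omega -> R) : Prop :=
  forall Y : set R, measurable Y -> G (X @^-1` Y).

Definition sigma_rv k (X : Omega -> 'cV[R]_k) : set (set Omega) :=
  <<s [set E | exists i (Y : set R),
         measurable Y /\ E = (fun w => X w i 0) @^-1` Y] >>.

Definition indep_sigma (G H : set (set Omega)) : Prop :=
  forall A B, G A -> H B -> Pr (A `&` B) = (Pr A * Pr B)%E.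

(* The law N(0, v), with N(0, 0) the Dirac mass at 0: the library's
   [normal_prob m s] takes the standard deviation s and is not the Dirac
   mass when s = 0. *)
Definition centered_gaussian (X : Omega -> R) (v : R) : Prop :=
  forall Y : set R, measurable Y ->
    Pr (X @^-1` Y) =
      if v == 0 then \d_(0 : R) Y else normal_prob 0 (Num.sqrt v) Y.

(* Processes are indexed by all of R; only their values on the time set D are
   ever constrained. *)
Definition adapted (D : set R) k (v : R -> Omega -> 'cV[R]_k) : Prop :=
  forall t, D t -> forall i, rv_measurable (F t) (fun w => v t w i 0).

(* Joint measurability is what gives a meaning to E \int_D |v(s)|^2 ds. *)
Definition adapted_process (D : set R) k (v : R -> Omega -> 'cV[R]_k) : Prop :=
  adapted D v /\
  forall i, measurable_fun (D `*` [set: Omega])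
    (fun z : measurableTypeR R * Omega => v z.1 z.2 i 0).

Definition L2sq (D : set R) k (v : R -> Omega -> 'cV[R]_k) : \bar R :=
  (\int[Pr]_w \int[mu]_(s in D) (sqnorm2 (v s w))%:E)%E.

Definition L2norm (D : set R) k (v : R -> Omega -> 'cV[R]_k) : \bar R :=
  (L2sq D v `^ 2^-1)%E.

Definition in_L2 (D : set R) k (v : R -> Omega -> 'cV[R]_k) : Prop :=
  adapted_process D v /\ (L2norm D v < +oo)%E.

Definition wiener q (K : 'M[R]_q) (W : R -> Omega -> 'cV[R]_q) : Prop :=
  [/\ adapted `[0, +oo[ W,
      {ae Pr, forall w, W 0 w = 0} /\
      {ae Pr, forall w, {within `[0, +oo[, continuous (fun t => W t w)}},
      forall t, 0 <= t ->
        (forall i, ('E_Pr[(fun w => W t w i 0)%R] = 0)%E) /\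
        (forall i j,
           ('E_Pr[(fun w => W t w i 0 * W t w j 0)%R] = (K i j * t)%:E)%E),
      forall t h, 0 <= t -> 0 <= h -> forall a : 'cV[R]_q,
        centered_gaussian (fun w => (a^T *m (W (t + h) w - W t w)) 0 0)
                          (quad_form K a * h) &
      forall t h, 0 <= t -> 0 <= h ->
        indep_sigma (F t) (sigma_rv (fun w => W (t + h) w - W t w))].

(* Ito integral of H in L^2_t over [0, t] against a scalar Wiener process: the
   L^2(Omega)-limit of the elementary integrals of any simple adapted processes
   approximating H in L^2([0, t] x Omega).  [simple_data] is a partition
   0 = tau_0 <= ... <= tau_k = t together with bounded F_{tau_j}-measurable
   coefficients xi_j. *)
Definition simple_data (t : R) (k : nat) (tau : nat -> R)
    (xi : nat -> Omega -> R) : Prop :=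
  [/\ tau 0%N = 0, tau k = t,
      forall j, (j < k)%N -> tau j <= tau j.+1,
      forall j, (j < k)%N -> rv_measurable (F (tau j)) (xi j) &
      forall j, (j < k)%N -> exists b : R, forall w, `|xi j w| <= b].

Definition simple_process (k : nat) (tau : nat -> R) (xi : nat -> Omega -> R)
    (s : R) (w : Omega) : R :=
  \sum_(j < k) xi j w * \1_(`]tau j, tau j.+1]%classic) s.

Definition simple_integral (b : R -> Omega -> R) (k : nat) (tau : nat -> R)
    (xi : nat -> Omega -> R) (w : Omega) : R :=
  \sum_(j < k) xi j w * (b (tau j.+1) w - b (tau j) w).

Definition is_ito_integral (b H : R -> Omega -> R) (t : R) (I : Omega -> R) :
    Prop :=
  measurable_fun setT I /\
  exists (k : nat -> nat) (tau : nat -> nat -> R) (xi : nat -> nat -> Omega -> R),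
    [/\ forall l, simple_data t (k l) (tau l) (xi l),
        ((fun l => \int[Pr]_w \int[mu]_(s in `[0%R, t])
            ((H s w - simple_process (k l) (tau l) (xi l) s w) ^+ 2)%:E)
          @ \oo --> 0)%E &
        ((fun l => \int[Pr]_w
            ((I w - simple_integral b (k l) (tau l) (xi l) w) ^+ 2)%:E)
          @ \oo --> 0)%E].

Variables (q : nat) (W : R -> Omega -> 'cV[R]_q).

(* x is the state x(., x0, u) on the time set D, which is [0, T] or
   [0, +oo[: dx = (A x + B u) dt + \sum_i N_i x dW_i in integral form.  Such an
   x is unique up to indistinguishability, so "the state" is rendered below by
   quantifying over every x satisfying is_state. *)
Definition is_state (D : set R) n m (A : 'M[R]_n) (B : 'M[R]_(n, m))
    (N : 'I_q -> 'M[R]_n) (x0 : 'cV[R]_n) (u : R -> Omega -> 'cV[R]_m)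
    (x : R -> Omega -> 'cV[R]_n) : Prop :=
  [/\ adapted_process D x,
      {ae Pr, forall w, {within D, continuous (fun t => x t w)}},
      forall t, D t -> (L2sq `[0%R, t] x < +oo)%E &
      forall t, D t -> exists I : 'I_q -> Omega -> 'cV[R]_n,
        (forall i j, is_ito_integral (fun s w => W s w i 0)
           (fun s w => (N i *m x s w) j 0) t (fun w => I i w j 0)) /\
        {ae Pr, forall w, x t w = x0 +
           \col_j (\int[mu]_(s in `[0%R, t]) ((A *m x s w + B *m u s w) j 0)) +
           \sum_(i < q) I i w}].

(* No control: the input matrix has no columns. *)
Definition stable n (A : 'M[R]_n) (N : 'I_q -> 'M[R]_n) : Prop :=
  exists M c : R, 1 <= M /\ 0 < c /\
    forall (x0 : 'cV[R]_n) (x : R -> Omega -> 'cV[R]_n),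
      is_state `[0, +oo[ A (0 : 'M[R]_(n, 0)) N x0 (fun _ _ => 0) x ->
      forall t, 0 <= t ->
        ('E_Pr[fun w => sqnorm2 (x t w)]
           <= (M * expR (- (c * t)) * sqnorm2 x0)%:E)%E.

Definition stabilizable n m (A : 'M[R]_n) (B : 'M[R]_(n, m))
    (N : 'I_q -> 'M[R]_n) : Prop :=
  forall x0 : 'cV[R]_n,
    exists (u : R -> Omega -> 'cV[R]_m) (x : R -> Omega -> 'cV[R]_n),
      [/\ in_L2 `[0, +oo[ u, is_state `[0, +oo[ A B N x0 u x &
          in_L2 `[0, +oo[ x].

Definition observable n p (A : 'M[R]_n) (C : 'M[R]_(p, n))
    (N : 'I_q -> 'M[R]_n) : Prop :=
  forall (x0 : 'cV[R]_n) (x : R -> Omega -> 'cV[R]_n),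
    is_state `[0, +oo[ A (0 : 'M[R]_(n, 0)) N x0 (fun _ _ => 0) x ->
    (forall t, 0 <= t -> {ae Pr, forall w, C *m x t w = 0}) ->
    x0 = 0.

Definition stabilizing_riccati n m p (K : 'M[R]_q) (A : 'M[R]_n)
    (B : 'M[R]_(n, m)) (C : 'M[R]_(p, n)) (N : 'I_q -> 'M[R]_n)
    (Q : 'M[R]_n) : Prop :=
  gen_lyap A N K Q + C^T *m C - Q *m B *m B^T *m Q = 0 /\
  stable (A - B *m B^T *m Q) N.

End Stochastic.

(* Main.v *)
Require Import Defs.
From HB Require Import structures.
From mathcomp Require Import all_boot all_order all_algebra.
From mathcomp Require Import all_classical all_reals all_analysis.
From mathcomp Require Import measurable_realfun ring lra.

Set Implicit Arguments.
Unset Strict Implicit.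
Unset Printing Implicit Defensive.

Import Order.TTheory GRing.Theory Num.Theory.
Import numFieldNormedType.Exports.

Local Open Scope classical_set_scope.
Local Open Scope ring_scope.

(* The state feedback v = u + B^T Q x turns x into the state of the closed loop with matrix
   A_Q = A - B B^T Q, and Ito's formula with the Riccati equation gives the energy identity
   ||v||^2 = ||u||^2 + ||y||^2 + E[x(T)^T Q x(T)].  In balanced coordinates both Q = Sigma and
   X = P^-1 + Q = Sigma^-1 + Sigma are diagonal, and X satisfies a Lyapunov inequality for the
   closed loop.  Truncate the closed loop one coordinate at a time: if x and x' are the states
   before and after removal of coordinate k, then for e = x - x', s = x + x' and
   theta^2 = Sigma_k / X_k = sigma_k^2 / (1 + sigma_k^2), the function
   E[e^T Sigma e + theta^2 s^T X s] shows that the outputs C e and B^T Q e together have norm at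
   most 2 theta ||v||.  Summing over k > r bounds y - yhat_r and the difference w between the
   control u and the one that the truncated closed loop feeds back, where yhat_r is its output.
   The truncated closed loop is the reduced system driven by another control, so that
   yhat_r - y_r is the output of the reduced system driven by w, at the cost of a factor gamma_T.
   On an infinite horizon, E[x(t)^T Q x(t)] is arbitrarily small at suitable times t.

   The truncated closed loops need strong solutions: these come from Picard iteration, where
   Kolmogorov's maximal inequality yields continuous versions. *)

(** * Square integrable functions and independence *)

(** No pathwise Ito formula is needed. In balanced coordinates every quadratic form of the argument
    is diagonal, so it suffices to know E[x_c(t)^2] for scalar Ito processes, and this follows from
    the isometry, the martingale property tested against square integrable variables, and Fubini's
    theorem. Stopping times and conditional expectations never appear. The obstacle is that the gain
    bound [gammaT] speaks about states in the sense of [is_state] only. The truncated closed loops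
    must therefore be constructed as adapted processes with continuous paths, and their stochastic
    integrals must be brought back to limits of simple integrals with bounded coefficients.
    Integrands are handled through the class of L^2 limits of simple processes, which contains all
    Ito processes and is closed under the operations of the Picard iteration. The constant 2 in the
    bound comes from completing a square: the input enters the growth of s^T X s through a cross
    term that the dissipation of s absorbs up to 4 |v|^2. Positivity of the Lyapunov function at the
    final time then gives the output estimate. *)

Lemma sqr_sum_le (R : realDomainType) (I : finType) (F : I -> R) :
  (\sum_i F i) ^+ 2 <= #|I|%:R * \sum_i F i ^+ 2.
Proof.
set S := \sum_i F i; set n : R := #|I|%:R.
have [I0|In] := eqVneq #|I| 0%N.
  rewrite /n I0 mul0r /S big1 ?expr0n // => i _.
  by have := fintype0 i; rewrite I0.
have np : 0 < n by rewrite ltr0n lt0n.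
(* Nonnegativity of the spread of [n * F i] around the sum [S]; scaling by [n] avoids the division
   in the mean. *)
have h : 0 <= \sum_i (n * F i - S) ^+ 2 by apply: sumr_ge0 => i _; exact: sqr_ge0.
suff e : \sum_i (n * F i - S) ^+ 2 = n * (n * \sum_i F i ^+ 2 - S ^+ 2).
  by move: h; rewrite e pmulr_rge0 // subr_ge0.
rewrite (eq_bigr (fun i => n ^+ 2 * F i ^+ 2 + (- 2 * n * S) * F i + S ^+ 2)).
  rewrite !big_split /= -!mulr_sumr -/S.
  by rewrite sumr_const -[S *+ _]mulr_natr -/n; ring.
by move=> i _; ring.
Qed.

Section SquareIntegrable.
Context d (T : measurableType d) (R : realType).
Variables (mu : {measure set T -> \bar R}) (D : set T).
Implicit Types f g h : T -> R.

Definition sqi f :=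
  measurable_fun D f /\ (\int[mu]_(x in D) ((f x) ^+ 2)%:E < +oo)%E.

(** The integral is the real-valued one, which is 0 where the extended integral is infinite; the
    notion has its intended meaning for square integrable arguments. *)
Definition l2to (F : nat -> T -> R) f :=
  (fun l => \int[mu]_(x in D) (f x - F l x) ^+ 2) @ \oo --> (0 : R).

Hypothesis mD : measurable D.

Lemma ge0_integrable f : measurable_fun D f -> (forall x, D x -> 0 <= f x) ->
  (\int[mu]_(x in D) (f x)%:E < +oo)%E -> mu.-integrable D (EFin \o f).
Proof.
move=> mf f0 fin; apply/integrableP; split; first exact/measurable_EFinP.
rewrite (eq_integral (EFin \o f)) // => x; rewrite inE => Dx /=.
by rewrite ger0_norm // f0.
Qed.

Lemma dominated_integrable f g : measurable_fun D f ->
  (forall x, D x -> `|f x| <= g x) ->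
  mu.-integrable D (EFin \o g) -> mu.-integrable D (EFin \o f).
Proof.
move=> mf fg ig; apply: (le_integrable mD _ _ ig); first exact/measurable_EFinP.
move=> x Dx /=; rewrite lee_fin; apply: (le_trans (fg x Dx)); exact: ler_norm.
Qed.

Lemma EFin_Rintegral f : mu.-integrable D (EFin \o f) ->
  ((\int[mu]_(x in D) f x)%:E = \int[mu]_(x in D) (f x)%:E)%E.
Proof. by move=> i; rewrite fineK //; exact: integrable_fin_num i. Qed.

Lemma integrable_lin (a b : R) f g :
  mu.-integrable D (EFin \o f) -> mu.-integrable D (EFin \o g) ->
  mu.-integrable D (EFin \o (fun x => a * f x + b * g x)).
Proof.
move=> hf hg; have /= := integrableD mD (integrableZl mD a hf) (integrableZl mD b hg).
by apply: eq_integrable.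
Qed.

Lemma RintegralL (a b : R) f g :
  mu.-integrable D (EFin \o f) -> mu.-integrable D (EFin \o g) ->
  \int[mu]_(x in D) (a * f x + b * g x) =
    a * \int[mu]_(x in D) f x + b * \int[mu]_(x in D) g x.
Proof.
move=> hf hg; rewrite RintegralD //; last 2 first.
- exact: (integrableZl mD a hf).
- exact: (integrableZl mD b hg).
by rewrite !RintegralZl.
Qed.

Lemma integrable_sumr (I : Type) (s : seq I) (F : I -> T -> R) :
  (forall i, mu.-integrable D (EFin \o F i)) ->
  mu.-integrable D (EFin \o (fun x => \sum_(i <- s) F i x)).
Proof.
move=> iF; have := integrable_sum mD s (P := xpredT) (fun i _ => iF i).
apply: eq_integrable => // x _ /=.
by rewrite sumEFin.
Qed.

Lemma Rintegral_sumr (I : Type) (s : seq I) (F : I -> T -> R) :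
  (forall i, mu.-integrable D (EFin \o F i)) ->
  \int[mu]_(x in D) (\sum_(i <- s) F i x) = \sum_(i <- s) \int[mu]_(x in D) F i x.
Proof.
move=> iF; elim: s => [|i s IH].
  rewrite big_nil; under eq_Rintegral do rewrite big_nil.
  by rewrite Rintegral_cst // mul0r.
rewrite big_cons -IH -RintegralD //; last exact: integrable_sumr.
by apply: eq_Rintegral => x _; rewrite big_cons.
Qed.

Lemma sqi_integrable f : sqi f -> mu.-integrable D (EFin \o (fun x => f x ^+ 2)).
Proof.
move=> [mf fin]; apply: ge0_integrable => // [|x _]; last exact: sqr_ge0.
exact: measurable_funX.
Qed.

Lemma sqi_mul f g : sqi f -> sqi g -> mu.-integrable D (EFin \o (fun x => f x * g x)).
Proof.
move=> hf hg.
apply: (@dominated_integrable _ (fun x => 1 * f x ^+ 2 + 1 * g x ^+ 2)).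
- by apply: measurable_funM; [case: hf|case: hg].
- move=> x _; rewrite !mul1r normrM.
  rewrite -(real_normK (num_real (f x))) -(real_normK (num_real (g x))).
  have := sqr_ge0 (`|f x| - `|g x|); have := sqr_ge0 (`|f x|); have := sqr_ge0 (`|g x|).
  by set a := `|f x|; set b := `|g x|; nra.
- by apply: integrable_lin; exact: sqi_integrable.
Qed.

Lemma integrable_sqi f : measurable_fun D f ->
  mu.-integrable D (EFin \o (fun x => f x ^+ 2)) -> sqi f.
Proof.
move=> mf /integrableP[_ fin]; split=> //; move: fin; rewrite (eq_integral (fun x => ((f x)^+2)%:E)) //.
by move=> x _ /=; rewrite ger0_norm ?sqr_ge0.
Qed.

Lemma sqi_lin (a b : R) f g : sqi f -> sqi g -> sqi (fun x => a * f x + b * g x).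
Proof.
move=> hf hg; have mf := hf.1; have mg := hg.1.
have m : measurable_fun D (fun x => a * f x + b * g x).
  by apply: measurable_funD; apply: measurable_funM => //; exact: measurable_cst.
apply: integrable_sqi => //.
apply: (@dominated_integrable _ (fun x => (2 * a ^+ 2) * f x ^+ 2 + (2 * b ^+ 2) * g x ^+ 2)).
- exact: measurable_funX.
- move=> x _; rewrite ger0_norm ?sqr_ge0 //.
  by have := sqr_ge0 (a * f x - b * g x); nra.
- by apply: integrable_lin; exact: sqi_integrable.
Qed.

Lemma sqi0 : sqi (fun=> 0).
Proof.
split; first exact: measurable_cst.
by rewrite (eq_integral (cst 0%E)) ?integral0 // => x _; rewrite expr0n.
Qed.

Lemma eq_sqi f g : (forall x, D x -> f x = g x) -> sqi f -> sqi g.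
Proof.
move=> fg [mf fin]; split.
  by apply: eq_measurable_fun mf => x; rewrite inE; exact: fg.
by under eq_integral => x do [rewrite inE => /fg e; rewrite -e].
Qed.

Lemma sqiZ a f : sqi f -> sqi (fun x => a * f x).
Proof.
by move=> hf; apply: eq_sqi (sqi_lin a 0 hf hf) => x _; rewrite mul0r addr0.
Qed.

Lemma sqiD f g : sqi f -> sqi g -> sqi (fun x => f x + g x).
Proof.
by move=> hf hg; apply: eq_sqi (sqi_lin 1 1 hf hg) => x _; rewrite !mul1r.
Qed.

Lemma sqiB f g : sqi f -> sqi g -> sqi (fun x => f x - g x).
Proof.
by move=> hf hg; apply: eq_sqi (sqi_lin 1 (-1) hf hg) => x _; rewrite !mul1r mulN1r.
Qed.

Lemma sqi_sum (I : Type) (s : seq I) (F : I -> T -> R) :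
  (forall i, sqi (F i)) -> sqi (fun x => \sum_(i <- s) F i x).
Proof.
move=> hF; elim: s => [|i s IH].
  by apply: eq_sqi sqi0 => x _; rewrite big_nil.
by apply: eq_sqi (sqiD (hF i) IH) => x _; rewrite big_cons.
Qed.

Lemma dominated_sqi f g : measurable_fun D f ->
  (forall x, D x -> `|f x| <= `|g x|) -> sqi g -> sqi f.
Proof.
move=> mf fg hg; apply: integrable_sqi => //.
apply: (@dominated_integrable _ (fun x => g x ^+ 2)) (sqi_integrable hg).
  exact: measurable_funX.
move=> x Dx; rewrite ger0_norm ?sqr_ge0 // -(real_normK (num_real (f x))).
by rewrite -(real_normK (num_real (g x))) lerXn2r ?nnegrE ?normr_ge0 // fg.
Qed.

Lemma isq_ge0 f : 0 <= \int[mu]_(x in D) (f x) ^+ 2.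
Proof. by apply: Rintegral_ge0 => x _; exact: sqr_ge0. Qed.

Lemma isq_lin (a b : R) f g : sqi f -> sqi g ->
  \int[mu]_(x in D) (a * f x + b * g x) ^+ 2 =
    a ^+ 2 * \int[mu]_(x in D) (f x) ^+ 2 + 2 * a * b * \int[mu]_(x in D) (f x * g x)
    + b ^+ 2 * \int[mu]_(x in D) (g x) ^+ 2.
Proof.
move=> hf hg; have hff := sqi_integrable hf; have hgg := sqi_integrable hg.
have hfg := sqi_mul hf hg.
rewrite (@eq_Rintegral _ _ _ _ _ (fun x => 1 * (a ^+ 2 * f x ^+ 2 + 2 * a * b * (f x * g x))
   + b ^+ 2 * g x ^+ 2)); last by move=> x _; ring.
rewrite RintegralL //; last exact: integrable_lin.
by rewrite RintegralL //; ring.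
Qed.

Lemma isqZ a f : sqi f ->
  \int[mu]_(x in D) (a * f x) ^+ 2 = a ^+ 2 * \int[mu]_(x in D) (f x) ^+ 2.
Proof.
move=> hf; rewrite -RintegralZl //; last exact: sqi_integrable.
by apply: eq_Rintegral => x _; rewrite exprMn.
Qed.

Lemma isqD_le f g : sqi f -> sqi g ->
  \int[mu]_(x in D) (f x + g x) ^+ 2 <=
    2 * \int[mu]_(x in D) (f x) ^+ 2 + 2 * \int[mu]_(x in D) (g x) ^+ 2.
Proof.
move=> hf hg; rewrite -RintegralL ?(sqi_integrable hf) ?(sqi_integrable hg) //.
apply: le_Rintegral => //.
- exact/sqi_integrable/sqiD.
- by apply: integrable_lin; exact: sqi_integrable.
- by move=> x _; have := sqr_ge0 (f x - g x); nra.
Qed.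

Lemma isq_sum_le (I : finType) (F : I -> T -> R) : (forall i, sqi (F i)) ->
  \int[mu]_(x in D) (\sum_i F i x) ^+ 2 <=
    #|I|%:R * \sum_i \int[mu]_(x in D) (F i x) ^+ 2.
Proof.
move=> hF; rewrite -Rintegral_sumr; last by move=> i; exact: sqi_integrable.
rewrite -RintegralZl //; last by apply: integrable_sumr => i; exact: sqi_integrable.
apply: le_Rintegral => //.
- exact/sqi_integrable/sqi_sum.
- apply: (integrableZl mD #|I|%:R (f := EFin \o (fun x => \sum_i F i x ^+ 2))).
  by apply: integrable_sumr => i; exact: sqi_integrable.
- move=> x _.
  exact: sqr_sum_le.
Qed.

Lemma ip_CS f g : sqi f -> sqi g ->
  (\int[mu]_(x in D) (f x * g x)) ^+ 2 <=
    (\int[mu]_(x in D) (f x) ^+ 2) * \int[mu]_(x in D) (g x) ^+ 2.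
Proof.
move=> hf hg.
set F := \int[mu]_(x in D) (f x) ^+ 2; set G := \int[mu]_(x in D) (g x) ^+ 2.
set c := \int[mu]_(x in D) (f x * g x).
have F0 : 0 <= F by exact: isq_ge0.
have G0 : 0 <= G by exact: isq_ge0.
have H a b : 0 <= a ^+ 2 * F + 2 * a * b * c + b ^+ 2 * G.
  by rewrite -isq_lin //; exact: isq_ge0.
have [G0'|Gn] := eqVneq G 0.
  (* For [G = 0] the form takes the value [- c ^+ 2] at this point, which forces [c = 0] without a
     division by [F]. *)
  have := H c (- (F + 1) / 2); rewrite G0' !mulr0 addr0.
  by rewrite (_ : _ + _ = - c ^+ 2); [rewrite oppr_ge0|field].
have Gp : 0 < G by lra.
have := H G (- c); rewrite (_ : _ + _ = G * (F * G - c ^+ 2)); last by ring.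
by rewrite pmulr_rge0 // subr_ge0.
Qed.

Lemma l2to_isq F f : (forall l, sqi (F l)) -> sqi f -> l2to F f ->
  (fun l => \int[mu]_(x in D) (F l x) ^+ 2) @ \oo --> \int[mu]_(x in D) (f x) ^+ 2.
Proof.
move=> hF hf cF; set a := \int[mu]_(x in D) (f x) ^+ 2.
have a0 : 0 <= a by exact: isq_ge0.
pose e l := \int[mu]_(x in D) (f x - F l x) ^+ 2.
have se : (fun l => Num.sqrt (e l)) @ \oo --> (0 : R).
  rewrite -(sqrtr0 R); apply: continuous_cvg => //; exact: sqrt_continuous.
have ke : (fun l => e l + 2 * Num.sqrt a * Num.sqrt (e l)) @ \oo --> (0 : R).
  rewrite -[X in _ --> X]addr0; apply: cvgD => //.
  by rewrite -[X in _ --> X](mulr0 (2 * Num.sqrt a)); apply: cvgMr.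
apply/subr_cvg0/norm_cvg0P.
apply: (squeeze_cvgr _ (cvg_cst 0) ke); apply: nearW => l; rewrite normr_ge0 /=.
have he : sqi (fun x => f x - F l x) by exact: sqiB.
have -> : \int[mu]_(x in D) F l x ^+ 2 =
  1 ^+ 2 * a + 2 * 1 * (-1) * \int[mu]_(x in D) (f x * (f x - F l x)) + (-1) ^+ 2 * e l.
  by rewrite -isq_lin //; apply: eq_Rintegral => x _; congr (_ ^+ 2); ring.
set c := \int[mu]_(x in D) (f x * (f x - F l x)).
have e0 : 0 <= e l by exact: isq_ge0.
have hc : `|c| <= Num.sqrt a * Num.sqrt (e l).
  by rewrite -sqrtrM // -sqrtr_sqr ler_sqrt ?mulr_ge0 ?sqr_ge0 //; exact: ip_CS.
rewrite (_ : _ - a = e l - 2 * c); last by ring.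
by rewrite (le_trans (ler_normB _ _)) // ger0_norm // lerD2l normrM ger0_norm // -mulrA ler_pM2l.
Qed.

Lemma l2to_lin (a b : R) F f G g : (forall l, sqi (F l)) -> sqi f -> (forall l, sqi (G l)) ->
  sqi g -> l2to F f -> l2to G g ->
  l2to (fun l x => a * F l x + b * G l x) (fun x => a * f x + b * g x).
Proof.
move=> hF hf hG hg cF cG; rewrite /l2to.
have k : (fun l => 2 * a ^+ 2 * \int[mu]_(x in D) (f x - F l x) ^+ 2 +
   2 * b ^+ 2 * \int[mu]_(x in D) (g x - G l x) ^+ 2) @ \oo --> (0 : R).
  rewrite [X in _ --> X](_ : _ = 2 * a ^+ 2 * 0 + 2 * b ^+ 2 * 0); last by rewrite !mulr0 addr0.
  by apply: cvgD; apply: cvgMr.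
apply: (squeeze_cvgr _ (cvg_cst 0) k); apply: nearW => l; rewrite isq_ge0 /=.
have hFl := sqiB hf (hF l); have hGl := sqiB hg (hG l).
rewrite (@eq_Rintegral _ _ _ _ _ (fun x => (a * (f x - F l x) + b * (g x - G l x)) ^+ 2)).
  by apply: (le_trans (isqD_le (sqiZ a hFl) (sqiZ b hGl))); rewrite !isqZ // !mulrA.
by move=> x _; congr (_ ^+ 2); ring.
Qed.

(** Polarisation reduces the claim to convergence of second moments. *)
Lemma l2to_ip F f G g : (forall l, sqi (F l)) -> sqi f -> (forall l, sqi (G l)) ->
  sqi g -> l2to F f -> l2to G g ->
  (fun l => \int[mu]_(x in D) (F l x * G l x)) @ \oo --> \int[mu]_(x in D) (f x * g x).
Proof.
move=> hF hf hG hg cF cG.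
have P u v : sqi u -> sqi v -> \int[mu]_(x in D) (u x * v x) =
   2^-1 * (\int[mu]_(x in D) (1 * u x + 1 * v x) ^+ 2 -
     \int[mu]_(x in D) (u x) ^+ 2 - \int[mu]_(x in D) (v x) ^+ 2).
  by move=> hu hv; rewrite isq_lin //; field.
rewrite P // (eq_cvg _ _ (fun l => P _ _ (hF l) (hG l))).
apply: cvgMr; apply: cvgB; first apply: cvgB; apply: l2to_isq => //.
- by move=> l; exact: sqi_lin.
- exact: sqi_lin.
- exact: l2to_lin.
Qed.

(** Convergence of the extended integrals to 0 makes some difference [f - F N] square integrable,
    and then [f] is so too. *)
Lemma ge0_l2to0_sqi (F : nat -> T -> R) f : (forall l, sqi (F l)) -> measurable_fun D f ->
  ((fun l => \int[mu]_(x in D) ((f x - F l x) ^+ 2)%:E) @ \oo --> 0)%E ->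
  sqi f /\ l2to F f.
Proof.
move=> hF mf cF.
have [[N _ HN] cf] := (fine_cvgP _ _).1 cF.
split; last exact: cf.
have hs : sqi (fun x => f x - F N x).
  split; first by apply: measurable_funB => //; exact: (hF N).1.
  by have := HN N (leqnn N); rewrite fin_numElt => /andP[].
by apply: eq_sqi (sqiD hs (hF N)) => x _; rewrite subrK.
Qed.

Lemma l2to_EFin (F : nat -> T -> R) f : (forall l, sqi (F l)) -> sqi f -> l2to F f ->
  ((fun l => \int[mu]_(x in D) ((f x - F l x) ^+ 2)%:E) @ \oo --> 0)%E.
Proof.
move=> hF hf cF; apply/fine_cvgP; split; last exact: cF.
apply: nearW => l; apply: integrable_fin_num => //.
exact/sqi_integrable/sqiB.
Qed.

End SquareIntegrable.

Section SubSigmaAlgebra.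
Context d (Omega : measurableType d) (R : realType).
Variable (Pr : probability Omega R).
Variable G : set (set Omega).
Hypothesis sG : sigma_algebra setT G.
Implicit Types X Y : Omega -> R.

(** The measurable space generated by a sigma-algebra [G] has exactly [G] as its measurable sets, so
    the closure properties below are those of measurable functions. *)
Lemma rv_measurableP X :
  rv_measurable G X <-> measurable_fun setT (X : g_sigma_algebraType G -> R).
Proof.
split=> [mX _ Y mY|mX Y mY].
  by rewrite setTI measurable_g_measurableTypeE //; exact: mX.
by have := mX measurableT Y mY; rewrite setTI measurable_g_measurableTypeE.
Qed.

Lemma rv_measurable_sub (H : set (set Omega)) X : G `<=` H ->
  rv_measurable G X -> rv_measurable H X.
Proof. by move=> GH mX Y mY; exact/GH/mX. Qed.

Lemma rv_lin (a b : R) X Y : rv_measurable G X -> rv_measurable G Y ->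
  rv_measurable G (fun w => a * X w + b * Y w).
Proof.
move=> /rv_measurableP mX /rv_measurableP mY; apply/rv_measurableP.
by apply: measurable_funD; apply: measurable_funM => //; exact: measurable_cst.
Qed.

Lemma rvM X Y : rv_measurable G X -> rv_measurable G Y ->
  rv_measurable G (fun w => X w * Y w).
Proof.
move=> /rv_measurableP mX /rv_measurableP mY; apply/rv_measurableP.
exact: measurable_funM.
Qed.

Lemma rv_cst (a : R) : rv_measurable G (fun=> a).
Proof. by apply/rv_measurableP; exact: measurable_cst. Qed.

Lemma rvZ (a : R) X : rv_measurable G X -> rv_measurable G (fun w => a * X w).
Proof. by move=> mX; apply: rvM => //; exact: rv_cst. Qed.

Lemma rvD X Y : rv_measurable G X -> rv_measurable G Y ->
  rv_measurable G (fun w => X w + Y w).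
Proof.
move=> /rv_measurableP mX /rv_measurableP mY; apply/rv_measurableP.
exact: measurable_funD.
Qed.

Lemma rvB X Y : rv_measurable G X -> rv_measurable G Y ->
  rv_measurable G (fun w => X w - Y w).
Proof.
move=> /rv_measurableP mX /rv_measurableP mY; apply/rv_measurableP.
exact: measurable_funB.
Qed.

Lemma rv_sum (I : Type) (s : seq I) (X : I -> Omega -> R) :
  (forall i, rv_measurable G (X i)) -> rv_measurable G (fun w => \sum_(i <- s) X i w).
Proof.
move=> mX; elim: s => [|i s IH].
  by under eq_fun do rewrite big_nil; exact: rv_cst.
by under eq_fun do rewrite big_cons; exact: rvD.
Qed.

Lemma rv_indic (E : set Omega) : G E -> rv_measurable G (\1_E : Omega -> R).
Proof.
move=> GE; apply/rv_measurableP; apply: measurable_indic.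
by rewrite measurable_g_measurableTypeE.
Qed.

Lemma rv_comp (f : R -> R) X : measurable_fun setT f -> rv_measurable G X ->
  rv_measurable G (fun w => f (X w)).
Proof.
by move=> mf /rv_measurableP mX; apply/rv_measurableP; exact: measurableT_comp.
Qed.

Lemma rv_cvg (X : nat -> Omega -> R) Y : (forall l, rv_measurable G (X l)) ->
  (forall w, X ^~ w @ \oo --> Y w) -> rv_measurable G Y.
Proof.
move=> mX cX; apply/rv_measurableP.
apply: (@measurable_fun_cvg _ (g_sigma_algebraType G) R setT (fun l => X l)).
- by move=> l; exact/rv_measurableP.
- by move=> w _; exact: cX.
Qed.

Hypothesis GM : G `<=` measurable.

Lemma rv_measurable_fun X : rv_measurable G X -> measurable_fun setT X.
Proof. by move=> mX _ Y mY; rewrite setTI; exact/GM/mX. Qed.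

Hypothesis nullG : Pr.-negligible `<=` G.

(** Completeness: all subsets of the null set [E] where [X] and [Y] differ lie in [G], whatever [Y]
    does there. *)
Lemma rv_ae_eq X Y : rv_measurable G X -> {ae Pr, forall w, X w = Y w} ->
  rv_measurable G Y.
Proof.
move=> mX nE; pose E := [set w | ~ (X w = Y w)].
have GE : G E by exact: nullG.
move=> Z mZ.
have -> : Y @^-1` Z = (X @^-1` Z `\` E) `|` (Y @^-1` Z `&` E).
  apply/seteqP; split => w /=.
    move=> YZ; have [e|e] := pselect (X w = Y w); last by right.
    by left; rewrite e; split=> // /(_ e).
    by move=> [[XZ /contrapT <-]|[]].
have sU : G (Y @^-1` Z `&` E).
  apply: nullG; case: nE => A [mA A0 sA]; exists A; split => //.
  by move=> w [_ Ew]; exact: sA.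
have mE (A : set (g_sigma_algebraType G)) : measurable A <-> G A.
  by rewrite measurable_g_measurableTypeE.
by apply/mE; apply: measurableU; [apply: measurableD; apply/mE => //; exact: mX|exact/mE].
Qed.
End SubSigmaAlgebra.

Section Independence.
Context d (Omega : measurableType d) (R : realType).
Variable (Pr : probability Omega R).
Variables G H : set (set Omega).
Hypothesis sG : sigma_algebra setT G.
Hypothesis sH : sigma_algebra setT H.
Hypothesis GM : G `<=` measurable.
Hypothesis HM : H `<=` measurable.
Hypothesis GH : indep_sigma Pr G H.

Let OG := g_sigma_algebraType G.
Let OH := g_sigma_algebraType H.
Let iG (w : Omega) : OG := w.
Let iH (w : Omega) : OH := w.

Let idG_measurable : measurable_fun [set: Omega] iG.
Proof.
by move=> _ Y mY; rewrite setTI; apply: GM; rewrite measurable_g_measurableTypeE in mY.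
Qed.

Let idH_measurable : measurable_fun [set: Omega] iH.
Proof.
by move=> _ Y mY; rewrite setTI; apply: HM; rewrite measurable_g_measurableTypeE in mY.
Qed.

Let diag (w : Omega) : OG * OH := (w, w).

Let diag_measurable : measurable_fun [set: Omega] diag.
Proof.
by apply: (@measurable_fun_pair _ _ _ Omega OG OH iG iH); [exact: idG_measurable|exact: idH_measurable].
Qed.

HB.instance Definition _ := isMeasurableFun.Build _ _ _ _ iG idG_measurable.
HB.instance Definition _ := isMeasurableFun.Build _ _ _ _ iH idH_measurable.
HB.instance Definition _ := isMeasurableFun.Build _ _ _ _ diag diag_measurable.

Let PG : probability OG R := distribution Pr iG.
Let PH : probability OH R := distribution Pr iH.
Let PD : probability (OG * OH)%type R := distribution Pr diag.

Let PDE : forall A, measurable A -> (PG \x PH)%E A = PD A.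
Proof.
apply: product_measure_unique => A B mA mB.
rewrite measurable_g_measurableTypeE // in mA.
rewrite measurable_g_measurableTypeE // in mB.
exact: GH.
Qed.

(* Independence says that the law of [w |-> (w, w)] on [G x H] is the product
   measure, so that the claim is Fubini's theorem. *)
Lemma indep_expectation (X Y : Omega -> R) :
  rv_measurable G X -> rv_measurable H Y ->
  Pr.-integrable setT (EFin \o X) -> Pr.-integrable setT (EFin \o Y) ->
  Pr.-integrable setT (EFin \o (fun w => X w * Y w)) /\
  \int[Pr]_w (X w * Y w) = \int[Pr]_w X w * \int[Pr]_w Y w.
Proof.
move=> /(rv_measurableP sG) mX /(rv_measurableP sH) mY iX iY.
pose f (z : OG * OH) : \bar R := (X z.1 * Y z.2)%:E.
have mf : measurable_fun setT f.
  apply/measurable_EFinP; apply: measurable_funM.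
    exact: (measurableT_comp mX measurable_fst).
  exact: (measurableT_comp mY measurable_snd).
have iXG : PG.-integrable setT (EFin \o X).
  apply: (integrable_pushforward idG_measurable) => //; exact/measurable_EFinP.
have iYH : PH.-integrable setT (EFin \o Y).
  apply: (integrable_pushforward idH_measurable) => //; exact/measurable_EFinP.
have EXG : (\int[PG]_x (X x)%:E = \int[Pr]_x (X x)%:E)%E.
  have /= := @integral_pushforward _ _ _ _ R _ idG_measurable Pr setT (EFin \o X).
  by rewrite preimage_setT; apply => //; exact/measurable_EFinP.
have EYH : (\int[PH]_x (Y x)%:E = \int[Pr]_x (Y x)%:E)%E.
  have /= := @integral_pushforward _ _ _ _ R _ idH_measurable Pr setT (EFin \o Y).
  by rewrite preimage_setT; apply => //; exact/measurable_EFinP.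
have iXY : (PG \x PH)%E.-integrable setT f.
  apply/(integrable12ltyP _ _ mf).
  have e x : (\int[PH]_y `|f (x, y)| = `|X x|%:E * \int[PH]_y `|Y y|%:E)%E.
    rewrite -ge0_integralZl //; last by apply/measurable_EFinP; exact: measurableT_comp.
    by apply: eq_integral => y _; rewrite /f /= normrM EFinM.
  under eq_integral do rewrite e.
  have /integrableP[_ fY] := iYH; have /integrableP[_ fX] := iXG.
  have fYn : (\int[PH]_y `|Y y|%:E \is a fin_num)%E.
    by rewrite ge0_fin_numE // integral_ge0.
  rewrite -(fineK fYn) ge0_integralZr // ?lee_fin ?fine_ge0 ?integral_ge0 //.
    by rewrite muleC lte_mul_pinfty // lee_fin fine_ge0 // integral_ge0.
  by apply/measurable_EFinP; exact: measurableT_comp.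
have iXYD : PD.-integrable setT f.
  move: iXY => /integrableP[_ fin]; apply/integrableP; split => //.
  by rewrite (eq_measure_integral (PG \x PH)%E) // => A mA _; apply: esym; exact: PDE.
have mfd : measurable_fun setT (f \o diag) by exact: measurableT_comp.
have iP : Pr.-integrable setT (f \o diag).
  move: iXYD => /integrableP[_ fin]; apply/integrableP; split => //.
  move: fin; rewrite (ge0_integral_pushforward diag_measurable) //.
  exact: measurableT_comp.
have eD : (\int[PD]_z f z = \int[Pr]_w (f \o diag) w)%E.
  have := @integral_pushforward _ _ _ _ R _ diag_measurable Pr setT f.
  by rewrite preimage_setT; apply.
split; first exact: iP.
rewrite {1}/Rintegral -[(\int[Pr]_x _)%E]eD (eq_measure_integral (PG \x PH)%E); last first.
  by move=> A mA _; apply: esym; exact: PDE.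
rewrite -integral12_prod_meas1 // /fubini_F.
have e x : (\int[PH]_y f (x, y) = (X x * \int[Pr]_w Y w)%:E)%E.
  under eq_integral do rewrite /f EFinM.
  rewrite (@eq_integral _ OH _ _ _ (fun y => (X x)%:E * (EFin \o Y) y)%E) //.
  by rewrite integralZl //= EYH EFinM EFin_Rintegral.
under eq_integral do rewrite e.
by rewrite -[LHS]/(\int[PG]_x (X x * \int[Pr]_w Y w)) RintegralZr // /Rintegral EXG.
Qed.

End Independence.

(** * Second-order properties of Wiener noise *)

Section Noise.
Context d (Omega : measurableType d) (R : realType).
Variable (Pr : probability Omega R).
Variable F : R -> set (set Omega).
Hypothesis hF : usual_filtration Pr F.
Variables (q : nat) (K : 'M[R]_q).

Local Notation sqO := (sqi Pr setT).

Definition incr (W : R -> Omega -> 'cV[R]_q) (i : 'I_q) (a b : R) (w : Omega) : R :=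
  W b w i 0 - W a w i 0.

Lemma sqO_cst (c : R) : sqO (fun=> c).
Proof.
apply: integrable_sqi; first exact: measurable_cst.
exact: (finite_measure_integrable_cst Pr (c ^+ 2) measurableT).
Qed.

Lemma sqO_integrable X : sqO X -> Pr.-integrable setT (EFin \o X).
Proof.
move=> hX; have := sqi_mul measurableT hX (sqO_cst 1).
by apply: eq_integrable => // w _ /=; rewrite mulr1.
Qed.

(* The L^2 properties of a Wiener process, which are stable under modification
   on a null set. *)
Record noise (W : R -> Omega -> 'cV[R]_q) : Prop := Noise {
  noise_adapted : forall t i, 0 <= t -> rv_measurable (F t) (fun w => W t w i 0);
  noise_sqi : forall a b i xi, 0 <= a -> a <= b -> rv_measurable (F a) xi -> sqO xi ->
    sqO (fun w => xi w * incr W i a b w);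
  noise_mean : forall a b i Z xi, 0 <= a -> a <= b -> rv_measurable (F a) Z -> sqO Z ->
    rv_measurable (F a) xi -> sqO xi -> \int[Pr]_w (Z w * (xi w * incr W i a b w)) = 0;
  noise_cov : forall a b i j xi eta, 0 <= a -> a <= b -> rv_measurable (F a) xi -> sqO xi ->
    rv_measurable (F a) eta -> sqO eta ->
    \int[Pr]_w ((xi w * incr W i a b w) * (eta w * incr W j a b w)) =
      K i j * (b - a) * \int[Pr]_w (xi w * eta w) }.

Lemma Fsigma (t : R) : 0 <= t -> sigma_algebra setT (F t).
Proof. by case: hF => h _ _ _ /h[]. Qed.

Lemma Fmeas (t : R) : 0 <= t -> F t `<=` measurable.
Proof. by case: hF => h _ _ _ /h[]. Qed.

Lemma Fsub (s t : R) : 0 <= s -> s <= t -> F s `<=` F t.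
Proof. by case: hF => _ h _ _; exact: h. Qed.

Lemma Fnull (t : R) : 0 <= t -> Pr.-negligible `<=` F t.
Proof. by case: hF => _ _ _ h; exact: h. Qed.

(** Factors measurable at time [a] are independent of the increment over [[a, b]], so all
    expectations split. The covariance of the increment follows from that of [W a] and [W b], since
    the products of [W a] with the increment have mean zero. *)
Lemma wiener_noise W : wiener Pr F K W -> noise W.
Proof.
move=> [adW _ momW _ indW].
have ad (t : R) i : 0 <= t -> rv_measurable (F t) (fun w => W t w i 0).
  by move=> t0; apply: adW; rewrite /= in_itv /= t0.
have mW (t : R) i : 0 <= t -> measurable_fun setT (fun w => W t w i 0).
  by move=> t0; apply: (rv_measurable_fun (Fmeas t0)); exact: ad.
have cW (t : R) i j : 0 <= t -> (\int[Pr]_w (W t w i 0 * W t w j 0)%:E = (K i j * t)%:E)%E.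
  by move=> t0; have [_ /(_ i j)] := momW t t0; rewrite unlock.
have sW (t : R) i : 0 <= t -> sqO (fun w => W t w i 0).
  move=> t0; split; first exact: mW.
  by under eq_integral do rewrite expr2; rewrite cW // ltry.
have eW (t : R) i : 0 <= t -> \int[Pr]_w W t w i 0 = 0.
  by move=> t0; have [/(_ i) + _] := momW t t0; rewrite unlock /Rintegral => ->.
have sqI := sqO_integrable.
have rW (t : R) i j : 0 <= t -> \int[Pr]_w (W t w i 0 * W t w j 0) = K i j * t.
  by move=> t0; rewrite /Rintegral cW.
have main (a b : R) : 0 <= a -> a <= b -> exists H, [/\ sigma_algebra setT H, H `<=` measurable,
    indep_sigma Pr (F a) H & forall i, rv_measurable H (incr W i a b)].
  move=> a0 ab; have b0 := le_trans a0 ab.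
  have := indW a (b - a) a0; rewrite subr_ge0 => /(_ ab) ind.
  exists (sigma_rv (fun w => W (a + (b - a)) w - W a w)); split => //.
  - exact: smallest_sigma_algebra.
  - apply: smallest_sub; first exact: sigma_algebra_measurable.
    move=> E [i [Y [mY ->]]]; rewrite -[X in measurable X]setTI.
    have : measurable_fun setT (fun w => (W (a + (b - a)) w - W a w) i 0).
      under eq_fun do rewrite !mxE; rewrite subrKC.
      by apply: measurable_funB; exact: mW.
    by apply.
  - move=> i Y mY; apply: sub_sigma_algebra; exists i, Y; split => //.
    by apply/seteqP; split => w /=; rewrite /incr !mxE subrKC.
have sI (a b : R) i : 0 <= a -> a <= b -> sqO (incr W i a b).
  by move=> a0 ab; apply: sqiB => //; apply: sW => //; exact: le_trans ab.
have eI (a b : R) i : 0 <= a -> a <= b -> \int[Pr]_w incr W i a b w = 0.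
  move=> a0 ab; rewrite RintegralB //; try (by apply: sqI; apply: sW => //; exact: le_trans ab).
  by rewrite !eW // ?subrr // (le_trans a0).
have cI (a b : R) i j : 0 <= a -> a <= b ->
    \int[Pr]_w (incr W i a b w * incr W j a b w) = K i j * (b - a).
  move=> a0 ab; have b0 := le_trans a0 ab.
  have [H [sH HM ind mH]] := main a b a0 ab.
  have z i' j' : \int[Pr]_w (W a w i' 0 * incr W j' a b w) = 0.
    have [_ ->] := indep_expectation (Fsigma a0) sH (Fmeas a0) HM ind (ad a i' a0) (mH j')
      (sqI _ (sW a i' a0)) (sqI _ (sI a b j' a0 ab)).
    by rewrite eW // mul0r.
  have m1 := sqi_mul measurableT (sW b i b0) (sW b j b0).
  have m2 := sqi_mul measurableT (sW a i a0) (sW a j a0).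
  have m3 := sqi_mul measurableT (sW a i a0) (sI a b j a0 ab).
  have m4 := sqi_mul measurableT (sW a j a0) (sI a b i a0 ab).
  rewrite (@eq_Rintegral _ _ _ _ _ (fun w => 1 * (1 * (W b w i 0 * W b w j 0) +
    (-1) * (W a w i 0 * W a w j 0)) + 1 * ((-1) * (W a w i 0 * incr W j a b w) +
      (-1) * (W a w j 0 * incr W i a b w)))); last by move=> w _; rewrite /incr; ring.
  rewrite RintegralL //; try exact: integrable_lin.
  by rewrite !RintegralL // !z !rW //; ring.
split=> //.
- move=> a b i xi a0 ab mxi hxi; have [H [sH HM ind mH]] := main a b a0 ab.
  have mH2 := rvM sH (mH i) (mH i); have mx2 := rvM (Fsigma a0) mxi mxi.
  have [+ _] := indep_expectation (Fsigma a0) sH (Fmeas a0) HM ind mx2 mH2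
      (sqi_mul measurableT hxi hxi) (sqi_mul measurableT (sI a b i a0 ab) (sI a b i a0 ab)).
  move=> h; apply: integrable_sqi => //.
    by apply: measurable_funM; [case: hxi|case: (sI a b i a0 ab)].
  by apply: eq_integrable h => // w _ /=; congr (_%:E); ring.
- move=> a b i Z xi a0 ab mZ hZ mxi hxi; have [H [sH HM ind mH]] := main a b a0 ab.
  have [_ e] := indep_expectation (Fsigma a0) sH (Fmeas a0) HM ind
    (rvM (Fsigma a0) mZ mxi) (mH i) (sqi_mul measurableT hZ hxi) (sqI _ (sI a b i a0 ab)).
  under eq_Rintegral do rewrite mulrA.
  by rewrite e eI // mulr0.
- move=> a b i j xi eta a0 ab mxi hxi meta heta; have [H [sH HM ind mH]] := main a b a0 ab.
  have [_ e] := indep_expectation (Fsigma a0) sH (Fmeas a0) HM ind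
    (rvM (Fsigma a0) mxi meta) (rvM sH (mH i) (mH j)) (sqi_mul measurableT hxi heta)
    (sqi_mul measurableT (sI a b i a0 ab) (sI a b j a0 ab)).
  under eq_Rintegral do rewrite mulrACA.
  by rewrite e cI // mulrC.
Qed.

End Noise.

(** * Fubini's theorem on strips of time and chance *)

Section Strip.
Context d (Omega : measurableType d) (R : realType).
Variable (Pr : probability Omega R).
Local Notation mu := (@lebesgue_measure R).
Local Notation muP := (mu \x Pr)%E.
Variable D : set (measurableTypeR R).
Hypothesis mD : measurable D.
Local Notation DT := (D `*` [set: Omega]).

Lemma measurable_strip : measurable DT.
Proof. exact: measurableX. Qed.

(** Integration over a strip is integration over the whole product after extension by zero; this
    identifies the sections of the extension. *)
Let patchE (f : measurableTypeR R * Omega -> \bar R) s w :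
  (f \_ DT) (s, w) = ((fun s => f (s, w)) \_ D) s.
Proof.
rewrite /patch; have [sD|sD] := pselect (D s); first by rewrite !mem_set.
by rewrite !memNset // => -[].
Qed.

Lemma measurable_patch (f : measurableTypeR R * Omega -> \bar R) :
  measurable_fun DT f -> measurable_fun setT (f \_ DT).
Proof. by move=> mf; apply/(measurable_restrictT _ measurable_strip). Qed.

Section Tonelli.
Variable f : measurableTypeR R * Omega -> \bar R.
Hypothesis mf : measurable_fun DT f.
Hypothesis f0 : forall z, D z.1 -> (0 <= f z)%E.

Let f0' z : (0 <= (f \_ DT) z)%E.
Proof. by apply: erestrict_ge0 => -[s w] [Ds _]; exact: f0. Qed.

Lemma tonelli1 : (\int[muP]_(z in DT) f z = \int[mu]_(s in D) \int[Pr]_w f (s, w))%E.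
Proof.
rewrite integral_mkcond (fubini_tonelli1 _ (measurable_patch mf) f0') [RHS]integral_mkcond.
apply: eq_integral => s _; rewrite /fubini_F.
under eq_integral do rewrite patchE.
by rewrite /patch; case: ifP => // _; rewrite integral0.
Qed.

Lemma tonelli2 : (\int[muP]_(z in DT) f z = \int[Pr]_w \int[mu]_(s in D) f (s, w))%E.
Proof.
rewrite integral_mkcond (fubini_tonelli2 _ (measurable_patch mf) f0').
apply: eq_integral => w _; rewrite /fubini_G [RHS]integral_mkcond.
by apply: eq_integral => s _; rewrite patchE.
Qed.

Lemma measurable_tonelli : measurable_fun setT (fun w => \int[mu]_(s in D) f (s, w))%E.
Proof.
have := measurable_fun_fubini_tonelli_G _ (m1 := mu) (measurable_patch mf) f0'.
apply: eq_measurable_fun => w _; rewrite /fubini_G [RHS]integral_mkcond.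
by apply: eq_integral => s _; rewrite patchE.
Qed.

Lemma measurable_tonelli1 : measurable_fun D (fun s => \int[Pr]_w f (s, w))%E.
Proof.
have := measurable_fun_fubini_tonelli_F _ (m2 := Pr) (measurable_patch mf) f0'.
move=> /(measurable_funS measurableT (@subsetT _ D)).
apply: eq_measurable_fun => s sD; rewrite /fubini_F.
by apply: eq_integral => w _; rewrite patchE /patch sD.
Qed.
End Tonelli.

Section FubiniStrip.
Variable f : measurableTypeR R * Omega -> R.
Hypothesis fi : muP.-integrable DT (EFin \o f).

Let fi' : muP.-integrable setT ((EFin \o f) \_ DT).
Proof. exact/(integrable_mkcond _ measurable_strip). Qed.

Lemma fubini_ae2 : {ae Pr, forall w, mu.-integrable D (EFin \o (fun s => f (s, w)))}.
Proof.
apply: filterS (ae_integrable2 fi') => w.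
rewrite (_ : (fun s => _) = (EFin \o (fun s => f (s, w))) \_ D); last first.
  by apply/funext => s; rewrite patchE.
by move=> h; apply/(integrable_mkcond _ mD).
Qed.

Lemma fubini_ae1 : {ae mu, forall s, D s -> Pr.-integrable setT (EFin \o (fun w => f (s, w)))}.
Proof.
apply: filterS (ae_integrable1 fi') => s + sD.
rewrite (_ : (fun w => _) = (EFin \o (fun w => f (s, w)))) //.
by apply/funext => w; rewrite patchE /patch mem_set.
Qed.

Let G2 : (\int[muP]_(z in DT) (f z)%:E = \int[Pr]_w \int[mu]_(s in D) (f (s, w))%:E)%E.
Proof.
rewrite integral_mkcond -(integral21_prod_meas1 fi').
apply: eq_integral => w _; rewrite /fubini_G [RHS]integral_mkcond.
by apply: eq_integral => s _; rewrite patchE.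
Qed.

Let G1 : (\int[muP]_(z in DT) (f z)%:E = \int[mu]_(s in D) \int[Pr]_w (f (s, w))%:E)%E.
Proof.
rewrite integral_mkcond -(integral12_prod_meas1 fi') [RHS]integral_mkcond.
apply: eq_integral => s _; rewrite /fubini_F.
under eq_integral do rewrite patchE.
by rewrite /patch; case: ifP => // _; rewrite integral0.
Qed.

Lemma measurable_fubini2 : measurable_fun setT (fun w => \int[mu]_(s in D) f (s, w)).
Proof.
apply: (measurableT_comp (fine_measurable measurableT)).
have := measurable_fubini_G fi'.
apply: eq_measurable_fun => w _; rewrite /fubini_G [RHS]integral_mkcond.
by apply: eq_integral => s _; rewrite patchE.
Qed.

Let mint1 : measurable_fun D (fun s => \int[Pr]_w (f (s, w))%:E)%E.
Proof.
have := measurable_fubini_F fi'.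
move=> /(measurable_funS measurableT (@subsetT _ D)).
apply: eq_measurable_fun => s sD; rewrite /fubini_F.
by apply: eq_integral => w _; rewrite patchE /patch sD.
Qed.

Lemma measurable_fubini1 : measurable_fun D (fun s => \int[Pr]_w f (s, w)).
Proof. exact: (measurableT_comp (fine_measurable measurableT)). Qed.

(** The inner real integral takes a default value at those [w] whose section is not integrable. They
    form a null set, so the real and the extended iterated integrals agree. *)
Lemma fubini2 : \int[muP]_(z in DT) f z = \int[Pr]_w \int[mu]_(s in D) f (s, w).
Proof.
rewrite /Rintegral G2; congr fine; apply: ae_eq_integral => //.
- have := measurable_fubini_G fi'.
  apply: eq_measurable_fun => w _; rewrite /fubini_G [RHS]integral_mkcond.
  by apply: eq_integral => s _; rewrite patchE.
- apply/measurable_EFinP; exact: measurable_fubini2.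
- apply: filterS fubini_ae2 => w iw _; rewrite fineK //; exact: integrable_fin_num iw.
Qed.

Lemma fubini1 : \int[muP]_(z in DT) f z = \int[mu]_(s in D) \int[Pr]_w f (s, w).
Proof.
rewrite /Rintegral G1; congr fine; apply: ae_eq_integral => //.
- apply/measurable_EFinP; exact: measurable_fubini1.
- apply: filterS fubini_ae1 => s iw sD; rewrite fineK //; exact: integrable_fin_num (iw sD).
Qed.

End FubiniStrip.
End Strip.

(** * The Ito integral *)

Section SimpleIntegrals.
Context d (Omega : measurableType d) (R : realType).
Variable (Pr : probability Omega R).
Variable F : R -> set (set Omega).
Hypothesis hF : usual_filtration Pr F.
Variables (q : nat) (K : 'M[R]_q) (W : R -> Omega -> 'cV[R]_q).
Hypothesis nW : noise Pr F K W.
Local Notation mu := (@lebesgue_measure R).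
Local Notation muP := (mu \x Pr)%E.
Local Notation sqO := (sqi Pr setT).

(* Generalised simple processes are finite sums of [xi 1_]a, b]] with [xi] square
   integrable and [F a]-measurable; the intervals may overlap, so that sums of
   simple processes are concatenations. *)
Record velt (t : R) := Velt {
  va : R; vb : R; vx : Omega -> R;
  va_ge0 : 0 <= va; vab : va <= vb; vb_le : vb <= t;
  vx_meas : rv_measurable (F va) vx; vx_sqi : sqO vx }.

Definition sp t (f : seq (velt t)) (s : R) (w : Omega) : R :=
  \sum_(e <- f) vx e w * \1_(`]va e, vb e]%classic) s.

Definition si (i : 'I_q) t (f : seq (velt t)) (w : Omega) : R :=
  \sum_(e <- f) vx e w * incr W i (va e) (vb e) w.

Definition sqP (t : R) (H : R -> Omega -> R) :=
  sqi muP (`[0, t] `*` setT) (fun z : measurableTypeR R * Omega => H z.1 z.2).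

Definition strip_int (t : R) (H : R -> Omega -> R) : R :=
  \int[muP]_(z in `[0, t]%classic `*` setT) H z.1 z.2.

Lemma mstrip t : measurable (`[0, t]%classic `*` [set: Omega] : set (measurableTypeR R * Omega)).
Proof. by apply: measurable_strip; exact: measurable_itv. Qed.

Lemma velt_meas s t (e : velt t) : va e <= s -> rv_measurable (F s) (vx e).
Proof. by move=> h; apply: rv_measurable_sub (vx_meas e); apply: (Fsub hF) => //; exact: va_ge0. Qed.

Lemma velt_int_sqi i t (e : velt t) : sqO (fun w => vx e w * incr W i (va e) (vb e) w).
Proof.
apply: (noise_sqi nW) (vx_sqi e) => //; [exact: va_ge0|exact: vab|exact: vx_meas].
Qed.

Lemma si_sqi i t (f : seq (velt t)) : sqO (si i f).
Proof. by apply: sqi_sum => // e; exact: velt_int_sqi. Qed.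

Lemma incr_meas i (a b s : R) : 0 <= a -> a <= s -> 0 <= b -> b <= s ->
  rv_measurable (F s) (incr W i a b).
Proof.
move=> a0 as_ b0 bs; have s0 := le_trans a0 as_.
apply: (rvB (Fsigma hF s0)).
  by apply: rv_measurable_sub (noise_adapted nW _ b0); exact: (Fsub hF).
by apply: rv_measurable_sub (noise_adapted nW _ a0); exact: (Fsub hF).
Qed.

Lemma velt_int_meas i s t (e : velt t) : vb e <= s ->
  rv_measurable (F s) (fun w => vx e w * incr W i (va e) (vb e) w).
Proof.
move=> h; have a0 := va_ge0 e; have ab := vab e; have as_ := le_trans ab h.
apply: (rvM (Fsigma hF (le_trans a0 as_))); first exact: velt_meas.
by apply: incr_meas => //; exact: le_trans ab.
Qed.

Lemma si_meas i t (f : seq (velt t)) : 0 <= t -> rv_measurable (F t) (si i f).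
Proof. by move=> t0; apply: (rv_sum (Fsigma hF t0)) => e; apply: velt_int_meas; exact: vb_le. Qed.

(** [K i j] is the mean of the product of the increments over [[0, 1]], which is symmetric. *)
Let noise_sym i j : K i j = K j i.
Proof.
have m1 : rv_measurable (F 0) (fun=> 1 : R) by exact: (rv_cst (Fsigma hF (lexx 0))).
have c i' j' := noise_cov nW i' j' (lexx 0) ler01 m1 (sqO_cst Pr 1) m1 (sqO_cst Pr 1).
have E1 : \int[Pr]_w ((1 : R) * 1) = 1.
  by rewrite Rintegral_cst // !mul1r; exact: (congr1 fine (probability_setT Pr)).
have := c i j; have := c j i; rewrite !E1 subr0 !mulr1 => <- <-.
by apply: eq_Rintegral => w _; rewrite mulrC.
Qed.

(** The length of the intersection of []a, b]] and []a', b']]. *)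
Definition overlap (a b a' b' : R) := Num.max 0 (Num.min b b' - Num.max a a').

(** The part of the longer increment beyond [b] has mean zero against everything known at time
    [b]. *)
Let core i j (a b b' : R) xi eta : 0 <= a -> a <= b -> b <= b' ->
  rv_measurable (F a) xi -> sqO xi -> rv_measurable (F a) eta -> sqO eta ->
  \int[Pr]_w ((xi w * incr W i a b w) * (eta w * incr W j a b' w)) =
    K i j * (b - a) * \int[Pr]_w (xi w * eta w).
Proof.
move=> a0 ab bb' mx hx me he; have b0 := le_trans a0 ab.
have Fab : F a `<=` F b by exact: (Fsub hF).
have mx' : rv_measurable (F b) xi by exact: rv_measurable_sub mx.
have me' : rv_measurable (F b) eta by exact: rv_measurable_sub me.
have h1 := noise_sqi nW i a0 ab mx hx.
have h2 := noise_sqi nW j a0 ab me he.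
have h3 := noise_sqi nW j b0 bb' me' he.
rewrite (@eq_Rintegral _ _ _ _ _ (fun w => (xi w * incr W i a b w) * (eta w * incr W j a b w) +
   (xi w * incr W i a b w) * (eta w * incr W j b b' w))); last first.
  by move=> w _; rewrite /incr; ring.
rewrite RintegralD //; try exact: sqi_mul.
rewrite (noise_cov nW) // (noise_mean nW) ?addr0 //.
apply: (rvM (Fsigma hF b0)) => //; exact: incr_meas.
Qed.

(** The earlier increment is cut at [a']. Its part before [a'] is known at [a'] and hence orthogonal
    to the later increment; the rest starts at [a'] as well, which is the situation of [core]. *)
Let core2 i j (a b a' b' : R) xi eta : 0 <= a -> a <= b -> a <= a' -> a' <= b' ->
  rv_measurable (F a) xi -> sqO xi -> rv_measurable (F a') eta -> sqO eta ->
  \int[Pr]_w ((xi w * incr W i a b w) * (eta w * incr W j a' b' w)) =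
    K i j * overlap a b a' b' * \int[Pr]_w (xi w * eta w).
Proof.
move=> a0 ab aa' ab' mx hx me he; have a'0 := le_trans a0 aa'.
have h1 := noise_sqi nW i a0 ab mx hx.
have h2 := noise_sqi nW j a'0 ab' me he.
have mx' : rv_measurable (F a') xi by apply: rv_measurable_sub mx; exact: (Fsub hF).
have S := Fsigma hF a'0.
have [ba'|a'b] := leP b a'.
  rewrite (noise_mean nW) //.
    rewrite /overlap (max_r aa') max_l ?mulr0 ?mul0r // subr_le0.
    by rewrite ge_min ba'.
  by apply: (rvM S) => //; apply: incr_meas => //; exact: le_trans ab.
have ha := noise_sqi nW i a0 aa' mx hx.
have hb := noise_sqi nW i a'0 (ltW a'b) mx' hx.
rewrite (@eq_Rintegral _ _ _ _ _ (fun w => (xi w * incr W i a a' w) * (eta w * incr W j a' b' w) +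
   (xi w * incr W i a' b w) * (eta w * incr W j a' b' w))); last first.
  by move=> w _; rewrite /incr; ring.
rewrite RintegralD //; try exact: sqi_mul.
rewrite (noise_mean nW) // ?add0r; last first.
  by apply: (rvM S) => //; apply: incr_meas.
rewrite /overlap (max_r aa').
have [bb'|b'b] := leP b b'.
  by rewrite core // ?(ltW a'b) // max_r // subr_ge0 ltW.
rewrite max_r ?subr_ge0 // noise_sym.
under eq_Rintegral do rewrite mulrC.
rewrite core // ?(ltW b'b) //; congr (_ * _).
by apply: eq_Rintegral => w _; rewrite mulrC.
Qed.

Let overlapC a b a' b' : overlap a b a' b' = overlap a' b' a b.
Proof. by rewrite /overlap [Num.min b b']minC [Num.max a a']maxC. Qed.

Lemma velt_int_cov i j t (e e' : velt t) :
  \int[Pr]_w ((vx e w * incr W i (va e) (vb e) w) * (vx e' w * incr W j (va e') (vb e') w)) =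
    K i j * overlap (va e) (vb e) (va e') (vb e') * \int[Pr]_w (vx e w * vx e' w).
Proof.
have [h|/ltW h] := leP (va e) (va e').
  by apply: core2 h _ _ _ _ _; case: e; case: e'.
rewrite noise_sym overlapC.
under eq_Rintegral do rewrite mulrC.
rewrite core2 //; try (by case: e {h}); try (by case: e' {h}).
by congr (_ * _); apply: eq_Rintegral => w _; rewrite mulrC.
Qed.

Lemma sqP_cst t X : sqO X -> sqP t (fun _ w => X w).
Proof.
move=> hX.
have m : measurable_fun (`[0, t]%classic `*` [set: Omega])
    (fun z : measurableTypeR R * Omega => X z.2).
  by apply: measurable_funTS; apply: (measurableT_comp hX.1 measurable_snd).
split=> //.
rewrite tonelli2 //=; first last.
- by move=> z _; rewrite lee_fin sqr_ge0.
- by apply/measurable_EFinP; exact: measurable_funX.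
under eq_integral do rewrite integral_cst //.
rewrite ge0_integralZr //; first last.
- by move=> w _; rewrite lee_fin sqr_ge0.
- by apply/measurable_EFinP; apply: measurable_funX; exact: hX.1.
rewrite muleC lte_mul_pinfty //; last exact: hX.2.
by rewrite /= lebesgue_measure_itv /=; case: ifP.
Qed.

Lemma velt_proc_sqP t t' (e : velt t) :
  sqP t' (fun s w => vx e w * \1_(`]va e, vb e]%classic) s).
Proof.
have hX := vx_sqi e.
apply: (dominated_sqi (mstrip t') _ _ (sqP_cst t' hX)).
  apply: measurable_funTS; apply: measurable_funM.
    exact: (measurableT_comp hX.1 measurable_snd).
  apply: (measurableT_comp _ measurable_fst).
  by apply: measurable_indic; exact: measurable_itv.
move=> z _; rewrite normrM /indic; case: (_ \in _); rewrite ?normr1 ?mulr1 //.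
by rewrite normr0 mulr0.
Qed.

Lemma sp_sqP t t' (f : seq (velt t)) : sqP t' (sp f).
Proof. by apply: (sqi_sum (mstrip t')) => e; exact: velt_proc_sqP. Qed.

Lemma velt_proc_ip t (e e' : velt t) :
  strip_int t (fun s w => (vx e w * \1_(`]va e, vb e]%classic) s) *
     (vx e' w * \1_(`]va e', vb e']%classic) s)) =
    overlap (va e) (vb e) (va e') (vb e') * \int[Pr]_w (vx e w * vx e' w).
Proof.
have h := sqi_mul (mstrip t) (velt_proc_sqP t e) (velt_proc_sqP t e').
rewrite /strip_int (fubini1 _ h); last exact: measurable_itv.
have hx := sqi_mul measurableT (vx_sqi e) (vx_sqi e').
have mI : measurable (`]va e, vb e]%classic `&` `]va e', vb e']%classic).
  by apply: measurableI; exact: measurable_itv.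
set J := `]va e, vb e]%classic `&` `]va e', vb e']%classic.
transitivity (\int[mu]_(s in `[0, t]%classic) ((\int[Pr]_w (vx e w * vx e' w)) * \1_J s)).
  apply: eq_Rintegral => s _ /=; rewrite /J indicI -RintegralZr //.
  by apply: eq_Rintegral => w _; rewrite /= mulrACA.
have eJ : J `&` `[0, t]%classic =
    `]Num.max (va e) (va e'), Num.min (vb e) (vb e')]%classic.
  have := va_ge0 e; have := vb_le e => ? ?; apply/seteqP; split => s; rewrite /J /= !in_itv /= gt_max le_min.
    by move=> [[/andP[-> ->] /andP[-> ->]] _].
  move=> /andP[/andP[h1 h2] /andP[h3 h4]]; rewrite h1 h2 h3 h4; split=> //.
  by apply/andP; split; lra.
have lJ : mu (J `&` `[0, t]%classic) = (overlap (va e) (vb e) (va e') (vb e'))%:E.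
  rewrite eJ lebesgue_measure_itv /= lte_fin /overlap; case: ltP => le_mM.
    by rewrite -EFinB; congr EFin; rewrite [RHS]max_r // subr_ge0 ltW.
  by rewrite max_l // subr_le0.
have iI : mu.-integrable `[0, t]%classic (EFin \o \1_J).
  apply: ge0_integrable; [exact: measurable_indic|by []|].
  apply: le_lt_trans (ltry (overlap (va e) (vb e) (va e') (vb e'))).
  by rewrite -lJ integral_indic.
rewrite RintegralZl //.
rewrite mulrC; congr (_ * _); rewrite /Rintegral integral_indic //.
exact: (congr1 fine lJ).
Qed.

(** Both sides are bilinear in the simple processes. For a single pair of elements both equal
    [K i j] times the overlap of the intervals times the mean of the product of the coefficients. *)
Lemma isometry i j t (f g : seq (velt t)) :
  \int[Pr]_w (si i f w * si j g w) = K i j * strip_int t (fun s w => sp f s w * sp g s w).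
Proof.
pose X i (e : velt t) w := vx e w * incr W i (va e) (vb e) w.
pose Y (e : velt t) (z : measurableTypeR R * Omega) :=
  vx e z.2 * \1_(`]va e, vb e]%classic) z.1.
transitivity (\sum_(e <- f) \sum_(e' <- g) \int[Pr]_w (X i e w * X j e' w)).
  rewrite (@eq_Rintegral _ _ _ _ _ (fun w => \sum_(e <- f) \sum_(e' <- g) (X i e w * X j e' w))).
    have iX e e' : Pr.-integrable setT (EFin \o (fun w => X i e w * X j e' w)).
      by apply: sqi_mul => //; exact: velt_int_sqi.
    rewrite Rintegral_sumr //; last by move=> e; exact: integrable_sumr.
    by apply: eq_bigr => e _; rewrite Rintegral_sumr.
  by move=> w _; rewrite /si mulr_suml; apply: eq_bigr => e _; rewrite mulr_sumr.
transitivity (K i j * \sum_(e <- f) \sum_(e' <- g)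
   \int[muP]_(z in `[0, t]%classic `*` setT) (Y e z * Y e' z)).
  rewrite mulr_sumr; apply: eq_bigr => e _; rewrite mulr_sumr; apply: eq_bigr => e' _.
  by rewrite velt_int_cov -mulrA -velt_proc_ip.
congr (_ * _); rewrite /strip_int.
have iY e e' : muP.-integrable (`[0, t]%classic `*` setT) (EFin \o (fun z => Y e z * Y e' z)).
  by apply: (sqi_mul (mstrip t)); exact: velt_proc_sqP.
rewrite (@eq_Rintegral _ _ _ _ _ (fun z => \sum_(e <- f) \sum_(e' <- g) (Y e z * Y e' z))).
  rewrite (Rintegral_sumr (mstrip t)); last first.
    by move=> e; apply: (integrable_sumr (mstrip t)).
  by apply: eq_bigr => e _; rewrite (Rintegral_sumr (mstrip t)).
by move=> z _; rewrite /sp mulr_suml; apply: eq_bigr => e _; rewrite mulr_sumr.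
Qed.

End SimpleIntegrals.

Section L2Limits.
Context d (T : measurableType d) (R : realType).
Variables (mu : {measure set T -> \bar R}).
Implicit Types (A B : set T) (f : T -> R).

Lemma sqi_subset A B f : measurable A -> measurable B -> A `<=` B -> sqi mu B f ->
  sqi mu A f /\ \int[mu]_(x in A) f x ^+ 2 <= \int[mu]_(x in B) f x ^+ 2.
Proof.
move=> mA mB AB hf; have iB := sqi_integrable hf.
have iA : mu.-integrable A (EFin \o (fun x => f x ^+ 2)) by exact: integrableS iB.
split; first by apply: integrable_sqi => //; exact: measurable_funS hf.1.
rewrite -lee_fin !EFin_Rintegral //; apply: ge0_subset_integral => //.
- by case/integrableP: iB.
- by move=> x _; rewrite lee_fin sqr_ge0.
Qed.

Lemma l2to_subset A B (F : nat -> T -> R) f : measurable A -> measurable B -> A `<=` B ->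
  (forall l, sqi mu B (F l)) -> sqi mu B f -> l2to mu B F f -> l2to mu A F f.
Proof.
move=> mA mB AB hF hf cF; apply: (squeeze_cvgr _ (cvg_cst 0) cF); apply: nearW => l.
by rewrite isq_ge0 /=; apply: (sqi_subset mA mB AB _).2; exact: sqiB.
Qed.

Lemma isq_eq0_ae f : sqi mu setT f -> \int[mu]_x f x ^+ 2 = 0 -> {ae mu, forall x, f x = 0}.
Proof.
move=> hf h.
have h0 : (\int[mu]_x `|(f x ^+ 2)%:E| = 0)%E.
  under eq_integral do rewrite gee0_abs ?lee_fin ?sqr_ge0 //.
  by rewrite -EFin_Rintegral ?h //; exact: sqi_integrable.
have mf : measurable_fun setT (fun x => (f x ^+ 2)%:E).
  by apply/measurable_EFinP; apply: measurable_funX; exact: hf.1.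
apply: filterS ((ae_eq_integral_abs _ measurableT mf).1 h0) => x /(_ I) /= [].
by move=> /eqP; rewrite sqrf_eq0 => /eqP.
Qed.

(** By monotone convergence the sum of the [X k ^+ 2] is integrable, hence finite almost everywhere,
    and the terms of a convergent series tend to 0. *)
Lemma summable_ae_cvg (X : nat -> T -> R) (a : nat -> R) (C : R) :
  (forall k, sqi mu setT (X k)) -> (forall k, \int[mu]_x X k x ^+ 2 <= a k) ->
  (forall n, \sum_(0 <= k < n) a k <= C) ->
  {ae mu, forall x, X ^~ x @ \oo --> (0 : R)}.
Proof.
move=> hX Xa sa; pose g k x := (X k x ^+ 2)%:E.
have mg k : measurable_fun setT (g k).
  by apply/measurable_EFinP; apply: measurable_funX; exact: (hX k).1.
have g0 k x : setT x -> (0 <= g k x)%E by rewrite lee_fin sqr_ge0.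
have fin : (\int[mu]_x (\sum_(0 <= k <oo) g k x) < +oo)%E.
  rewrite integral_nneseries //; apply: le_lt_trans (ltry C).
  apply: lime_le; first by apply: is_cvg_nneseries => k _ _; apply: integral_ge0 => x _; exact: g0.
  apply: nearW => n; apply: (@le_trans _ _ (\sum_(0 <= k < n) a k)%:E).
    rewrite -sumEFin; apply: lee_sum => k _.
    by rewrite -EFin_Rintegral ?lee_fin ?Xa //; exact: sqi_integrable.
  by rewrite lee_fin.
have ig : mu.-integrable setT (fun x => \sum_(0 <= k <oo) g k x)%E.
  apply/integrableP; split.
    by apply: ge0_emeasurable_sum => *; [exact: g0|exact: mg].
  rewrite (eq_integral (fun x => \sum_(0 <= k <oo) g k x)%E) // => x _.
  by rewrite gee0_abs //; apply: nneseries_ge0 => k _ _; exact: g0.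
apply: filterS (integrable_ae measurableT ig) => x /(_ I) fx.
have cx : cvgn (series (fun k => X k x ^+ 2)).
  apply: nondecreasing_is_cvgn.
    by apply: nondecreasing_series => k _ _; exact: sqr_ge0.
  exists (fine (\sum_(0 <= k <oo) g k x)%E) => _ [n _ <-].
  rewrite -lee_fin fineK // /series /= -sumEFin.
  by apply: nneseries_lim_ge => *; exact: (g0 _ x I).
have c0 := cvg_series_cvg_0 cx.
apply/norm_cvg0P.
have : (fun k => Num.sqrt (X k x ^+ 2)) @ \oo --> (0 : R).
  by rewrite -(sqrtr0 R); apply: continuous_cvg => //; exact: sqrt_continuous.
by under eq_fun do rewrite sqrtr_sqr.
Qed.

(** Indices with errors below [2^-k] make the errors summable. The map [phi] need not be increasing:
    it only serves to exhibit [Y] as a pointwise limit of members of the family. *)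
Lemma l2to_subseq_ae (X : nat -> T -> R) Y : (forall l, sqi mu setT (X l)) ->
  sqi mu setT Y -> l2to mu setT X Y ->
  exists phi : nat -> nat, {ae mu, forall x, (fun k => X (phi k) x) @ \oo --> Y x}.
Proof.
move=> hX hY cX.
have ex k : exists l, \int[mu]_x (Y x - X l x) ^+ 2 <= 2^-1 ^+ k.
  have [N _ HN] : \forall l \near \oo, \int[mu]_x (Y x - X l x) ^+ 2 < 2^-1 ^+ k.
    by apply: (cvgr_lt _ cX); rewrite exprn_gt0.
  by exists N; apply: ltW; exact: HN (leqnn N).
have [phi hphi] := choice ex; exists phi.
have gs n : \sum_(0 <= k < n) (2^-1 : R) ^+ k <= 2.
  have : \sum_(0 <= k < n) (2^-1 : R) ^+ k = 2 - 2 * 2^-1 ^+ n.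
    elim: n => [|n IH]; first by rewrite big_nil expr0; ring.
    by rewrite big_nat_recr //= IH exprS; field.
  by move=> ->; rewrite gerBl mulr_ge0 // exprn_ge0.
have := summable_ae_cvg (fun k => sqiB measurableT hY (hX (phi k))) hphi gs.
apply: filterS => x hx.
have -> : (fun k => X (phi k) x) = (fun k => Y x - (Y x - X (phi k) x)).
  by apply/funext => k; rewrite subKr.
by rewrite -[X in _ --> X]subr0; apply: cvgB => //; exact: cvg_cst.
Qed.

End L2Limits.

Section ItoIntegral.
Context d (Omega : measurableType d) (R : realType).
Variable (Pr : probability Omega R).
Variable F : R -> set (set Omega).
Hypothesis hF : usual_filtration Pr F.
Variables (q : nat) (K : 'M[R]_q) (W : R -> Omega -> 'cV[R]_q).
Hypothesis nW : noise Pr F K W.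
Local Notation mu := (@lebesgue_measure R).
Local Notation muP := (mu \x Pr)%E.
Local Notation sqO := (sqi Pr setT).
Local Notation sqP := (sqP Pr).
Local Notation strip t := (`[0, t]%classic `*` [set: Omega] : set (measurableTypeR R * Omega)).
Local Notation velt := (velt Pr F).
Implicit Types (H : R -> Omega -> R) (I X Y Z : Omega -> R).

(** Some sequence of members converges to [Y] off a null set. That set belongs to [F t] by
    completeness, and multiplying by the indicator of its complement gives convergence
    everywhere. *)
Lemma l2to_rv (t : R) (X : nat -> Omega -> R) Y : 0 <= t ->
  (forall l, rv_measurable (F t) (X l)) -> (forall l, sqO (X l)) -> sqO Y ->
  l2to Pr setT X Y -> rv_measurable (F t) Y.
Proof.
move=> t0 mX hX hY cX; have S := Fsigma hF t0.
have [phi hphi] := l2to_subseq_ae hX hY cX.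
pose E := [set w | ~ ((fun k => X (phi k) w) @ \oo --> Y w)].
have FE : F t (~` E).
  have [_ FC _] := S; rewrite -setTD; apply: FC.
  exact: (Fnull hF t0).
pose Y' w := \1_(~` E) w * Y w.
have mY' : rv_measurable (F t) Y'.
  apply: (rv_cvg S (X := fun k w => \1_(~` E) w * X (phi k) w)) => [l|w].
    by apply: (rvM S) => //; exact: rv_indic.
  rewrite /Y' indicE; have [/set_mem nE|_] := boolP (w \in ~` E).
    rewrite mul1r; under eq_fun do rewrite mul1r.
    exact: contrapT.
  by rewrite mul0r; under eq_fun do rewrite mul0r; exact: cvg_cst.
apply: (rv_ae_eq S (Fnull hF t0) mY').
apply: filterS hphi => w hw; by rewrite /Y' indicE mem_set ?mul1r // => /(_ hw).
Qed.

Definition scale_velt t (a : R) (e : velt t) : velt t :=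
  @Velt _ _ _ Pr F t (va e) (vb e) (fun w => a * vx e w) (va_ge0 e) (vab e) (vb_le e)
    (rvZ (Fsigma hF (va_ge0 e)) a (vx_meas e)) (sqiZ measurableT a (vx_sqi e)).

Lemma sp_lin t (a b : R) (f g : seq (velt t)) s w :
  sp ([seq scale_velt a e | e <- f] ++ [seq scale_velt b e | e <- g]) s w =
    a * sp f s w + b * sp g s w.
Proof.
rewrite /sp big_cat !big_map /= !mulr_sumr.
by congr (_ + _); apply: eq_bigr => e _; rewrite mulrA.
Qed.

Lemma si_lin i t (a b : R) (f g : seq (velt t)) w :
  si W i ([seq scale_velt a e | e <- f] ++ [seq scale_velt b e | e <- g]) w =
    a * si W i f w + b * si W i g w.
Proof.
rewrite /si big_cat !big_map /= !mulr_sumr.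
by congr (_ + _); apply: eq_bigr => e _; rewrite mulrA.
Qed.

(* [gito i t H I]: [I] is the Ito integral of [H] over [0, t] against [W_i]. *)
Definition gito (i : 'I_q) (t : R) H I : Prop :=
  [/\ sqP t H, sqO I & exists f : nat -> seq (velt t),
    l2to muP (strip t) (fun l z => sp (f l) z.1 z.2) (fun z => H z.1 z.2) /\
    l2to Pr setT (fun l => si W i (f l)) I].

Lemma gito_lin i t (a b : R) H I H' I' : gito i t H I -> gito i t H' I' ->
  gito i t (fun s w => a * H s w + b * H' s w) (fun w => a * I w + b * I' w).
Proof.
move=> [sH sI [f [cf1 cf2]]] [sH' sI' [g [cg1 cg2]]]; split.
- exact: (sqi_lin (mstrip t) a b sH sH').
- exact: sqi_lin.
- exists (fun l => [seq scale_velt a e | e <- f l] ++ [seq scale_velt b e | e <- g l]).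
  split.
    have := l2to_lin (mstrip t) a b (fun l => sp_sqP t (f l)) sH (fun l => sp_sqP t (g l)) sH' cf1 cg1.
    by rewrite /l2to; under [X in X @ _ --> _ -> _]eq_fun do under eq_Rintegral do rewrite -sp_lin.
  have := l2to_lin measurableT a b (fun l => si_sqi nW i (f l)) sI (fun l => si_sqi nW i (g l)) sI' cf2 cg2.
  by rewrite /l2to; under [X in X @ _ --> _ -> _]eq_fun do under eq_Rintegral do rewrite -si_lin.
Qed.

Lemma gito_isometry i j t H I H' I' : gito i t H I -> gito j t H' I' ->
  \int[Pr]_w (I w * I' w) = K i j * strip_int Pr t (fun s w => H s w * H' s w).
Proof.
move=> [sH sI [f [cf1 cf2]]] [sH' sI' [g [cg1 cg2]]].
have c1 := l2to_ip measurableT (fun l => si_sqi nW i (f l)) sI (fun l => si_sqi nW j (g l)) sI' cf2 cg2.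
have c2 := l2to_ip (mstrip t) (fun l => sp_sqP t (f l)) sH (fun l => sp_sqP t (g l)) sH' cf1 cg1.
have c3 : (fun l => \int[Pr]_w (si W i (f l) w * si W j (g l) w)) @ \oo -->
    K i j * strip_int Pr t (fun s w => H s w * H' s w).
  by under eq_fun do rewrite (isometry hF nW); exact: cvgMr.
exact: (cvg_unique _ c1 c3).
Qed.

Lemma gito_sp i t (f : seq (velt t)) : gito i t (sp f) (si W i f).
Proof.
split; [exact: sp_sqP|exact: (si_sqi nW)|exists (fun=> f); split].
  rewrite /l2to (_ : (fun _ : nat => _) = fun=> 0); first exact: cvg_cst.
  apply/funext => l; under eq_Rintegral do rewrite subrr expr0n /=.
  by rewrite (Rintegral_cst _ (mstrip t)) mul0r.
rewrite /l2to (_ : (fun _ : nat => _) = fun=> 0); first exact: cvg_cst.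
apply/funext => l; under eq_Rintegral do rewrite subrr expr0n /=.
by rewrite Rintegral_cst // mul0r.
Qed.

Lemma gito_isq i t H I : gito i t H I ->
  \int[Pr]_w I w ^+ 2 = K i i * strip_int Pr t (fun s w => H s w ^+ 2).
Proof.
move=> h; have := gito_isometry h h.
rewrite (@eq_Rintegral _ _ _ _ _ (fun w => I w ^+ 2)) => [->|w _]; last by rewrite expr2.
by congr (_ * _); apply: eq_Rintegral => z _; rewrite expr2.
Qed.

Lemma gito_dist i t H I H' I' : gito i t H I -> gito i t H' I' ->
  \int[Pr]_w (I w - I' w) ^+ 2 = K i i * strip_int Pr t (fun s w => (H s w - H' s w) ^+ 2).
Proof.
move=> h h'; have := gito_isq (gito_lin 1 (-1) h h').
rewrite (@eq_Rintegral _ _ _ _ _ (fun w => (I w - I' w) ^+ 2)) => [->|w _]; last by rewrite mul1r mulN1r.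
by congr (_ * _); apply: eq_Rintegral => z _; rewrite mul1r mulN1r.
Qed.

(* By the isometry any simple approximation of the integrand will do. *)
Lemma gito_approx i t H I (f : nat -> seq (velt t)) : gito i t H I ->
  l2to muP (strip t) (fun l z => sp (f l) z.1 z.2) (fun z => H z.1 z.2) ->
  l2to Pr setT (fun l => si W i (f l)) I.
Proof.
move=> h cf; rewrite /l2to; under eq_fun do rewrite (gito_dist h (gito_sp i (f _))).
by rewrite -(mulr0 (K i i)); apply: cvgMr.
Qed.

Lemma gito_rv i t H I : 0 <= t -> gito i t H I -> rv_measurable (F t) I.
Proof.
move=> t0 [_ sI [f [_ cf]]]; apply: (l2to_rv t0 _ _ sI cf) => l.
  exact: (si_meas hF nW).
exact: (si_sqi nW).
Qed.

Section Cut.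
Variables (s t : R).
Hypotheses (s0 : 0 <= s) (st : s <= t).

Let min_ge a b : a <= b -> a <= s -> a <= Num.min b s.
Proof. by rewrite le_min => -> ->. Qed.

Let min_le b : Num.min b s <= s.
Proof. by rewrite ge_min lexx orbT. Qed.

(** Restriction to [[0, s]]. An element starting after [s] has no admissible endpoints left and
    becomes the zero element on the empty interval []0, 0]]. *)
Definition cut (e : velt t) : velt s :=
  match pselect (va e <= s) with
  | left h => @Velt _ _ _ Pr F s (va e) (Num.min (vb e) s) (vx e) (va_ge0 e)
      (min_ge (vab e) h) (min_le _) (vx_meas e) (vx_sqi e)
  | right _ => @Velt _ _ _ Pr F s 0 0 (fun=> 0) (lexx 0) (lexx 0) s0
      (rv_cst (Fsigma hF (lexx 0)) 0) (sqO_cst Pr 0)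
  end.

Lemma sp_cut (f : seq (velt t)) r w : r <= s -> sp (map cut f) r w = sp f r w.
Proof.
move=> rs; rewrite /sp big_map; apply: eq_bigr => e _; rewrite /cut.
case: pselect => [h|h] /=.
  congr (_ * _); rewrite !indicE; congr (_%:R); congr nat_of_bool.
  by apply/idP/idP; rewrite !inE /= !in_itv /= le_min rs andbT.
rewrite mul0r indicE memNset ?mulr0 //= in_itv /= => /andP[h1 _]; apply: h.
by rewrite (le_trans (ltW h1)).
Qed.

(** The martingale property for simple integrals: the part of each increment after [s] has mean zero
    against products of [Z] with coefficients known at [s]. *)
Lemma si_cut i (f : seq (velt t)) Z : rv_measurable (F s) Z -> sqO Z ->
  \int[Pr]_w (Z w * si W i f w) = \int[Pr]_w (Z w * si W i (map cut f) w).
Proof.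
move=> mZ hZ.
have sum t' (g : seq (velt t')) : \int[Pr]_w (Z w * si W i g w) =
    \sum_(e <- g) \int[Pr]_w (Z w * (vx e w * incr W i (va e) (vb e) w)).
  rewrite -Rintegral_sumr //; last first.
    by move=> e; apply: sqi_mul => //; exact: (velt_int_sqi nW).
  by apply: eq_Rintegral => w _; rewrite mulr_sumr.
rewrite !sum big_map; apply: eq_bigr => e _; rewrite /cut.
have a0 := va_ge0 e; have ab := vab e.
case: pselect => [as_|/negP] /=; last first.
  rewrite -ltNge => /ltW sa.
  rewrite (noise_mean nW) //; [|by apply: rv_measurable_sub mZ; exact: (Fsub hF)
    |exact: vx_meas|exact: vx_sqi].
  by under eq_Rintegral do rewrite mul0r mulr0; rewrite Rintegral_cst // mul0r.
have [bs|/ltW sb] := leP (vb e) s; first by [].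
have mx : rv_measurable (F s) (vx e) by exact: (velt_meas hF).
have hx := vx_sqi e.
have h1 := noise_sqi nW i a0 as_ (vx_meas e) hx.
have h2 := noise_sqi nW i s0 sb mx hx.
rewrite (@eq_Rintegral _ _ _ _ _ (fun w => Z w * (vx e w * incr W i (va e) s w) +
   Z w * (vx e w * incr W i s (vb e) w))); last by move=> w _; rewrite /incr; ring.
rewrite RintegralD //; try exact: sqi_mul.
by rewrite [X in _ + X](noise_mean nW) // addr0.
Qed.

Lemma strip_subset : strip s `<=` strip t.
Proof.
move=> z [+ _]; rewrite /= in_itv /= => /andP[h1 h2]; split=> //=.
by rewrite in_itv /= h1 (le_trans h2).
Qed.

(** Passage to the limit in [si_cut]. Testing against square integrable [Z] takes the place of a
    conditional expectation. *)
Lemma gito_mart i H I Is Z : gito i t H I -> gito i s H Is ->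
  rv_measurable (F s) Z -> sqO Z ->
  \int[Pr]_w (Z w * I w) = \int[Pr]_w (Z w * Is w).
Proof.
move=> h hs mZ hZ; have [sH sI [f [cf1 cf2]]] := h.
have cZ : l2to Pr setT (fun _ : nat => Z) Z.
  rewrite /l2to (_ : (fun _ : nat => _) = fun=> 0); first exact: cvg_cst.
  apply/funext => l; under eq_Rintegral do rewrite subrr expr0n /=.
  by rewrite Rintegral_cst // mul0r.
have c1 := l2to_ip measurableT (fun _ => hZ) hZ (fun l => si_sqi nW i (f l)) sI cZ cf2.
have cs := l2to_subset (mstrip s) (mstrip t) strip_subset (fun l => sp_sqP t (f l)) sH cf1.
have cs' : l2to muP (strip s) (fun l z => sp (map cut (f l)) z.1 z.2) (fun z => H z.1 z.2).
  rewrite /l2to (_ : (fun l => _) = (fun l => \int[muP]_(z in strip s) (H z.1 z.2 - sp (f l) z.1 z.2) ^+ 2)); first exact: cs.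
  apply/funext => l; apply: eq_Rintegral => z /set_mem [+ _]; rewrite /= in_itv /= => /andP[_ zs].
  by rewrite sp_cut.
have [_ sIs _] := hs.
have c2 := l2to_ip measurableT (fun _ => hZ) hZ (fun l => si_sqi nW i (map cut (f l))) sIs cZ
  (gito_approx hs cs').
have c3 : (fun l => \int[Pr]_w (Z w * si W i (f l) w)) @ \oo --> \int[Pr]_w (Z w * Is w).
  by under eq_fun do rewrite si_cut //; exact: c2.
exact: (cvg_unique _ c1 c3).
Qed.

(** Pythagoras: the martingale property tested against [Is] itself turns the mixed term into the
    second moment of [Is]. *)
Lemma gito_incr i H I Is : gito i t H I -> gito i s H Is ->
  \int[Pr]_w (I w - Is w) ^+ 2 =
    K i i * (strip_int Pr t (fun s w => H s w ^+ 2) - strip_int Pr s (fun s w => H s w ^+ 2)).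
Proof.
move=> h hs; have [_ sI _] := h; have [_ sIs _] := hs.
have e := gito_mart h hs (gito_rv s0 hs) sIs.
rewrite (@eq_Rintegral _ _ _ _ _ (fun w => (1 * I w + (-1) * Is w) ^+ 2)); last first.
  by move=> w _; rewrite mul1r mulN1r.
rewrite isq_lin // (gito_isq h) (gito_isq hs) mulrBr.
have -> : \int[Pr]_w (I w * Is w) = K i i * strip_int Pr s (fun s w => H s w ^+ 2).
  rewrite -(gito_isq hs) (@eq_Rintegral _ _ _ _ _ (fun w => Is w * I w)).
    by rewrite e; apply: eq_Rintegral => w _; rewrite expr2.
  by move=> w _; rewrite mulrC.
ring.
Qed.

End Cut.

End ItoIntegral.

(** * Almost everywhere comparison, iterated integrals and primitives *)

Section AeIntegral.
Context d (T : measurableType d) (R : realType).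
Variables (mu : {measure set T -> \bar R}) (D : set T).
Hypothesis mD : measurable D.

Lemma ae_eq_Rintegral (f g : T -> R) : measurable_fun D f -> measurable_fun D g ->
  {ae mu, forall x, D x -> f x = g x} -> \int[mu]_(x in D) f x = \int[mu]_(x in D) g x.
Proof.
move=> mf mg fg; rewrite /Rintegral; congr fine; apply: ae_eq_integral => //.
- exact/measurable_EFinP.
- exact/measurable_EFinP.
- by apply: filterS fg => x + Dx => ->.
Qed.

Lemma ae_eq_integrable (f g : T -> R) : measurable_fun D g ->
  {ae mu, forall x, D x -> f x = g x} -> mu.-integrable D (EFin \o f) ->
  mu.-integrable D (EFin \o g).
Proof.
move=> mg fg /integrableP[mf fin]; apply/integrableP; split; first exact/measurable_EFinP.
have -> : (\int[mu]_(x in D) `|(EFin \o g) x| = \int[mu]_(x in D) `|(EFin \o f) x|)%E; last by [].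
apply: ae_eq_integral => //.
- by apply: measurableT_comp => //; exact/measurable_EFinP.
- exact: measurableT_comp.
- by apply: filterS fg => x + Dx => /= ->.
Qed.

Lemma ae_eq_sqi (f g : T -> R) : measurable_fun D g ->
  {ae mu, forall x, D x -> f x = g x} -> sqi mu D f -> sqi mu D g.
Proof.
move=> mg fg hf; apply: integrable_sqi => //.
apply: (ae_eq_integrable _ _ (sqi_integrable hf)); first exact: measurable_funX.
by apply: filterS fg => x + Dx => ->.
Qed.

Lemma ae_le_Rintegral (f g : T -> R) : mu.-integrable D (EFin \o f) ->
  mu.-integrable D (EFin \o g) -> (forall x, D x -> 0 <= f x) -> (forall x, D x -> 0 <= g x) ->
  {ae mu, forall x, D x -> f x <= g x} -> \int[mu]_(x in D) f x <= \int[mu]_(x in D) g x.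
Proof.
move=> hf hg f0 g0 fg; rewrite -lee_fin !EFin_Rintegral //; apply: ae_ge0_le_integral => //.
- by case/integrableP: hf.
- by case/integrableP: hg.
Qed.
End AeIntegral.

Section RFubini.
Context d1 d2 (T1 : measurableType d1) (T2 : measurableType d2) (R : realType).
Variables (m1 : {sigma_finite_measure set T1 -> \bar R}).
Variables (m2 : {sigma_finite_measure set T2 -> \bar R}).
Variable f : T1 * T2 -> R.
Hypothesis fi : (m1 \x m2)%E.-integrable setT (EFin \o f).

Lemma Rfubini12 : (forall x, m2.-integrable setT (EFin \o (fun y => f (x, y)))) ->
  \int[(m1 \x m2)%E]_z f z = \int[m1]_x \int[m2]_y f (x, y).
Proof.
move=> h; rewrite /Rintegral -(integral12_prod_meas1 fi); congr fine.
by apply: eq_integral => x _; rewrite fineK //; exact: integrable_fin_num (h x).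
Qed.

Lemma Rfubini21 : (forall y, m1.-integrable setT (EFin \o (fun x => f (x, y)))) ->
  \int[(m1 \x m2)%E]_z f z = \int[m2]_y \int[m1]_x f (x, y).
Proof.
move=> h; rewrite /Rintegral -(integral21_prod_meas1 fi); congr fine.
by apply: eq_integral => y _; rewrite fineK //; exact: integrable_fin_num (h y).
Qed.
End RFubini.

Section Primitive.
Context (R : realType).
Local Notation mu := (@lebesgue_measure R).
Implicit Types f : R -> R.

(* Fubini on the two triangles of the square [0, t]^2. *)
Lemma integral_mul_primitive (t : R) (f : R -> R) : mu.-integrable `[0, t]%classic (EFin \o f) ->
  \int[mu]_(s in `[0, t]%classic) (f s * \int[mu]_(r in `[0, s]%classic) f r) =
    2^-1 * (\int[mu]_(s in `[0, t]%classic) f s) ^+ 2.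
Proof.
move=> hf; pose D : set (measurableTypeR R) := `[0, t]%classic.
have mD : measurable D by exact: measurable_itv.
pose g := f \_ D.
have ig : mu.-integrable setT (EFin \o g).
  by move/(integrable_mkcond _ mD): hf; rewrite restrict_EFin.
have mg : measurable_fun setT g by move/integrableP: ig => -[/measurable_EFinP].
pose G (z : measurableTypeR R * measurableTypeR R) := g z.1 * g z.2.
pose U : set (measurableTypeR R * measurableTypeR R) := [set z | z.1 <= z.2].
have mU : measurable U.
  have := measurable_fun_ler (@measurable_fst _ _ (measurableTypeR R) (measurableTypeR R))
    (@measurable_snd _ _ (measurableTypeR R) (measurableTypeR R)).
  by move=> /(_ measurableT [set true] I); rewrite setTI.
have mG : measurable_fun setT G.
  by apply: measurable_funM; [exact: (measurableT_comp mg measurable_fst)|exact: (measurableT_comp mg measurable_snd)].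
have iG : (mu \x mu)%E.-integrable setT (EFin \o G).
  apply/integrable12ltyP; first exact/measurable_EFinP.
  have /integrableP[_ fin] := ig.
  have n0 : (\int[mu]_y `|g y|%:E \is a fin_num)%E by rewrite ge0_fin_numE // integral_ge0.
  have e x : (\int[mu]_y `|(EFin \o G) (x, y)| = `|g x|%:E * \int[mu]_y `|g y|%:E)%E.
    rewrite -ge0_integralZl //; last by apply/measurable_EFinP; exact: measurableT_comp.
    by apply: eq_integral => y _; rewrite /G /= normrM EFinM.
  under eq_integral do rewrite e.
  rewrite -(fineK n0) ge0_integralZr // ?lee_fin ?fine_ge0 ?integral_ge0 //.
    by rewrite muleC lte_mul_pinfty // lee_fin fine_ge0 // integral_ge0.
  by apply/measurable_EFinP; exact: measurableT_comp.
have bI (A : set R) (h : R -> R) : measurable A -> mu.-integrable setT (EFin \o h) ->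
    mu.-integrable setT (EFin \o (fun r => h r * \1_A r)).
  move=> mA hh; have /integrableP[/measurable_EFinP mh _] := hh.
  apply: (dominated_integrable measurableT _ _ (integrable_norm hh)).
    by apply: measurable_funM => //; exact: measurable_indic.
  move=> z _; rewrite normrM /indic; case: (_ \in _); rewrite ?normr1 ?mulr1 //=.
  by rewrite normr0 mulr0.
have iGU V : measurable V -> (mu \x mu)%E.-integrable setT (EFin \o (fun z => G z * \1_V z)).
  move=> mV; apply: (dominated_integrable measurableT _ _ (integrable_norm iG)).
    by apply: measurable_funM => //; exact: measurable_indic.
  move=> z _; rewrite normrM /indic; case: (_ \in _); rewrite ?normr1 ?mulr1 //=.
  by rewrite normr0 mulr0.
pose a s := \int[mu]_(r in `[0, s]%classic) f r.
have hfs s : D s -> mu.-integrable `[0, s]%classic (EFin \o f).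
  rewrite /D /= in_itv /= => /andP[s0 st]; apply: integrableS hf => //.
  by move=> r; rewrite /= !in_itv /= => /andP[-> rs]; exact: le_trans st.
have gle s : D s -> \int[mu]_r (g r * \1_[set r | r <= s] r) = a s.
  move=> Ds; rewrite /a [RHS]Rintegral_mkcond; apply: eq_Rintegral => r _.
  have := Ds; rewrite /g /D /patch !mem_setE /indic /= !in_itv /= => /andP[s0 st].
  have -> : (r \in [set r | r <= s]) = (r <= s) by apply/idP/idP; rewrite inE.
  case: (leP r s) => rs; rewrite ?andbT ?andbF ?mulr1 ?mulr0 //.
  by rewrite (le_trans rs st) andbT.
have glt s : D s -> \int[mu]_r (g r * \1_[set r | r < s] r) = a s.
  move=> Ds; rewrite /a -Rintegral_itv_bndo_bndc; last first.
    apply: (integrableS _ _ _ (hfs s Ds)) => //.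
    by move=> r; rewrite /= !in_itv /= => /andP[-> /ltW].
  rewrite [RHS]Rintegral_mkcond; apply: eq_Rintegral => r _.
  have := Ds; rewrite /g /D /patch !mem_setE /indic /= !in_itv /= => /andP[s0 st].
  have -> : (r \in [set r | r < s]) = (r < s) by apply/idP/idP; rewrite inE.
  case: (ltP r s) => rs; rewrite ?andbT ?andbF ?mulr1 ?mulr0 //.
  by rewrite (le_trans (ltW rs) st) andbT.
have mle s : measurable [set r : R | r <= s].
  by rewrite (_ : [set r | _] = `]-oo, s]%classic) //; apply/seteqP; split => r /=; rewrite in_itv.
have mlt s : measurable [set r : R | r < s].
  by rewrite (_ : [set r | _] = `]-oo, s[%classic) //; apply/seteqP; split => r /=; rewrite in_itv.
have final (b : R -> R) : (forall s, D s -> b s = a s) ->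
    \int[mu]_s (g s * b s) = \int[mu]_(s in `[0, t]%classic) (f s * a s).
  move=> ba; rewrite [RHS]Rintegral_mkcond; apply: eq_Rintegral => s _.
  rewrite /g /patch; case: ifPn => [/set_mem Ds|]; last by rewrite mul0r.
  by rewrite ba.
have i1 : \int[(mu \x mu)%E]_z (G z * \1_U z) =
    \int[mu]_(s in `[0, t]%classic) (f s * a s).
  have e x y : G (x, y) * \1_U (x, y) = g y * (g x * \1_[set r | r <= y] x).
    by rewrite /G /U !indicE !mem_setE /= mulrCA mulrA.
  have iy y : mu.-integrable setT (EFin \o (fun x => G (x, y) * \1_U (x, y))).
    under eq_fun do rewrite e.
    exact: (integrableZl measurableT _ (bI _ _ (mle y) ig)).
  rewrite (Rfubini21 (iGU _ mU) iy).
  rewrite -(final (fun y => \int[mu]_x (g x * \1_[set r | r <= y] x))) //.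
  apply: eq_Rintegral => y _; rewrite -RintegralZl //; last exact: bI.
  by apply: eq_Rintegral => x _; rewrite e.
have i2 : \int[(mu \x mu)%E]_z (G z * \1_(~` U) z) =
    \int[mu]_(s in `[0, t]%classic) (f s * a s).
  have e x y : G (x, y) * \1_(~` U) (x, y) = g x * (g y * \1_[set r | r < x] y).
    rewrite /G /U !indicE /= mulrA; congr (_ * _%:R); congr nat_of_bool.
    apply/idP/idP; rewrite !inE /=; first by move=> /negP; rewrite -ltNge.
    by move=> h; apply/negP; rewrite -ltNge.
  have iy y : mu.-integrable setT (EFin \o (fun x => G (y, x) * \1_(~` U) (y, x))).
    under eq_fun do rewrite e.
    exact: (integrableZl measurableT _ (bI _ _ (mlt y) ig)).
  rewrite (Rfubini12 (iGU _ (measurableC mU)) iy).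
  rewrite -(final (fun y => \int[mu]_x (g x * \1_[set r | r < y] x))) //.
  apply: eq_Rintegral => y _; rewrite -RintegralZl //; last exact: bI.
  by apply: eq_Rintegral => x _; rewrite e.
have i0 : \int[(mu \x mu)%E]_z G z =
    (\int[mu]_(s in `[0, t]%classic) f s) ^+ 2.
  have iy y : mu.-integrable setT (EFin \o (fun x => G (y, x))).
    exact: (integrableZl measurableT (g y) ig).
  rewrite (Rfubini12 iG iy) expr2 [X in _ = X * _]Rintegral_mkcond [X in _ = _ * X]Rintegral_mkcond.
  rewrite -RintegralZr //; apply: eq_Rintegral => y _.
  by rewrite -RintegralZl.
rewrite -i0 (@eq_Rintegral _ _ _ _ _ (fun z => G z * \1_U z + G z * \1_(~` U) z)); last first.
  by move=> z _; rewrite indicC indicE; case: (_ \in _); rewrite /= ?mulr1 ?mulr0 ?addr0 ?add0r.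
rewrite RintegralD //; [|exact: iGU|exact: iGU (measurableC mU)].
by rewrite i1 i2 /a; field.
Qed.
End Primitive.

Section Drift.
Context d (Omega : measurableType d) (R : realType).
Variable (Pr : probability Omega R).
Local Notation mu := (@lebesgue_measure R).
Local Notation muP := (mu \x Pr)%E.
Local Notation sqO := (sqi Pr setT).
Variables (D : set (measurableTypeR R)) (c : R).
Hypothesis mD : measurable D.
Hypothesis Dc : mu D = c%:E.
Variable f : R -> Omega -> R.
Local Notation DT := (D `*` [set: Omega]).
Local Notation uf := (fun z : measurableTypeR R * Omega => f z.1 z.2).
Hypothesis hf : sqi muP DT uf.

Let mDT : measurable DT := measurable_strip mD.

Lemma strip_one : sqi muP DT (fun=> 1).
Proof.
split; first exact: measurable_cst.
rewrite (eq_integral (cst 1%E)); last by move=> z _; rewrite expr1n.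
rewrite integral_cst // mul1e.
have e : muP DT = (mu D * Pr setT)%E by exact: product_measure1E.
apply: (eq_ind_r (fun u => u < +oo)%E _ e).
by rewrite (probability_setT Pr) mule1 Dc ltry.
Qed.

Lemma sqi_one : sqi mu D (fun=> 1 : R).
Proof.
split; first exact: measurable_cst.
rewrite (eq_integral (cst 1%E)); last by move=> z _; rewrite expr1n.
by rewrite integral_cst // mul1e [X in (X < _)%E]Dc ltry.
Qed.

Lemma strip_integrable : muP.-integrable DT (EFin \o uf).
Proof.
have := sqi_mul mDT hf strip_one; apply: eq_integrable => // z _ /=.
by rewrite mulr1.
Qed.

Lemma drift_section : {ae Pr, forall w, sqi mu D (f ^~ w)}.
Proof.
have h1 := fubini_ae2 mD strip_integrable.
have h2 := fubini_ae2 mD (sqi_integrable hf).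
apply: filterS2 h1 h2 => w i1 i2; apply: integrable_sqi => //.
by move/integrableP: i1 => -[/measurable_EFinP].
Qed.

Lemma drift_measurable : measurable_fun setT (fun w => \int[mu]_(s in D) f s w).
Proof. exact: (measurable_fubini2 mD strip_integrable). Qed.

(** Cauchy-Schwarz against the constant 1, on each path separately; [c] is the length of the time
    set. *)
Lemma drift_le : {ae Pr, forall w, (\int[mu]_(s in D) f s w) ^+ 2 <=
   c * \int[mu]_(s in D) (f s w) ^+ 2}.
Proof.
apply: filterS drift_section => w hw.
have := ip_CS mD hw sqi_one.
under eq_Rintegral do rewrite mulr1; move=> /le_trans; apply.
rewrite mulrC ler_wpM2r ?isq_ge0 // (@eq_Rintegral _ _ _ _ _ (fun=> 1)); last by move=> s _; rewrite expr1n.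
by rewrite Rintegral_cst // mul1r (congr1 fine Dc).
Qed.

Lemma drift_sq_integrable :
  Pr.-integrable setT (EFin \o (fun w => \int[mu]_(s in D) (f s w) ^+ 2)).
Proof.
have i2 := sqi_integrable hf.
have m2 : measurable_fun setT (fun w => \int[mu]_(s in D) (f s w) ^+ 2).
  exact: (measurable_fubini2 mD i2).
apply: ge0_integrable => //; first by move=> w _; exact: isq_ge0.
have e : (\int[Pr]_w (\int[mu]_(s in D) (f s w) ^+ 2)%:E =
   \int[muP]_(z in DT) ((f z.1 z.2) ^+ 2)%:E)%E.
  rewrite tonelli2 //.
  - apply: ae_eq_integral => //.
    + exact/measurable_EFinP.
    + apply: (measurable_tonelli mD (f := fun z => ((f z.1 z.2) ^+ 2)%:E)).
      by case/integrableP: i2.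
      by move=> z _; rewrite lee_fin sqr_ge0.
    + apply: filterS (fubini_ae2 mD i2) => w iw _.
      by rewrite EFin_Rintegral.
  - by case/integrableP: i2.
  - by move=> z _; rewrite lee_fin sqr_ge0.
by rewrite e; exact: hf.2.
Qed.

Lemma drift_sqi : sqO (fun w => \int[mu]_(s in D) f s w) /\
  \int[Pr]_w (\int[mu]_(s in D) f s w) ^+ 2 <= c * \int[muP]_(z in DT) (f z.1 z.2) ^+ 2.
Proof.
have i2 := sqi_integrable hf.
have m2 : measurable_fun setT (fun w => \int[mu]_(s in D) (f s w) ^+ 2).
  exact: (measurable_fubini2 mD i2).
have iE := drift_sq_integrable.
have c0 : 0 <= c by rewrite -lee_fin -Dc measure_ge0.
have hs : sqO (fun w => \int[mu]_(s in D) f s w).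
  split; first exact: drift_measurable.
  apply: (@le_lt_trans _ _ (\int[Pr]_w (c * \int[mu]_(s in D) (f s w) ^+ 2)%:E)%E).
    apply: ae_ge0_le_integral => //.
    - by move=> w _; rewrite lee_fin sqr_ge0.
    - by apply/measurable_EFinP; apply: measurable_funX; exact: drift_measurable.
    - by move=> w _; rewrite lee_fin mulr_ge0 // isq_ge0.
    - by apply/measurable_EFinP; apply: measurable_funM.
    - by apply: filterS drift_le => w h _; rewrite lee_fin.
  exact: (integrable_lty measurableT (integrableZl measurableT c iE)).
split=> //; rewrite (fubini2 mD i2) -RintegralZl //; apply: ae_le_Rintegral => //.
- exact: sqi_integrable.
- exact: (integrableZl measurableT c iE).
- by move=> w _; exact: sqr_ge0.
- by move=> w _; rewrite mulr_ge0 // isq_ge0.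
- by apply: filterS drift_le => w h _.
Qed.

Lemma drift_mul X : sqi muP DT (fun z => X z.2) -> sqO X ->
  \int[Pr]_w ((\int[mu]_(s in D) f s w) * X w) = \int[muP]_(z in DT) (f z.1 z.2 * X z.2).
Proof.
move=> sX hX; have i := sqi_mul mDT hf sX.
rewrite (fubini2 mD i); apply: ae_eq_Rintegral => //.
- by apply: measurable_funM; [exact: drift_measurable|exact: hX.1].
- exact: (measurable_fubini2 mD i).
- apply: filterS (fubini_ae2 mD strip_integrable) => w iw _.
  by rewrite -RintegralZr.
Qed.

End Drift.

(** * Second moments of Ito processes *)

Section DriftProcess.
Context d (Omega : measurableType d) (R : realType).
Variable (Pr : probability Omega R).
Local Notation mu := (@lebesgue_measure R).
Local Notation muP := (mu \x Pr)%E.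
Local Notation sqO := (sqi Pr setT).
Local Notation sqP := (sqP Pr).
Local Notation strip t := (`[0, t]%classic `*` [set: Omega] : set (measurableTypeR R * Omega)).

Lemma mu_itv (t : R) : 0 <= t -> mu `[0, t]%classic = t%:E.
Proof.
move=> t0; rewrite lebesgue_measure_itv /= lte_fin; case: ltP => h.
  by rewrite -EFinB subr0.
by congr EFin; apply/eqP; rewrite eq_le t0 h.
Qed.

Lemma sqP_sub (s t : R) f : s <= t -> sqP t f -> sqP s f /\
  strip_int Pr s (fun s w => f s w ^+ 2) <= strip_int Pr t (fun s w => f s w ^+ 2).
Proof.
move=> st hf; apply: (sqi_subset (mstrip s) (mstrip t)) hf => z [+ _].
by rewrite /= in_itv /= => /andP[h1 h2]; split=> //=; rewrite in_itv /= h1 (le_trans h2).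
Qed.

Variables (t : R) (f : R -> Omega -> R).
Hypothesis t0 : 0 <= t.
Hypothesis hf : sqP t f.

Definition prim (s : R) (w : Omega) := \int[mu]_(r in `[0, s]%classic) f r w.

(** The primitive is an integral over a third variable [r] of [f r w] times the indicator of
    [r <= s]. Tonelli's theorem gives measurability for the positive and the negative part
    separately, so the paths need not be integrable. *)
Lemma measurable_prim : measurable_fun (strip t) (fun z => prim z.1 z.2).
Proof.
pose h (y : (measurableTypeR R * Omega) * measurableTypeR R) : \bar R :=
  (((EFin \o (fun z : measurableTypeR R * Omega => f z.1 z.2)) \_ (strip t)) (y.2, y.1.2) *
    (\1_[set y : (measurableTypeR R * Omega) * measurableTypeR R | y.2 <= y.1.1] y)%:E)%E.
have mU : measurable [set y : (measurableTypeR R * Omega) * measurableTypeR R | y.2 <= y.1.1].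
  have := measurable_fun_ler (@measurable_snd _ _ (measurableTypeR R * Omega)%type (measurableTypeR R))
    (measurableT_comp measurable_fst (@measurable_fst _ _ (measurableTypeR R * Omega)%type (measurableTypeR R))).
  by move=> /(_ measurableT [set true] I); rewrite setTI.
have mh : measurable_fun setT h.
  apply: emeasurable_funM; last by apply/measurable_EFinP; exact: measurable_indic.
  have mp : measurable_fun setT ((EFin \o (fun z : measurableTypeR R * Omega => f z.1 z.2)) \_ (strip t)).
    apply: measurable_patch; first exact: measurable_itv.
    by apply/measurable_EFinP; exact: hf.1.
  apply: (measurableT_comp mp); apply: measurable_fun_pair; first exact: measurable_snd.
  exact: (measurableT_comp measurable_snd measurable_fst).
have mpos := measurable_fun_fubini_tonelli_F _ (m2 := mu) (measurable_funepos mh) (fun x => funepos_ge0 h x).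
have mneg := measurable_fun_fubini_tonelli_F _ (m2 := mu) (measurable_funeneg mh) (fun x => funeneg_ge0 h x).
have m := measurable_funTS (D := strip t) (measurableT_comp (fine_measurable measurableT) (emeasurable_funB mpos mneg)).
apply: eq_measurable_fun m => z /set_mem [zt _].
rewrite /prim /Rintegral; congr fine.
rewrite [RHS]integral_mkcond.
transitivity (\int[mu]_r h (z, r))%E.
  rewrite [RHS]integralE /fubini_F; congr (_ - _)%E; apply: eq_integral => r _.
    by rewrite !funeposE.
  by rewrite !funenegE.
apply: eq_integral => r _; rewrite /h /patch.
have := zt; rewrite /= in_itv /= => /andP[z0 zt'].
have [rz|rz] := pselect (`[0%R, z.1]%classic r).
  have := rz; rewrite /= in_itv /= => /andP[r0 rz'].
  by rewrite !mem_set //= ?indicE ?mem_set // ?mule1 //; split=> //=; rewrite in_itv /= r0 (le_trans rz').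
rewrite [in RHS]memNset //; have [r0|r0] := leP 0 r.
  rewrite indicE [X in (_ * (nat_of_bool X)%:R%:E)%E]memNset ?mule0 //= => h'.
  by apply: rz; rewrite /= in_itv /= r0.
rewrite [X in (X * _)%E](_ : _ = 0%E) ?mul0e // memNset // => -[].
by rewrite /= in_itv /= leNgt r0.
Qed.

Lemma sqP_prim : sqP t prim.
Proof.
have [sI _] := drift_sqi (measurable_itv _) (mu_itv t0) hf.
have i2 := sqi_integrable hf.
pose B w := t * \int[mu]_(s in `[0, t]%classic) (f s w) ^+ 2.
split; first exact: measurable_prim.
rewrite tonelli2 //=; last 2 first.
- by apply/measurable_EFinP; apply: measurable_funX; exact: measurable_prim.
- by move=> z _; rewrite lee_fin sqr_ge0.
have mB : measurable_fun setT B.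
  by apply: measurable_funM => //; exact: (measurable_fubini2 (measurable_itv _) i2).
have B0 w : 0 <= B w by rewrite mulr_ge0 // isq_ge0.
apply: (@le_lt_trans _ _ (\int[Pr]_w (B w * t)%:E)%E).
  apply: ae_ge0_le_integral => //.
  - by move=> w _; apply: integral_ge0 => s _; rewrite lee_fin sqr_ge0.
  - apply: (measurable_tonelli (measurable_itv _) (f := fun z => (prim z.1 z.2 ^+ 2)%:E)).
      by apply/measurable_EFinP; apply: measurable_funX; exact: measurable_prim.
    by move=> z _; rewrite lee_fin sqr_ge0.
  - by move=> w _; rewrite lee_fin mulr_ge0.
  - by apply/measurable_EFinP; apply: measurable_funM.
  - apply: filterS (drift_section (measurable_itv _) (mu_itv t0) hf) => w hw _.
    have mI (s : R) : `[0, s]%classic s -> measurable (`[0, s]%classic : set R) by [].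
    apply: (@le_trans _ _ (\int[mu]_(s in `[0%R, t]) (cst (B w)%:E) s)%E); last first.
      by rewrite integral_cst // [X in (_ * X)%E](mu_itv t0) -EFinM.
    apply: ge0_le_integral => //.
    - by move=> s _; rewrite lee_fin sqr_ge0.
    - apply/measurable_EFinP; apply: measurable_funX.
      have mp : measurable_fun setT (((fun z => prim z.1 z.2) : measurableTypeR R * Omega -> R) \_ (strip t)).
        by apply/(measurable_restrictT _ (mstrip t)); exact: measurable_prim.
      have := measurable_fun_pair1 w mp => /(measurable_funS measurableT (@subsetT _ `[0, t]%classic)).
      by apply: eq_measurable_fun => s /set_mem st; rewrite /patch mem_set.
    - move=> s; rewrite /= in_itv /= => /andP[s0 st]; rewrite lee_fin /B.
      have sub : (`[0, s]%classic : set (measurableTypeR R)) `<=` `[0, t]%classic.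
        by move=> r; rewrite /= !in_itv /= => /andP[-> rs]; exact: le_trans st.
      have [hs le_s] := @sqi_subset _ (measurableTypeR R) R mu _ _ _ (measurable_itv `[0, s])
        (measurable_itv `[0, t]) sub hw.
      have := @ip_CS _ (measurableTypeR R) R mu _ (measurable_itv `[0, s]) _ _ hs (sqi_one (measurable_itv `[0, s]) (mu_itv s0)).
      rewrite /prim; under eq_Rintegral do rewrite mulr1; move=> /le_trans; apply.
      rewrite mulrC (@eq_Rintegral _ _ _ _ _ (fun=> 1)); last by move=> s' _; rewrite expr1n.
      rewrite Rintegral_cst // mul1r (congr1 fine (mu_itv s0)) /=.
      by apply: ler_pM => //; exact: isq_ge0.
have iE := drift_sq_integrable (measurable_itv _) hf.
have iB : Pr.-integrable setT (EFin \o (fun w => B w * t)).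
  have := integrableZl measurableT (t * t) iE; apply: eq_integrable => // w _ /=.
  by rewrite /B -EFinM; congr EFin; ring.
exact: (integrable_lty measurableT iB).
Qed.

Lemma drift_self : \int[muP]_(z in strip t) (f z.1 z.2 * prim z.1 z.2) =
  2^-1 * \int[Pr]_w (prim t w) ^+ 2.
Proof.
have i := sqi_mul (mstrip t) hf sqP_prim.
have [sI _] := drift_sqi (measurable_itv _) (mu_itv t0) hf.
rewrite (fubini2 (measurable_itv _) i) -RintegralZl //; last exact: sqi_integrable.
apply: ae_eq_Rintegral => //.
- exact: (measurable_fubini2 (measurable_itv _) i).
- by apply: measurable_funM => //; apply: measurable_funX; exact: sI.1.
- apply: filterS (fubini_ae2 (measurable_itv _) (strip_integrable (measurable_itv _) (mu_itv t0) hf)) => w iw _.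
  exact: integral_mul_primitive.
Qed.

End DriftProcess.

Section ItoProcess.
Context d (Omega : measurableType d) (R : realType).
Variable (Pr : probability Omega R).
Variable F : R -> set (set Omega).
Hypothesis hF : usual_filtration Pr F.
Variables (q : nat) (K : 'M[R]_q) (W : R -> Omega -> 'cV[R]_q).
Hypothesis nW : noise Pr F K W.
Local Notation mu := (@lebesgue_measure R).
Local Notation muP := (mu \x Pr)%E.
Local Notation sqO := (sqi Pr setT).
Local Notation sqP := (sqP Pr).
Local Notation strip t := (`[0, t]%classic `*` [set: Omega] : set (measurableTypeR R * Omega)).
Local Notation gito := (gito Pr F W).
Local Notation strip_int := (strip_int Pr).

(* [dx = g dt + sum_i h_i dW_i] on [0, T], with [x 0 = 0]. *)
Record itop (T : R) (x g : R -> Omega -> R) (h : 'I_q -> R -> Omega -> R) : Prop := Itop {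
  itop_x_ad : forall t, 0 <= t -> t <= T -> rv_measurable (F t) (x t);
  itop_g_ad : forall t, 0 <= t -> t <= T -> rv_measurable (F t) (g t);
  itop_x : sqP T x;
  itop_g : sqP T g;
  itop_eq : forall t, 0 <= t -> t <= T -> exists I : 'I_q -> Omega -> R,
    (forall i, gito i t (h i) (I i)) /\
    {ae Pr, forall w, x t w = prim g t w + \sum_i I i w} }.

Lemma prim_lin T (a b : R) g g' t : 0 <= t -> t <= T -> sqP T g -> sqP T g' ->
  {ae Pr, forall w, prim (fun s w => a * g s w + b * g' s w) t w = a * prim g t w + b * prim g' t w}.
Proof.
move=> t0 tT hg hg'.
have [h _] := sqP_sub tT hg; have [h' _] := sqP_sub tT hg'.
have i := strip_integrable (measurable_itv _) (mu_itv t0) h.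
have i' := strip_integrable (measurable_itv _) (mu_itv t0) h'.
apply: filterS2 (fubini_ae2 (measurable_itv _) i) (fubini_ae2 (measurable_itv _) i') => w iw iw'.
by rewrite /prim RintegralL.
Qed.

Lemma itop_lin T (a b : R) x g h x' g' h' : itop T x g h -> itop T x' g' h' ->
  itop T (fun s w => a * x s w + b * x' s w) (fun s w => a * g s w + b * g' s w)
    (fun i s w => a * h i s w + b * h' i s w).
Proof.
move=> p p'; split.
- move=> t t0 tT; apply: (rv_lin (Fsigma hF t0)); [exact: (itop_x_ad p)|exact: (itop_x_ad p')].
- move=> t t0 tT; apply: (rv_lin (Fsigma hF t0)); [exact: (itop_g_ad p)|exact: (itop_g_ad p')].
- exact: (sqi_lin (mstrip T) a b (itop_x p) (itop_x p')).
- exact: (sqi_lin (mstrip T) a b (itop_g p) (itop_g p')).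
- move=> t t0 tT; have [I [hI eI]] := itop_eq p t0 tT; have [J [hJ eJ]] := itop_eq p' t0 tT.
  exists (fun i w => a * I i w + b * J i w); split; first by move=> i; exact: (gito_lin hF nW a b (hI i) (hJ i)).
  apply: filterS3 (prim_lin a b t0 tT (itop_g p) (itop_g p')) eI eJ => w -> -> ->.
  by rewrite big_split /= -!mulr_sumr; ring.
Qed.

Lemma itop_sub T T' x g h : T' <= T -> itop T x g h -> itop T' x g h.
Proof.
move=> TT p; split.
- by move=> t t0 tT; apply: (itop_x_ad p) => //; exact: le_trans TT.
- by move=> t t0 tT; apply: (itop_g_ad p) => //; exact: le_trans TT.
- exact: (sqP_sub TT (itop_x p)).1.
- exact: (sqP_sub TT (itop_g p)).1.
- by move=> t t0 tT; apply: (itop_eq p) => //; exact: le_trans TT.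
Qed.

Lemma itop_sqO T x g h t : itop T x g h -> 0 <= t -> t <= T -> sqO (x t).
Proof.
move=> p t0 tT; have [I [hI eI]] := itop_eq p t0 tT.
have [hg _] := sqP_sub tT (itop_g p).
have [sa _] := drift_sqi (measurable_itv _) (mu_itv t0) hg.
have sm : sqO (fun w => \sum_i I i w) by apply: sqi_sum => // i; case: (hI i).
apply: (ae_eq_sqi measurableT _ _ (sqiD measurableT sa sm)).
  apply: (rv_measurable_fun (Fmeas hF t0)); exact: (itop_x_ad p).
by apply: filterS eI => w -> _.
Qed.

(* E[g(s) (x(t) - x(s))] only sees the drift, which gives the cross term
   E[(int_0^t g) m(t)] = int_0^t E[g(s) m(s)] ds for the martingale part m. *)
Lemma itop_isq T x g h t : itop T x g h -> 0 <= t -> t <= T ->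
  \int[Pr]_w (x t w) ^+ 2 = strip_int t (fun s w => 2 * (x s w * g s w) +
     \sum_i \sum_j K i j * (h i s w * h j s w)).
Proof.
move=> p t0 tT; have [I [hI eI]] := itop_eq p t0 tT.
have [hg _] := sqP_sub tT (itop_g p).
have [hx _] := sqP_sub tT (itop_x p).
have [sa _] := drift_sqi (measurable_itv _) (mu_itv t0) hg.
have sI i : sqO (I i) by case: (hI i).
pose m w := \sum_i I i w.
have sm : sqO m by apply: sqi_sum.
have sprim := sqP_prim t0 hg.
have cross : \int[Pr]_w (prim g t w * m w) =
    strip_int t (fun s w => g s w * x s w) - 2^-1 * \int[Pr]_w (prim g t w) ^+ 2.
  have hmP : sqP t (fun _ w => m w) by exact: sqP_cst.
  rewrite (drift_mul (measurable_itv _) (mu_itv t0) hg hmP sm) -(drift_self t0 hg) /strip_int.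
  have igm := sqi_mul (mstrip t) hg hmP.
  have igx := sqi_mul (mstrip t) hg hx.
  have igp := sqi_mul (mstrip t) hg sprim.
  have igxp := integrable_lin (mstrip t) 1 (-1) igx igp.
  transitivity (\int[muP]_(z in strip t) (1 * (g z.1 z.2 * x z.1 z.2) + (-1) * (g z.1 z.2 * prim g z.1 z.2))).
    2: by rewrite RintegralL ?mul1r ?mulN1r //; exact: (mstrip t).
  rewrite (fubini1 (measurable_itv _) igm) (fubini1 (measurable_itv _) igxp).
  apply: ae_eq_Rintegral.
  - exact: measurable_itv.
  - exact: (measurable_fubini1 (measurable_itv _) igm).
  - exact: (measurable_fubini1 (measurable_itv _) igxp).
  apply: filterS (fubini_ae1 (measurable_itv _) (sqi_integrable hg)) => s + st.
  move=> /(_ st) is2; move: st; rewrite /= in_itv /= => /andP[s0 st].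
  have sT := le_trans st tT.
  have sgs : sqO (g s).
    apply: integrable_sqi => //; apply: (rv_measurable_fun (Fmeas hF s0)); exact: (itop_g_ad p).
  have [J [hJ eJ]] := itop_eq p s0 sT.
  have sJ i : sqO (J i) by case: (hJ i).
  have [hgs _] := sqP_sub st hg.
  have [sas _] := drift_sqi (measurable_itv _) (mu_itv s0) hgs.
  transitivity (\int[Pr]_w (g s w * \sum_i J i w)).
    under eq_Rintegral do rewrite /m mulr_sumr.
    under [RHS]eq_Rintegral do rewrite mulr_sumr.
    rewrite !Rintegral_sumr //; try by move=> i; exact: sqi_mul.
    apply: eq_bigr => i _; apply: (gito_mart hF nW s0 st (hI i) (hJ i)) => //.
    exact: (itop_g_ad p).
  have sxs := itop_sqO p s0 sT.
  have sJs : sqO (fun w => \sum_i J i w) by exact: sqi_sum.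
  apply: ae_eq_Rintegral => //.
  - by apply: measurable_funM; [exact: sgs.1|exact: sJs.1].
  - have := integrable_lin measurableT 1 (-1) (sqi_mul measurableT sgs sxs) (sqi_mul measurableT sgs sas).
    by move=> /integrableP[/measurable_EFinP].
  - apply: filterS eJ => w -> _ /=; rewrite -/(prim g s w); ring.
have mm : \int[Pr]_w (m w) ^+ 2 = \sum_i \sum_j K i j * strip_int t (fun s w => h i s w * h j s w).
  rewrite (@eq_Rintegral _ _ _ _ _ (fun w => \sum_i \sum_j (I i w * I j w))).
    have iI i j : Pr.-integrable setT (EFin \o (fun w => I i w * I j w)) by exact: sqi_mul.
    rewrite Rintegral_sumr //; last by move=> i; exact: integrable_sumr.
    apply: eq_bigr => i _; rewrite Rintegral_sumr //; apply: eq_bigr => j _.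
    exact: (gito_isometry hF nW).
  by move=> w _; rewrite expr2 /m mulr_suml; apply: eq_bigr => i _; rewrite mulr_sumr.
have -> : \int[Pr]_w (x t w) ^+ 2 = \int[Pr]_w (1 * prim g t w + 1 * m w) ^+ 2.
  apply: ae_eq_Rintegral => //.
  - by apply: measurable_funX; exact: (itop_sqO p t0 tT).1.
  - by apply: measurable_funX; exact: (sqi_lin measurableT 1 1 sa sm).1.
  - by apply: filterS eI => w -> _; rewrite !mul1r.
(* The second moment of the drift integral enters once from the expanded square and once with the
   opposite sign from twice [cross], and cancels. *)
rewrite isq_lin // cross mm /strip_int.
have shh i : sqP t (h i) by case: (hI i).
have ihh i j : muP.-integrable (strip t) (EFin \o (fun z => h i z.1 z.2 * h j z.1 z.2)).
  exact: (sqi_mul (mstrip t) (shh i) (shh j)).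
have iK i j : muP.-integrable (strip t) (EFin \o (fun z => K i j * (h i z.1 z.2 * h j z.1 z.2))).
  exact: (integrableZl (mstrip t) _ (ihh i j)).
have iKs i : muP.-integrable (strip t) (EFin \o (fun z => \sum_j K i j * (h i z.1 z.2 * h j z.1 z.2))).
  exact: (integrable_sumr (mstrip t)).
have iKss : muP.-integrable (strip t) (EFin \o (fun z => \sum_i \sum_j K i j * (h i z.1 z.2 * h j z.1 z.2))).
  exact: (integrable_sumr (mstrip t)).
have ixg := sqi_mul (mstrip t) hx hg.
rewrite RintegralD //; [|exact: (mstrip t)|exact: (integrableZl (mstrip t) 2 ixg)].
rewrite (RintegralZl _ (mstrip t)) // (Rintegral_sumr (mstrip t)) //.
have -> : \sum_i \sum_j K i j * \int[muP]_(z in strip t) (h i z.1 z.2 * h j z.1 z.2) =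
   \sum_i \int[muP]_(z in strip t) (\sum_j K i j * (h i z.1 z.2 * h j z.1 z.2)).
  apply: eq_bigr => i _; rewrite (Rintegral_sumr (mstrip t)) //; apply: eq_bigr => j _.
  by rewrite (RintegralZl _ (mstrip t)).
have e : strip_int t (fun s w => g s w * x s w) = strip_int t (fun s w => x s w * g s w).
  by apply: eq_Rintegral => z _; rewrite mulrC.
by rewrite /strip_int in e; rewrite e; field.
Qed.

End ItoProcess.

Section VectorIto.
Context d (Omega : measurableType d) (R : realType).
Variable (Pr : probability Omega R).
Variable F : R -> set (set Omega).
Hypothesis hF : usual_filtration Pr F.
Variables (q : nat) (K : 'M[R]_q) (W : R -> Omega -> 'cV[R]_q).
Hypothesis nW : noise Pr F K W.
Local Notation mu := (@lebesgue_measure R).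
Local Notation muP := (mu \x Pr)%E.
Local Notation sqO := (sqi Pr setT).
Local Notation sqP := (sqP Pr).
Local Notation strip t := (`[0, t]%classic `*` [set: Omega] : set (measurableTypeR R * Omega)).
Local Notation gito := (gito Pr F W).
Local Notation strip_int := (strip_int Pr).
Local Notation itop := (itop Pr F W).

(** Open on the left, so that a slab is disjoint from the strip up to its left end and consecutive
    slabs tile the strip without its initial time. *)
Definition slab_int (s t : R) (f : R -> Omega -> R) : R :=
  \int[muP]_(z in `]s, t]%classic `*` setT) f z.1 z.2.

Lemma mslab s t : measurable (`]s, t]%classic `*` [set: Omega] : set (measurableTypeR R * Omega)).
Proof. by apply: measurable_strip; exact: measurable_itv. Qed.

Lemma slab_sub (s t T : R) : 0 <= s -> t <= T ->
  (`]s, t]%classic `*` [set: Omega] : set (measurableTypeR R * Omega)) `<=` strip T.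
Proof.
move=> s0 tT z [+ _]; rewrite /= in_itv /= => /andP[h1 h2]; split=> //=.
by rewrite in_itv /= (le_trans s0 (ltW h1)) (le_trans h2).
Qed.

Lemma strip_slab (s t : R) f : 0 <= s -> s <= t ->
  muP.-integrable (strip t) (EFin \o (fun z => f z.1 z.2)) ->
  strip_int t f - strip_int s f = slab_int s t f.
Proof.
move=> s0 st fi.
have e : strip t = strip s `|` (`]s, t]%classic `*` [set: Omega] : set (measurableTypeR R * Omega)).
  apply/seteqP; split => [z [+ _]|z [[+ _]|[+ _]]]; rewrite /= !in_itv /= => /andP[h1 h2].
  - by have [zs|sz] := leP z.1 s; [left|right]; rewrite ?h1 ?h2.
  - by rewrite h1 (le_trans h2).
  - by rewrite h2 (le_trans s0 (ltW h1)).
rewrite /strip_int e Rintegral_setU //; first by rewrite addrC addKr.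
- exact: mstrip.
- exact: mslab.
- by rewrite -e.
- apply/disj_setPS => z [[h1 _] [h2 _]]; move: h1 h2; rewrite /= !in_itv /= => /andP[_ h1] /andP[h2 _].
  by move: (lt_le_trans h2 h1); rewrite ltxx.
Qed.

(** Cauchy-Schwarz in time for the drift, the isometry for the martingale part. The factors 2 and
    [q] come from squaring sums of 2 and of [q] terms. *)
Lemma itop_incr_le T x g h s t : itop T x g h -> 0 <= s -> s <= t -> t <= T ->
  \int[Pr]_w (x t w - x s w) ^+ 2 <= 2 * ((t - s) * slab_int s t (fun r w => g r w ^+ 2)) +
    2 * (q%:R * \sum_i K i i * slab_int s t (fun r w => h i r w ^+ 2)).
Proof.
move=> p s0 st tT; have t0 := le_trans s0 st; have sT := le_trans st tT.
have [I [hI eI]] := itop_eq p t0 tT; have [J [hJ eJ]] := itop_eq p s0 sT.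
have [hg _] := sqP_sub tT (itop_g p).
have [hgs lg] := sqi_subset (mslab s t) (mstrip T) (slab_sub s0 tT) (itop_g p).
have mst : mu `]s, t]%classic = (t - s)%:E.
  rewrite lebesgue_measure_itv /= lte_fin; case: ltP => [_|ts]; first by rewrite EFinB.
  by congr EFin; apply/eqP; rewrite eq_sym subr_eq0 eq_le st ts.
have [sa la] := drift_sqi (measurable_itv _) mst hgs.
have sI i : sqO (I i) by case: (hI i).
have sJ i : sqO (J i) by case: (hJ i).
pose D i w := I i w - J i w.
have sD i : sqO (D i) by exact: sqiB.
have sDD : sqO (fun w => \sum_i D i w) by exact: sqi_sum.
have -> : \int[Pr]_w (x t w - x s w) ^+ 2 =
   \int[Pr]_w (\int[mu]_(r in `]s, t]%classic) g r w + \sum_i D i w) ^+ 2.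
  apply: ae_eq_Rintegral => //.
  - by apply: measurable_funX; exact: (sqiB measurableT (itop_sqO hF p t0 tT) (itop_sqO hF p s0 sT)).1.
  - by apply: measurable_funX; exact: (sqiD measurableT sa sDD).1.
  - have := fubini_ae2 (measurable_itv _) (strip_integrable (measurable_itv _) (mu_itv t0) hg).
    apply: filterS3 eI eJ => w -> -> ig _; congr (_ ^+ 2).
    have -> : \int[mu]_(r in `]s, t]%classic) g r w = prim g t w - prim g s w.
      by rewrite /prim Rintegral_itvB.
    by rewrite /D sumrB; ring.
apply: (le_trans (isqD_le measurableT sa sDD)).
apply: lerD; rewrite ler_pM2l //.
apply: (le_trans (isq_sum_le measurableT sD)); rewrite card_ord ler_wpM2l //.
apply: ler_sum => i _; rewrite (gito_incr hF nW s0 st (hI i) (hJ i)) strip_slab //.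
by have [hh _ _] := hI i; exact: (sqi_integrable hh).
Qed.

Lemma itop_zero_ae T x g h : 0 <= T -> itop T x g h -> {ae Pr, forall w, x 0 w = 0}.
Proof.
move=> T0 p; have [I [hI eI]] := itop_eq p (lexx 0) T0.
have z (f : R -> Omega -> R) : (fun w => prim f (0 : R) w) = fun=> 0.
  apply/funext => w; rewrite /prim.
  have -> : (`[0, 0]%classic : set R) = [set 0] by rewrite set_itv1.
  exact: Rintegral_set1.
have I0 i : {ae Pr, forall w, I i w = 0}.
  have [hh sI _] := hI i; apply: (isq_eq0_ae sI).
  rewrite (gito_isq hF nW (hI i)) /strip_int (fubini2 (measurable_itv _) (sqi_integrable hh)).
  rewrite (@eq_Rintegral _ _ _ _ _ (fun=> 0)); last first.
    by move=> w _; exact: (congr1 (fun f => f w) (z (fun s w => h i s w ^+ 2))).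
  by rewrite Rintegral_cst // mul0r mulr0.
have : {ae Pr, forall w i, I i w = 0}.
  exact: filter_forall.
apply: filterS2 eI => w -> h0; rewrite (congr1 (fun f => f w) (z g)) big1 ?addr0 // => i _.
Qed.

Definition vitop n (T : R) (x g : R -> Omega -> 'cV[R]_n) (h : 'I_q -> R -> Omega -> 'cV[R]_n) :=
  forall c, itop T (fun t w => x t w c 0) (fun t w => g t w c 0) (fun i t w => h i t w c 0).

Lemma itop0 T : itop T (fun _ _ => 0) (fun _ _ => 0) (fun _ _ _ => 0).
Proof.
have z t : sqP t (fun _ _ => 0) by exact: sqi0.
split=> //.
- by move=> t t0 _; exact: (rv_cst (Fsigma hF t0)).
- by move=> t t0 _; exact: (rv_cst (Fsigma hF t0)).
- move=> t t0 _; exists (fun _ _ => 0); split.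
    move=> i; have := gito_sp (W := W) nW i ([::] : seq (velt Pr F t)).
    by congr (gito _ _ _ _); apply/funext => s; [apply/funext => w|]; rewrite /sp /si big_nil.
  apply: aeW => w; rewrite big1 // addr0 /prim.
  by rewrite Rintegral_cst ?mul0r //; exact: measurable_itv.
Qed.

Lemma itop_sum n T (a : 'I_n -> R) (x g : 'I_n -> R -> Omega -> R)
    (h : 'I_n -> 'I_q -> R -> Omega -> R) : (forall c, itop T (x c) (g c) (h c)) ->
  itop T (fun t w => \sum_c a c * x c t w) (fun t w => \sum_c a c * g c t w)
    (fun i t w => \sum_c a c * h c i t w).
Proof.
move=> p.
have key (s : seq 'I_n) : itop T (fun t w => \sum_(c <- s) a c * x c t w)
    (fun t w => \sum_(c <- s) a c * g c t w) (fun i t w => \sum_(c <- s) a c * h c i t w).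
  elim: s => [|c s IH].
    have := itop0 T; congr (itop _ _ _ _); apply/funext => t; apply/funext => w; try apply/funext => s; by rewrite big_nil.
  have := itop_lin hF nW (a c) 1 (p c) IH.
  by congr (itop _ _ _ _); apply/funext => t; apply/funext => w; try apply/funext => s';
    rewrite big_cons mul1r.
exact: key.
Qed.

Lemma vitop_mulmx m n T (L : 'M[R]_(m, n)) x g h : vitop T x g h ->
  vitop T (fun t w => L *m x t w) (fun t w => L *m g t w) (fun i t w => L *m h i t w).
Proof.
move=> p c; have := itop_sum (L c) p.
by congr (itop _ _ _ _); apply/funext => t; apply/funext => w; try apply/funext => s; rewrite mxE.
Qed.

Lemma vitop_lin n T (a b : R) (x g x' g' : R -> Omega -> 'cV[R]_n) h h' :
  vitop T x g h -> vitop T x' g' h' ->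
  vitop T (fun t w => a *: x t w + b *: x' t w) (fun t w => a *: g t w + b *: g' t w)
    (fun i t w => a *: h i t w + b *: h' i t w).
Proof.
move=> p p' c; have := itop_lin hF nW a b (p c) (p' c).
by congr (itop _ _ _ _); apply/funext => t; apply/funext => w; try apply/funext => s; rewrite !mxE.
Qed.

(** The quadratic form of [K], that is, the rate of growth of the quadratic variation of the noise
    with coefficients [y]. *)
Definition kap (y : 'I_q -> R) : R := \sum_i \sum_j K i j * (y i * y j).

(** Ito's formula in the mean for a diagonal quadratic form. Integrability of the integrand is part
    of the conclusion because pointwise dissipation inequalities are integrated against it later. *)
Lemma vitop_diag n T (D : 'I_n -> R) x g h t : vitop T x g h -> 0 <= t -> t <= T ->
  \sum_c D c * \int[Pr]_w (x t w c 0) ^+ 2 = strip_int t (fun s w =>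
    \sum_c D c * (2 * (x s w c 0 * g s w c 0) + kap (fun i => h i s w c 0))) /\
  muP.-integrable (strip t) (EFin \o (fun z =>
    \sum_c D c * (2 * (x z.1 z.2 c 0 * g z.1 z.2 c 0) + kap (fun i => h i z.1 z.2 c 0)))).
Proof.
move=> p t0 tT.
have i1 c : muP.-integrable (strip t) (EFin \o (fun z =>
     2 * (x z.1 z.2 c 0 * g z.1 z.2 c 0) + kap (fun i => h i z.1 z.2 c 0))).
  have [hx _] := sqP_sub tT (itop_x (p c)); have [hg _] := sqP_sub tT (itop_g (p c)).
  have [I [hI _]] := itop_eq (p c) t0 tT.
  have ik : muP.-integrable (strip t) (EFin \o (fun z => kap (fun i => h i z.1 z.2 c 0))).
    apply: (integrable_sumr (mstrip t)) => i; apply: (integrable_sumr (mstrip t)) => j.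
    apply: (integrableZl (mstrip t) (K i j) (f := EFin \o (fun z => h i z.1 z.2 c 0 * h j z.1 z.2 c 0))).
    by apply: (sqi_mul (mstrip t)); [case: (hI i)|case: (hI j)].
  have := integrable_lin (mstrip t) 2 1 (sqi_mul (mstrip t) hx hg) ik.
  by apply: eq_integrable; [exact: mstrip|move=> z _ /=; rewrite mul1r].
have i2 c : muP.-integrable (strip t) (EFin \o (fun z =>
     D c * (2 * (x z.1 z.2 c 0 * g z.1 z.2 c 0) + kap (fun i => h i z.1 z.2 c 0)))).
  exact: (integrableZl (mstrip t) (D c) (i1 c)).
split; last exact: (integrable_sumr (mstrip t)).
rewrite /strip_int (Rintegral_sumr (mstrip t)) //; apply: eq_bigr => c _.
by rewrite (RintegralZl _ (mstrip t)) // (itop_isq hF nW (p c) t0 tT).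
Qed.

End VectorIto.

Section StateIto.
Context d (Omega : measurableType d) (R : realType).
Variable (Pr : probability Omega R).
Variable F : R -> set (set Omega).
Hypothesis hF : usual_filtration Pr F.
Variables (q : nat) (K : 'M[R]_q) (W : R -> Omega -> 'cV[R]_q).
Hypothesis nW : noise Pr F K W.
Local Notation mu := (@lebesgue_measure R).
Local Notation muP := (mu \x Pr)%E.
Local Notation sqO := (sqi Pr setT).
Local Notation sqP := (sqP Pr).
Local Notation strip t := (`[0, t]%classic `*` [set: Omega] : set (measurableTypeR R * Omega)).
Local Notation gito := (gito Pr F W).
Local Notation strip_int := (strip_int Pr).
Local Notation velt := (velt Pr F).
Local Notation vitop := (vitop Pr F W).

Section SimpleData.
Variables (t : R) (k : nat) (tau : nat -> R) (xi : nat -> Omega -> R).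
Hypothesis sd : simple_data F t k tau xi.

Let tau_le a b : (a <= b)%N -> (b <= k)%N -> tau a <= tau b.
Proof.
case: sd => _ _ tm _ _; elim: b => [|b IH]; first by rewrite leqn0 => /eqP ->.
rewrite leq_eqVlt => /orP[/eqP -> //|ab bk].
exact: le_trans (IH ab (ltnW bk)) (tm _ bk).
Qed.

Let tau_ge0 (j : 'I_k) : 0 <= tau j.
Proof. by case: sd => t0 _ _ _ _; rewrite -t0; apply: tau_le => //; exact: ltnW. Qed.

Let tau_step (j : 'I_k) : tau j <= tau j.+1.
Proof. by apply: tau_le. Qed.

Let tau_end (j : 'I_k) : tau j.+1 <= t.
Proof. by case: sd => _ <- _ _ _; exact: tau_le. Qed.

Let xi_meas (j : 'I_k) : rv_measurable (F (tau j)) (xi j).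
Proof. by case: sd => _ _ _ h _; exact: h. Qed.

Let xi_sqi (j : 'I_k) : sqO (xi j).
Proof.
case: sd => _ _ _ _ /(_ _ (ltn_ord j))[b hb].
apply: (dominated_sqi measurableT _ _ (sqO_cst Pr b)).
  exact: (rv_measurable_fun (Fmeas hF (tau_ge0 j))).
by move=> w _; rewrite (le_trans (hb w)) // ler_norm.
Qed.

Definition simple_velts : seq (velt t) := [seq @Velt _ _ _ Pr F t (tau j) (tau j.+1) (xi j)
  (tau_ge0 j) (tau_step j) (tau_end j) (xi_meas j) (xi_sqi j) | j : 'I_k <- enum 'I_k].

Lemma sp_simple_velts s w : sp simple_velts s w = simple_process k tau xi s w.
Proof. by rewrite /sp /simple_process big_map big_enum. Qed.

Lemma si_simple_velts i w :
  si W i simple_velts w = simple_integral (fun s w => W s w i 0) k tau xi w.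
Proof. by rewrite /si /simple_integral big_map big_enum. Qed.

End SimpleData.

(** The approximating sequence in [is_ito_integral] is already one of generalised simple processes;
    Tonelli's theorem turns its iterated integral into an integral over the strip. *)
Lemma ito_gito i t H I : sqP t H ->
  is_ito_integral Pr F (fun s w => W s w i 0) H t I -> gito i t H I.
Proof.
move=> sH [mI [k [tau [xi [sd cH cI]]]]].
pose f l := simple_velts (sd l).
have [sI cI'] : sqO I /\ l2to Pr setT (fun l => si W i (f l)) I.
  apply: ge0_l2to0_sqi => //; first by move=> l; exact: (si_sqi nW).
  by under eq_fun do under eq_integral do rewrite si_simple_velts; exact: cI.
split=> //; exists f; split=> //.
have cH' := fine_cvg cH.
rewrite /l2to [X in X @ _](_ : _ = fine \o (fun l => \int[Pr]_w \int[mu]_(s in `[0%R, t])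
  ((H s w - simple_process (k l) (tau l) (xi l) s w) ^+ 2)%:E)%E); first exact: cH'.
apply/funext => l.
have sd2 := sqiB (mstrip t) sH (sp_sqP t (f l)).
rewrite /Rintegral tonelli2 /=; last 3 first.
- exact: measurable_itv.
- by case/integrableP: (sqi_integrable sd2).
- by move=> z _; rewrite lee_fin sqr_ge0.
congr fine; apply: eq_integral => w _; apply: eq_integral => s _.
by rewrite sp_simple_velts.
Qed.

Lemma sqnorm2_ge n (v : 'cV[R]_n) c : v c 0 ^+ 2 <= sqnorm2 v.
Proof.
rewrite /sqnorm2 (bigD1 c) //= lerDl; apply: sumr_ge0 => i _; exact: sqr_ge0.
Qed.

Lemma L2sq_strip (D : set (measurableTypeR R)) n (v : R -> Omega -> 'cV[R]_n) :
  measurable D ->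
  (forall i, measurable_fun (D `*` setT) (fun z : measurableTypeR R * Omega => v z.1 z.2 i 0)) ->
  L2sq Pr D v = (\int[muP]_(z in D `*` setT) (sqnorm2 (v z.1 z.2))%:E)%E.
Proof.
move=> mD mv; rewrite tonelli2 //.
- apply/measurable_EFinP; apply: measurable_sum => i.
  exact: measurable_funX.
- by move=> z _; rewrite lee_fin; apply: sumr_ge0 => i _; exact: sqr_ge0.
Qed.

Lemma L2sq_sqP (D : set (measurableTypeR R)) n (v : R -> Omega -> 'cV[R]_n) (T : R) :
  measurable D -> `[0, T]%classic `<=` D ->
  (forall i, measurable_fun (D `*` setT) (fun z : measurableTypeR R * Omega => v z.1 z.2 i 0)) ->
  (L2sq Pr D v < +oo)%E -> forall i, sqP T (fun s w => v s w i 0).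
Proof.
move=> mD TD mv; rewrite L2sq_strip // => fin i.
have sub : strip T `<=` D `*` setT by move=> z [z1 z2]; split=> //; exact: TD.
have mDT := measurable_strip (Omega := Omega) mD.
have hs : sqi muP (D `*` setT) (fun z => v z.1 z.2 i 0).
  split; first exact: mv.
  apply: le_lt_trans fin; apply: ge0_le_integral => //.
  - by move=> z _; rewrite lee_fin sqr_ge0.
  - by apply/measurable_EFinP; apply: measurable_funX.
  - by apply/measurable_EFinP; apply: measurable_sum => j; exact: measurable_funX.
  - by move=> z _; rewrite lee_fin sqnorm2_ge.
exact: (sqi_subset (mstrip T) mDT sub hs).1.
Qed.

Lemma L2norm_lty (D : set (measurableTypeR R)) n (v : R -> Omega -> 'cV[R]_n) :
  (L2norm Pr D v < +oo)%E -> (L2sq Pr D v < +oo)%E.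
Proof.
rewrite /L2norm; case: (L2sq Pr D v) => [r| |] //; first by rewrite !ltry.
by rewrite poweRyr // invr_eq0 pnatr_eq0.
Qed.

Lemma rv_mulmx n m (L : 'M[R]_(m, n)) t (v : Omega -> 'cV[R]_n) : 0 <= t ->
  (forall c, rv_measurable (F t) (fun w => v w c 0)) ->
  forall c, rv_measurable (F t) (fun w => (L *m v w) c 0).
Proof.
move=> t0 mv c; under eq_fun do rewrite mxE.
by apply: (rv_sum (Fsigma hF t0)) => j; exact: (rvZ (Fsigma hF t0)).
Qed.

Lemma sqP_mulmx n m (L : 'M[R]_(m, n)) T (v : R -> Omega -> 'cV[R]_n) :
  (forall c, sqP T (fun s w => v s w c 0)) -> forall c, sqP T (fun s w => (L *m v s w) c 0).
Proof.
move=> hv c.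
have h := sqi_sum (mstrip T) (index_enum 'I_n) (fun j => sqiZ (mstrip T) (L c j) (hv j)).
by apply: (eq_sqi _ h) => z _; rewrite /= mxE.
Qed.

(** The time sets only have to contain [[0, T]], so that the lemma serves both horizons of the
    theorem. *)
Lemma state_vitop (D D' : set (measurableTypeR R)) n m (A : 'M[R]_n) (B : 'M[R]_(n, m)) N u x (T : R) :
  measurable D -> measurable D' -> `[0, T]%classic `<=` D -> `[0, T]%classic `<=` D' -> 0 <= T ->
  in_L2 Pr F D' u -> is_state Pr F W D A B N 0 u x ->
  vitop T x (fun t w => A *m x t w + B *m u t w) (fun i t w => N i *m x t w) /\
  (forall c, sqP T (fun s w => u s w c 0)).
Proof.
move=> mD mD' TD TD' T0 [[uad um] uf] [[xad xm] _ xf xe].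
have inT (t : R) : 0 <= t -> t <= T -> `[0, T]%classic t by move=> ? ?; rewrite /= in_itv /=; apply/andP.
have itv_sub (t : R) : t <= T -> `[0, t]%classic `<=` (`[0, T]%classic : set R).
  by move=> tT r; rewrite /= !in_itv /= => /andP[-> /le_trans]; exact.
have hu c : sqP T (fun s w => u s w c 0) by apply: (L2sq_sqP mD') => //; exact: L2norm_lty.
have mxT c : measurable_fun (strip T) (fun z => x z.1 z.2 c 0).
  apply: measurable_funS (xm c); first exact: measurable_strip.
  by move=> z [z1 z2]; split=> //; exact: TD.
have hx c : sqP T (fun s w => x s w c 0).
  apply: (L2sq_sqP (measurable_itv `[0, T])) => //.
  exact: (xf T (TD _ (inT _ T0 (lexx T)))).
have hg c : sqP T (fun s w => (A *m x s w + B *m u s w) c 0).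
  apply: (eq_sqi _ (sqiD (mstrip T) (sqP_mulmx A hx c) (sqP_mulmx B hu c))).
  by move=> z _; rewrite [RHS]mxE.
split=> // c; split=> //.
- by move=> t t0 tT; exact: (xad t (TD _ (inT _ t0 tT))).
- move=> t t0 tT; under eq_fun do rewrite mxE; apply: (rvD (Fsigma hF t0)).
    by apply: rv_mulmx => // c'; exact: (xad t (TD _ (inT _ t0 tT))).
  by apply: rv_mulmx => // c'; exact: (uad t (TD' _ (inT _ t0 tT))).
- move=> t t0 tT; have [I [hI eI]] := xe t (TD _ (inT _ t0 tT)).
  exists (fun i w => I i w c 0); split.
    move=> i; apply: ito_gito; last exact: hI.
    apply: sqP_mulmx => c'; exact: (sqP_sub tT (hx c')).1.
  apply: filterS eI => w ->; rewrite !mxE add0r summxE; congr (_ + _).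
Qed.

End StateIto.

(** * Existence of solutions *)

Section RealLemmas.
Context (R : realType).
Local Notation mu := (@lebesgue_measure R).

Lemma geometric_cauchy (u : nat -> R) (L : nat) :
  (forall l, (L <= l)%N -> `|u l.+1 - u l| <= 2^-1 ^+ l) ->
  cvgn u /\ forall l, (L <= l)%N -> `|limn u - u l| <= 2 * 2^-1 ^+ l.
Proof.
(* The negative term in [m] is what the induction feeds on: it pays for the next step. *)
move=> hu; have step l m : (L <= l)%N -> (l <= m)%N ->
    `|u m - u l| <= 2 * 2^-1 ^+ l - 2 * 2^-1 ^+ m.
  move=> Ll; elim: m => [|m IH]; first by rewrite leqn0 => /eqP ->; rewrite !subrr normr0.
  rewrite leq_eqVlt => /orP[/eqP ->|lm]; first by rewrite !subrr normr0.
  have lm' : (l <= m)%N by [].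
  rewrite (_ : u m.+1 - u l = (u m.+1 - u m) + (u m - u l)); last by ring.
  apply: (le_trans (ler_normD _ _)); apply: (le_trans (lerD (hu m (leq_trans Ll lm')) (IH lm'))).
  by rewrite exprS; set x := 2^-1 ^+ m; set y := 2^-1 ^+ l; lra.
have bnd l m : (L <= l)%N -> (l <= m)%N -> `|u m - u l| <= 2 * 2^-1 ^+ l.
  move=> Ll lm; apply: (le_trans (step l m Ll lm)).
  by rewrite gerBl mulr_ge0 // exprn_ge0.
have cu : cvgn u.
  pose v k := u (k + L).+1 - u (k + L)%N.
  have cv : cvgn (series v).
    apply: normed_cvg; apply: (@series_le_cvg _ _ (geometric 1 2^-1)).
    - by move=> k; exact: normr_ge0.
    - by move=> k; rewrite /= mul1r exprn_ge0.
    - move=> k; rewrite /= mul1r (le_trans (hu _ _)) ?leq_addl //.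
      rewrite exprD ler_piMr ?exprn_ge0 //; apply: exprn_ile1; lra.
    - by apply: is_cvg_geometric_series; rewrite ger0_norm //; lra.
  have e : (fun k => u (k + L)%N) = (fun k => u L + series v k).
    apply/funext => k; rewrite /series /= /v; elim: k => [|k IH]; first by rewrite big_nil addr0.
    by rewrite big_nat_recr //= addrA -IH addSn; ring.
  have : cvgn (fun k => u (k + L)%N) by rewrite e; apply: is_cvgD => //; exact: is_cvg_cst.
  by move=> /cvg_ex[y] cy; apply: (cvgP y); rewrite -(cvg_shiftn L).
split=> // l Ll.
have c1 : (fun m => `|u m - u l|) @ \oo --> `|limn u - u l|.
  by apply: cvg_norm; apply: cvgB => //; exact: cvg_cst.
rewrite -(cvg_lim _ c1) //; apply: limr_le; first by apply: cvgP c1.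
by exists l => // m /= lm; exact: bnd.
Qed.

Lemma integral_expR (b t : R) : 0 < b -> 0 <= t ->
  mu.-integrable `[0, t]%classic (EFin \o (fun s => expR (2 * b * s))) /\
  \int[mu]_(s in `[0, t]%classic) expR (2 * b * s) = (expR (2 * b * t) - 1) / (2 * b).
Proof.
move=> b0 t0.
have ce : continuous (fun s : R => expR (2 * b * s)).
  move=> s; apply: continuous_comp; last exact: continuous_expR.
  by apply: cvgMr; exact: cvg_id.
split.
  apply: continuous_compact_integrable; first exact: segment_compact.
  by apply: continuous_subspaceT.
move: t0; rewrite le_eqVlt => /orP[/eqP <-|t0].
  by rewrite set_itv1 Rintegral_set1 mulr0 expR0 subrr mul0r.
pose G (s : R) : R := expR (2 * b * s) / (2 * b).
have dG (s : R) : is_derive s 1 G (expR (2 * b * s)).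
  apply: is_derive_eq; rewrite /GRing.scale /= !mulr1; field; lra.
have cG : continuous G by move=> s; apply: cvgMl; exact: ce.
have := @continuous_FTC2 R (fun s => expR (2 * b * s)) G 0 t t0.
rewrite /Rintegral => -> //.
- by rewrite /G mulr0 expR0 /= -mulrBl.
- exact: continuous_subspaceT.
- split=> //.
  + by apply: cvg_at_right_filter; exact: cG.
  + by apply: cvg_at_left_filter; exact: cG.
- by move=> s _; rewrite derive1E; exact: (@derive_val _ _ _ _ _ _ _ (dG s)).
Qed.

End RealLemmas.

(** * Uniform time grids and joint measurability *)

Section Grid.
Context (R : realType).
Variables (T : R).
Hypothesis T0 : 0 < T.
Local Notation mu := (@lebesgue_measure R).

Definition gp (m j : nat) : R := T * j%:R / m%:R.

Lemma gp0 m : gp m 0 = 0. Proof. by rewrite /gp mulr0 mul0r. Qed.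

Lemma gpm m : (0 < m)%N -> gp m m = T.
Proof. by move=> m0; rewrite /gp mulfK // pnatr_eq0 -lt0n. Qed.

Lemma gp_le m i j : (i <= j)%N -> gp m i <= gp m j.
Proof.
by move=> ij; rewrite /gp ler_wpM2r ?invr_ge0 // ler_wpM2l ?ler_nat // ltW.
Qed.

Lemma gp_ge0 m j : 0 <= gp m j.
Proof. by rewrite -(gp0 m); exact: gp_le. Qed.

Lemma gp_leT m j : (j <= m)%N -> gp m j <= T.
Proof.
case: (posnP m) => [->|m0 jm]; last by rewrite -[leRHS](gpm m0); exact: gp_le.
by rewrite leqn0 => /eqP ->; rewrite gp0 ltW.
Qed.

Lemma gpS m j : gp m j.+1 - gp m j = T / m%:R.
Proof. by rewrite /gp -mulrBl -mulrBr -natrB // subSnn mulr1. Qed.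

Lemma gp_cell m s : (0 < m)%N -> 0 < s -> s <= T ->
  exists j : 'I_m, gp m j < s /\ s <= gp m j.+1.
Proof.
move=> m0 s0 sT; have ex : exists k, s <= gp m k by exists m; rewrite gpm.
case: (ex_minnP ex) => -[|j] sj min; first by move: sj; rewrite gp0 leNgt s0.
have jm : (j < m)%N by apply: min; rewrite gpm.
exists (Ordinal jm); split=> //=; rewrite ltNge; apply/negP => /min.
by rewrite ltnn.
Qed.

Lemma gp_sum m (a : nat -> R) (j : 'I_m) s : gp m j < s -> s <= gp m j.+1 ->
  \sum_(i < m) a i * \1_(`]gp m i, gp m i.+1]%classic) s = a j.
Proof.
move=> h1 h2; rewrite (bigD1 j) //= big1 => [|i ij].
  by rewrite addr0 indicE mem_set ?mulr1 //= in_itv /= h1.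
rewrite indicE memNset ?mulr0 //= in_itv /= => /andP[g1 g2].
move: ij; rewrite -val_eqE neq_ltn => /orP[lt_ij|lt_ji].
  by move: (lt_le_trans h1 g2); rewrite ltNge gp_le.
by move: (lt_le_trans g1 h2); rewrite ltNge gp_le.
Qed.

(** A process with continuous paths is the pointwise limit of its left-endpoint interpolations on
    the grids, each of which is jointly measurable. *)
Lemma caratheodory_measurable d (Omega : measurableType d) (X : R -> Omega -> R) :
  (forall t, 0 <= t -> t <= T -> measurable_fun setT (X t)) ->
  (forall w, {within `[0, T], continuous (fun t => X t w)}) ->
  measurable_fun (`[0, T]%classic `*` setT) (fun z : measurableTypeR R * Omega => X z.1 z.2).
Proof.
move=> mX cX; have mS : measurable (`[0, T]%classic `*` [set: Omega] : set (measurableTypeR R * Omega)).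
  by apply: measurable_strip; exact: measurable_itv.
(* The cells are open on the left and miss time 0, hence the separate first term. *)
pose Xl (l : nat) (z : measurableTypeR R * Omega) : R := X 0 z.2 * \1_[set 0 : R] z.1 +
  \sum_(j < l.+1) X (gp l.+1 j) z.2 * \1_(`]gp l.+1 j, gp l.+1 j.+1]%classic) z.1.
apply: (@measurable_fun_cvg _ _ _ _ Xl).
- move=> l; apply: measurable_funTS; apply: measurable_funD.
    apply: measurable_funM.
      by apply: (measurableT_comp _ measurable_snd); apply: mX => //; exact: ltW.
    apply: (measurableT_comp _ measurable_fst); exact: measurable_indic.
  apply: measurable_sum => j; apply: measurable_funM.
    apply: (measurableT_comp _ measurable_snd); apply: mX; first exact: gp_ge0.
    by apply: gp_leT; exact: ltnW.
  by apply: (measurableT_comp _ measurable_fst); apply: measurable_indic; exact: measurable_itv.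
- move=> [s w] [/= + _]; rewrite in_itv /= => /andP[s0 sT].
  move: s0; rewrite le_eqVlt => /orP[/eqP <-|s0].
    rewrite (_ : (fun l => _) = fun=> X 0 w); first exact: cvg_cst.
    apply/funext => l; rewrite /Xl /= indicE mem_set // mulr1 big1 ?addr0 // => j _.
    by rewrite indicE memNset ?mulr0 //= in_itv /= ltNge gp_ge0.
  have /subspace_continuousP/(_ s) := cX w.
  rewrite /= in_itv /= (ltW s0) sT => /(_ isT) /cvgrPdist_lt cs.
  apply/cvgrPdist_lt => e e0; have [dl /= dl0 hd] := cs _ e0.
  have [L _ hL] : \forall l \near \oo, T / l.+1%:R < dl.
    have : (fun l => T * (l.+1%:R)^-1) @ \oo --> (0 : R).
      by rewrite -(mulr0 T); apply: cvgMr; exact: cvg_harmonic.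
    by move=> /cvgr_lt; apply.
  exists L => // l /= Ll; have [j [h1 h2]] := gp_cell (ltn0Sn l) s0 sT.
  rewrite /Xl /= indicE memNset ?mulr0 ?add0r; last by move=> /= es; move: s0; rewrite es ltxx.
  rewrite (gp_sum (fun j => X (gp l.+1 j) w) h1 h2); apply: hd; last first.
    by rewrite /= in_itv /= gp_ge0 gp_leT // ltnW.
  rewrite /ball /= gtr0_norm ?subr_gt0 //; apply: le_lt_trans (hL l Ll).
  by rewrite -(gpS l.+1 j) lerD2r.
Qed.

End Grid.

Section L2Fatou.
Context d (T : measurableType d) (R : realType).
Variables (mu : {measure set T -> \bar R}).

(** Fatou's lemma; the bound is known from the index [L] on only, so the sequence is shifted by
    [L]. *)
Lemma fatou_isq (X : nat -> T -> R) (Y : T -> R) (e : R) (L : nat) :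
  (forall l, sqi mu setT (X l)) -> (forall x, X ^~ x @ \oo --> Y x) ->
  (forall l, (L <= l)%N -> \int[mu]_x X l x ^+ 2 <= e) ->
  sqi mu setT Y /\ \int[mu]_x Y x ^+ 2 <= e.
Proof.
move=> sX XY Xe.
have mY : measurable_fun setT Y.
  by apply: (measurable_fun_cvg (h := X)) => [l|x _]; [case: (sX l)|exact: XY].
have le1 : (\int[mu]_x (Y x ^+ 2)%:E <= e%:E)%E.
  pose f l x := ((X (l + L)%N x) ^+ 2)%:E.
  have fY x : limn_einf (f ^~ x) = (Y x ^+ 2)%:E.
    apply: (cvg_limn_einf_sup _).1; apply: cvg_EFin; first by near=> l.
    have := XY x; rewrite -(cvg_shiftn L) => c1.
    by rewrite expr2; under eq_fun do rewrite /f /= expr2; exact: cvgM.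
  under eq_integral do rewrite -fY.
  apply: (le_trans (fatou mu measurableT _ _)).
  - move=> l; apply/measurable_EFinP; apply: measurable_funX; by case: (sX (l + L)%N).
  - by move=> l x _; rewrite lee_fin sqr_ge0.
  - rewrite limn_einf_lim; apply: lime_le; first exact: is_cvg_einfs.
    near=> l; apply: (@le_trans _ _ (\int[mu]_x f l x)%E).
      by apply: ereal_inf_lbound; exists l => //=.
    rewrite -EFin_Rintegral ?lee_fin; first by apply: Xe; exact: leq_addl.
      exact: measurableT.
    exact: sqi_integrable.
split; first by split=> //; exact: le_lt_trans le1 (ltry _).
have sY : sqi mu setT Y by split=> //; exact: le_lt_trans le1 (ltry _).
by rewrite -lee_fin EFin_Rintegral //; exact: sqi_integrable.
Unshelve. all: by end_near.
Qed.

End L2Fatou.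

(** * Suprema of processes, continuous limits and the maximal inequality *)

Section SupBound.
Context d (Omega : measurableType d) (R : realType).
Variable (Pr : probability Omega R).
Local Notation sqO := (sqi Pr setT).
Variable T : R.
Implicit Types Z : R -> Omega -> R.

(** A weak L^2 bound for the supremum of [|Z t|] over [[0, T]]. It is stated through a measurable
    exceptional set, so that the supremum itself need not be a random variable. *)
Definition sup_bd Z (c : R) := forall l : R, 0 < l -> exists E : set Omega,
  [/\ measurable E, (Pr E <= (c / l ^+ 2)%:E)%E &
      forall w, ~ E w -> forall t, 0 <= t -> t <= T -> `|Z t w| <= l].

Lemma sup_bd_le Z c c' : c <= c' -> sup_bd Z c -> sup_bd Z c'.
Proof.
move=> cc' h l l0; have [E [mE PE hE]] := h l l0; exists E; split=> //.
by apply: (le_trans PE); rewrite lee_fin ler_wpM2r // invr_ge0 exprn_ge0 // ltW.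
Qed.

(** Each summand is held to the level [l / 2], whence the factor 4. *)
Lemma sup_bdD Z Z' c c' : sup_bd Z c -> sup_bd Z' c' ->
  sup_bd (fun t w => Z t w + Z' t w) (4 * (c + c')).
Proof.
move=> h h' l l0; have l2 : 0 < l / 2 by rewrite divr_gt0.
have [E [mE PE hE]] := h _ l2; have [E' [mE' PE' hE']] := h' _ l2.
exists (E `|` E'); split; first exact: measurableU.
  apply: (le_trans (measureU2 Pr mE mE')); apply: (le_trans (leeD PE PE')).
  rewrite -EFinD lee_fin le_eqVlt; apply/orP; left; apply/eqP.
  by field; rewrite gt_eqF.
move=> w /not_orP[nE nE'] t t0 tT.
by rewrite (splitr l) (le_trans (ler_normD _ _)) // lerD ?hE ?hE'.
Qed.

Lemma sup_bd_ae Z Z' c : {ae Pr, forall w, forall t, 0 <= t -> t <= T -> Z t w = Z' t w} ->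
  sup_bd Z c -> sup_bd Z' c.
Proof.
move=> [A [mA PA hA]] h l l0; have [E [mE PE hE]] := h l l0.
exists (E `|` A); split; first exact: measurableU.
  by apply: (le_trans (measureU2 Pr mE mA)); rewrite /= PA adde0.
move=> w /not_orP[nE nA] t t0 tT.
have e : Z t w = Z' t w.
  by apply: contrapT => ne; apply: nA; apply: hA => /= /(_ t t0 tT).
by rewrite -e; exact: hE.
Qed.

Lemma markov_isq X l : sqO X -> 0 < l -> exists E : set Omega,
  [/\ measurable E, (Pr E <= ((\int[Pr]_w X w ^+ 2) / l ^+ 2)%:E)%E &
      forall w, ~ E w -> `|X w| <= l].
Proof.
move=> sX l0; exists [set w | l ^+ 2 < X w ^+ 2].
have mE : measurable [set w | l ^+ 2 < X w ^+ 2].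
  rewrite -[X in measurable X]setTI.
  apply: (@measurable_fun_ltr _ _ _ setT (fun=> l ^+ 2) (fun w => X w ^+ 2)) => //.
  by apply: measurable_funX; case: sX.
split=> //; last first.
  move=> w /negP; rewrite /= -leNgt => h.
  by rewrite -(ler_pXn2r (n := 2)) ?nnegrE ?normr_ge0 ?(ltW l0) // -normrX ger0_norm // sqr_ge0.
have l2 : 0 < l ^+ 2 by rewrite exprn_gt0.
rewrite -(setIT [set w | _]) -integral_indic //.
have iX := sqi_integrable sX.
have -> : (((\int[Pr]_w X w ^+ 2) / l ^+ 2)%:E = \int[Pr]_w ((l ^+ 2)^-1 * X w ^+ 2)%:E)%E.
  rewrite -EFin_Rintegral //; last exact: (integrableZl measurableT _ iX).
  by rewrite RintegralZl // mulrC.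
apply: ge0_le_integral => //.
- by apply/measurable_EFinP; exact: measurable_indic.
- by apply/measurable_EFinP; apply: measurable_funM => //; apply: measurable_funX; case: sX.
- move=> w _; rewrite lee_fin indicE.
  case: (boolP (w \in _)) => [|_]; last by rewrite mulr_ge0 ?sqr_ge0 // invr_ge0 ltW.
  by rewrite inE /= => h; rewrite mulrC ler_pdivlMr // mul1r ltW.
Qed.

End SupBound.

Section ContinuousLimit.
Context d (Omega : measurableType d) (R : realType).
Variable (Pr : probability Omega R).
Variable F : R -> set (set Omega).
Hypothesis hF : usual_filtration Pr F.
Local Notation sqO := (sqi Pr setT).
Variable T : R.

Variables (Z : nat -> R -> Omega -> R) (c : R).
Hypothesis c0 : 0 <= c.
Hypothesis Zad : forall l t, 0 <= t -> t <= T -> rv_measurable (F t) (Z l t).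
Hypothesis Zc : forall l w, {within `[0, T], continuous (fun t => Z l t w)}.
Hypothesis Zs : forall l t, 0 <= t -> t <= T -> sqO (Z l t).
Hypothesis Zb : forall l, sup_bd Pr T (fun t w => Z l.+1 t w - Z l t w) (c * 64^-1 ^+ l).
Hypothesis Ze : forall l t, 0 <= t -> t <= T ->
  \int[Pr]_w (Z l.+1 t w - Z l t w) ^+ 2 <= c * 64^-1 ^+ l.

(** Induction on [k] by squaring a sum of two terms: the constant 4 reproduces itself because
    [2 * 4 / 64 + 2 <= 4]. *)
Let Zcauchy l k t : 0 <= t -> t <= T ->
  \int[Pr]_w (Z (k + l)%N t w - Z l t w) ^+ 2 <= 4 * c * 64^-1 ^+ l.
Proof.
move=> t0 tT; elim: k l => [|k IH] l.
  under eq_Rintegral do rewrite subrr expr0n /=.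
  by rewrite Rintegral_cst // mul0r mulr_ge0 // ?exprn_ge0 // mulr_ge0.
have h1 := IH l.+1; have h2 := Ze l t0 tT.
have := isqD_le measurableT (sqiB measurableT (Zs (k + l.+1) t0 tT) (Zs l.+1 t0 tT))
  (sqiB measurableT (Zs l.+1 t0 tT) (Zs l t0 tT)).
rewrite (@eq_Rintegral _ _ _ _ _ (fun w => (Z (k.+1 + l)%N t w - Z l t w) ^+ 2)).
  move=> h; apply: (le_trans h); move: h1 h2; rewrite exprS.
  set a := \int[Pr]_w _; set b := \int[Pr]_w _.
  have y0 : 0 <= c * 64^-1 ^+ l by rewrite mulr_ge0 // exprn_ge0.
  move: y0; rewrite -!mulrA [c * (_ * _)]mulrCA; set y := c * _ => y0; lra.
by move=> w _; rewrite addSnnS; congr (_ ^+ 2); ring.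
Qed.

(** Borel-Cantelli: at the level [2^-l] the bound [Zb] gives probabilities of at most [c * 16^-l],
    which are summable. Off the limit superior of the exceptional sets the paths are uniformly
    Cauchy. On that null set the limit is set to 0, which keeps it continuous and, since the
    filtration is complete, adapted. *)
Lemma continuous_limit : exists Y : R -> Omega -> R,
  [/\ forall t, 0 <= t -> t <= T -> rv_measurable (F t) (Y t),
      forall w, {within `[0, T], continuous (fun t => Y t w)} &
      forall t, 0 <= t -> t <= T -> sqO (Y t) /\
        forall l, \int[Pr]_w (Y t w - Z l t w) ^+ 2 <= 4 * c * 64^-1 ^+ l].
Proof.
have h2 l : 0 < (2^-1 : R) ^+ l by rewrite exprn_gt0.
have [E hE] := choice (fun l => @Zb l _ (h2 l)).
have mE l : measurable (E l) by case: (hE l).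
pose B := lim_sup_set E.
have mB : measurable B.
  by apply: bigcap_measurable => // k _; apply: bigcup_measurable => j _.
have PB : Pr B = 0%E.
  apply: lim_sup_set_cvg0 => //.
  apply: (@le_lt_trans _ _ (\sum_(0 <= k <oo) ((2 * c) / (2 ^ (k + 1))%:R)%:E)%E).
    apply: lee_nneseries => // k _; have [_ + _] := hE k; move=> /le_trans; apply.
    rewrite lee_fin (_ : 2 * c / _ = c * 2^-1 ^+ k); last first.
      by rewrite addn1 expnS natrM natrX exprVn; field; rewrite expf_neq0 // pnatr_eq0.
    rewrite -mulrA ler_wpM2l // expr2 -exprMn -exprVn -exprMn.
    by apply: lerXn2r; rewrite ?nnegrE; lra.
  by rewrite (cvg_lim _ (@cvg_geometric_eseries_half _ (2 * c) 0)) ?ltry.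
pose G := ~` B.
have GF t : 0 <= t -> F t G.
  move=> t0; have [_ hC _] := Fsigma hF t0; rewrite /G -setTD; apply: hC.
  by apply: (Fnull hF t0); apply/negligibleP.
pose Z' l t w := (\1_G w : R) * Z l t w.
have Zfin w : exists L, forall l, (L <= l)%N -> forall t, 0 <= t -> t <= T ->
    `|Z' l.+1 t w - Z' l t w| <= 2^-1 ^+ l.
  have [Gw|nGw] := pselect (G w); last first.
    exists 0%N => l _ t t0 tT.
    by rewrite /Z' indicE memNset // !mul0r subrr normr0 ltW.
  have : exists L, forall l, (L <= l)%N -> ~ E l w.
    apply: contrapT => /forallNP h; apply: Gw => n _.
    have := h n; move=> /existsNP[l /not_implyP[nl /contrapT El]].
    by exists l.
  move=> [L hL]; exists L => l Ll t t0 tT.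
  by rewrite /Z' indicE mem_set // !mul1r; have [_ _] := hE l; apply => //; exact: hL.
pose Y t w := limn (fun l => Z' l t w).
have Ylim w : exists L, forall t, 0 <= t -> t <= T -> (fun l => Z' l t w) @ \oo --> Y t w /\
    forall l, (L <= l)%N -> `|Y t w - Z' l t w| <= 2 * 2^-1 ^+ l.
  have [L hL] := Zfin w; exists L => t t0 tT.
  by apply: (@geometric_cauchy _ (fun l => Z' l t w) L) => l Ll; exact: hL.
have Zad' l t : 0 <= t -> t <= T -> rv_measurable (F t) (Z' l t).
  move=> t0 tT; apply: (rvM (Fsigma hF t0)); last exact: Zad.
  by apply: (rv_indic (Fsigma hF t0)); exact: GF.
have Yad t : 0 <= t -> t <= T -> rv_measurable (F t) (Y t).
  move=> t0 tT; apply: (rv_cvg (Fsigma hF t0) (X := Z' ^~ t)) => [l|w]; first exact: Zad'.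
  by have [L /(_ t t0 tT)[]] := Ylim w.
have mG : measurable G by exact: measurableC.
have aeZ : {ae Pr, forall w, forall l t, Z' l t w = Z l t w}.
  exists B; split=> // w /= /existsNP[l /existsNP[t ne]].
  by apply: contrapT => Gw; apply: ne; rewrite /Z' indicE mem_set // mul1r.
exists Y; split=> //.
- move=> w; apply/subspace_continuousP => s; rewrite /= in_itv /= => /andP[s0 sT].
  apply/cvgrPdist_lt => e e0; have [L hL] := Ylim w.
  have [l [Ll le]] : exists l, (L <= l)%N /\ 2 * (2^-1 : R) ^+ l < e / 3.
    have : (fun l => 2 * (2^-1 : R) ^+ l) @ \oo --> (2 * 0 : R).
      by apply: cvgMr; apply: cvg_expr; rewrite ger0_norm //; lra.
    rewrite mulr0 => /cvgr_lt /(_ (e / 3)); rewrite divr_gt0 // => /(_ isT)[M _ hM].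
    exists (maxn L M); split; first exact: leq_maxl.
    by apply: hM; rewrite /= leq_maxr.
  have cZ' : {within `[0, T], continuous (fun t => Z' l t w)}.
    by move=> r; apply: cvgMr; exact: Zc.
  have /subspace_continuousP/(_ s) := cZ'.
  rewrite /= in_itv /= s0 sT => /(_ isT) /cvgrPdist_lt /(_ (e / 3)).
  rewrite divr_gt0 // => /(_ isT); apply: filterS2 (@withinT _ (nbhs s) `[0, T]%classic _).
  move=> t; rewrite /= in_itv /= => /andP[t0 tT] h3.
  have h1 := (hL s s0 sT).2 l Ll; have h2' := (hL t t0 tT).2 l Ll.
  rewrite (_ : Y s w - Y t w = (Y s w - Z' l s w) + (Z' l s w - Z' l t w) - (Y t w - Z' l t w)); last by ring.
  apply: (le_lt_trans (ler_normB _ _)); apply: (le_lt_trans (lerD (ler_normD _ _) (lexx _))).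
  by move: h1 h2' h3 le; lra.
- move=> t t0 tT.
  have sZ' l : sqO (Z' l t).
    apply: (dominated_sqi measurableT _ _ (Zs l t0 tT)).
      exact: (rv_measurable_fun (Fmeas hF t0) (Zad' l t t0 tT)).
    move=> w _; rewrite /Z' normrM ler_piMl // indicE; case: (_ \in _); by rewrite ?normr1 ?normr0.
  have aeE l k : \int[Pr]_w (Z' k t w - Z' l t w) ^+ 2 = \int[Pr]_w (Z k t w - Z l t w) ^+ 2.
    apply: ae_eq_Rintegral => //.
    + by apply: measurable_funX; case: (sqiB measurableT (sZ' k) (sZ' l)).
    + by apply: measurable_funX; case: (sqiB measurableT (Zs k t0 tT) (Zs l t0 tT)).
    + by apply: filterS aeZ => w h _; rewrite !h.
  have main l : sqO (fun w => Y t w - Z' l t w) /\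
      \int[Pr]_w (Y t w - Z' l t w) ^+ 2 <= 4 * c * 64^-1 ^+ l.
    apply: (@fatou_isq _ _ _ _ (fun k w => Z' k t w - Z' l t w) _ _ l).
    + by move=> k; exact: sqiB.
    + move=> w; apply: cvgB; last exact: cvg_cst.
      by have [L /(_ t t0 tT)[]] := Ylim w.
    + by move=> k lk; rewrite aeE -(subnK lk); exact: Zcauchy.
  have sY : sqO (Y t).
    apply: (eq_sqi _ (sqiD measurableT (main 0%N).1 (sZ' 0%N))) => w _; exact: subrK.
  split=> // l; apply: le_trans (main l).2; rewrite le_eqVlt; apply/orP; left; apply/eqP.
  apply: ae_eq_Rintegral => //.
  + by apply: measurable_funX; case: (sqiB measurableT sY (Zs l t0 tT)).
  + by apply: measurable_funX; case: (main l).1.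
  + by apply: filterS aeZ => w h _; rewrite h.
Qed.

End ContinuousLimit.

Section Maximal.
Context d (Omega : measurableType d) (R : realType).
Variable (Pr : probability Omega R).
Variable F : R -> set (set Omega).
Hypothesis hF : usual_filtration Pr F.
Local Notation sqO := (sqi Pr setT).
Variables (m : nat) (tau : nat -> R) (X : nat -> Omega -> R).
Hypothesis tau0 : forall j, (j <= m)%N -> 0 <= tau j.
Hypothesis tau_mono : forall i j, (i <= j)%N -> (j <= m)%N -> tau i <= tau j.
Hypothesis Xad : forall j, (j <= m)%N -> rv_measurable (F (tau j)) (X j).
Hypothesis Xs : forall j, (j <= m)%N -> sqO (X j).
Hypothesis Xmart : forall j Z, (j <= m)%N -> rv_measurable (F (tau j)) Z -> sqO Z ->
  \int[Pr]_w (Z w * X m w) = \int[Pr]_w (Z w * X j w).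

(* Kolmogorov's inequality, by decomposing according to the first passage above l. *)
Lemma maximal_ineq (l : R) : 0 < l ->
  measurable [set w | exists j, (j <= m)%N /\ l < `|X j w|] /\
  (Pr [set w | exists j, (j <= m)%N /\ (l < `|X j w|)%R] <=
     ((\int[Pr]_w X m w ^+ 2) / l ^+ 2)%:E)%E.
Proof.
move=> l0; pose phi (y : R) : R := \1_[set y | `|y| <= l] y.
have phiE y : phi y = if `|y| <= l then 1 else 0.
  by rewrite /phi indicE; case: ifP => h; [rewrite mem_set|rewrite memNset //= h].
have mphi : measurable_fun setT phi.
  apply: measurable_indic.
  rewrite (_ : [set y | _] = `[- l, l]%classic); first exact: measurable_itv.
  by apply/seteqP; split=> y /=; rewrite in_itv /= ler_norml.
(* [b k] indicates that the variables before index [k] stay within [l], and [c k] below indicates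
   that index [k] is the first to exceed it. *)
pose b k w := \prod_(i < k) phi (X i w).
have bS k w : b k.+1 w = b k w * phi (X k w) by rewrite /b big_ord_recr.
have b01 k w : b k w = 0 \/ b k w = 1.
  elim: k => [|k IH]; first by right; rewrite /b big_ord0.
  by rewrite bS phiE; case: ifP => _; rewrite ?mulr1 ?mulr0 //; left.
have bad k : (k <= m.+1)%N -> forall j, (k <= j.+1)%N -> (j <= m)%N -> rv_measurable (F (tau j)) (b k).
  elim: k => [|k IH] km j kj jm.
    rewrite (_ : b 0%N = fun=> 1); last by apply/funext => w; rewrite /b big_ord0.
    exact: (rv_cst (Fsigma hF (tau0 jm))).
  rewrite (_ : b k.+1 = fun w => b k w * phi (X k w)); last by apply/funext => w; rewrite bS.
  apply: (rvM (Fsigma hF (tau0 jm))); first by apply: IH => //; exact: ltnW.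
  apply: (rv_comp (Fsigma hF (tau0 jm)) mphi); apply: (rv_measurable_sub _ (Xad _)) => //.
  by apply: (Fsub hF); rewrite ?tau0 ?tau_mono.
pose c k w := b k w * (1 - phi (X k w)).
have c01 k w : c k w = 0 \/ c k w = 1 /\ l <= `|X k w|.
  rewrite /c phiE; case: ifPn => [_|]; first by rewrite subrr mulr0; left.
  by rewrite -ltNge subr0 mulr1 => h; case: (b01 k w) => ->; [left|right; split=> //; exact: ltW].
have cad k : (k <= m)%N -> rv_measurable (F (tau k)) (c k).
  move=> km; apply: (rvM (Fsigma hF (tau0 km))); first by apply: bad => //; exact: leqW.
  apply: (rvB (Fsigma hF (tau0 km))); first exact: (rv_cst (Fsigma hF (tau0 km))).
  by apply: (rv_comp (Fsigma hF (tau0 km)) mphi); exact: Xad.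
have mulbd (a Y : Omega -> R) : measurable_fun setT a -> (forall w, `|a w| <= 1) -> sqO Y ->
    sqO (fun w => a w * Y w).
  move=> ma a1 sY; apply: (dominated_sqi measurableT _ _ sY).
    by apply: measurable_funM => //; case: sY.
  by move=> w _; rewrite normrM ler_piMl.
have c1 k w : `|c k w| <= 1 by case: (c01 k w) => [|[]] ->; rewrite ?normr0 ?normr1.
have mc k : (k <= m)%N -> measurable_fun setT (c k).
  by move=> km; exact: (rv_measurable_fun (Fmeas hF (tau0 km)) (cad k km)).
have sc k : (k <= m)%N -> sqO (c k).
  move=> km; apply: (eq_sqi _ (mulbd _ _ (mc k km) (c1 k) (sqO_cst Pr 1))) => w _.
  by rewrite mulr1.
have mb k : (k <= m.+1)%N -> measurable_fun setT (b k).
  move=> km; apply: (rv_measurable_fun (Fmeas hF (tau0 (leqnn m)))).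
  by apply: bad.
have sb k : (k <= m.+1)%N -> sqO (fun w => 1 - b k w).
  move=> km; apply: (sqiB measurableT (sqO_cst Pr 1)).
  apply: (eq_sqi _ (mulbd _ _ (mb k km) _ (sqO_cst Pr 1))) => [w _|w]; first by rewrite mulr1.
  by case: (b01 k w) => ->; rewrite ?normr0 ?normr1.
have sbX k : (k <= m.+1)%N -> sqO (fun w => (1 - b k w) * X m w).
  move=> km; apply: mulbd; [by case: (sb k km)| |exact: Xs].
  by move=> w; case: (b01 k w) => ->; rewrite ?subr0 ?subrr ?normr0 ?normr1.
have scX k j : (k <= m)%N -> (j <= m)%N -> sqO (fun w => c k w * X j w).
  by move=> km jm; apply: mulbd; [exact: mc|exact: c1|exact: Xs].
have step k : (k <= m)%N ->
    l ^+ 2 * \int[Pr]_w c k w ^+ 2 <= \int[Pr]_w (c k w * X m w) ^+ 2.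
  move=> km; apply: (@le_trans _ _ (\int[Pr]_w (c k w * X k w) ^+ 2)).
    rewrite -RintegralZl //; last exact: (sqi_integrable (sc k km)).
    apply: le_Rintegral => //.
    - exact: (integrableZl measurableT _ (sqi_integrable (sc k km))).
    - exact: (sqi_integrable (scX k k km km)).
    - move=> w _; case: (c01 k w) => [->|[-> h]]; first by rewrite mul0r expr0n mulr0.
      by rewrite expr1n mulr1 mul1r -[leRHS](real_normK (num_real _)) lerXn2r ?nnegrE // ltW.
  (* The martingale property makes the mixed term equal to the second moment at time [k], so a
     nonnegative square yields the growth of second moments on the event of first passage at [k]. *)
  have h0 := isq_ge0 Pr setT (fun w => 1 * (c k w * X m w) + (-1) * (c k w * X k w)).
  rewrite (isq_lin measurableT _ _ (scX k m km (leqnn m)) (scX k k km km)) in h0.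
  have e : \int[Pr]_w (c k w * X m w * (c k w * X k w)) = \int[Pr]_w (c k w * X k w) ^+ 2.
    transitivity (\int[Pr]_w ((c k w * X k w) * X m w)).
      by apply: eq_Rintegral => w _; case: (c01 k w) => [->|[-> _]]; ring.
    rewrite (Xmart km); last 2 first.
    - apply: (rvM (Fsigma hF (tau0 km))); [exact: cad|exact: Xad].
    - exact: scX.
    by apply: eq_Rintegral => w _; case: (c01 k w) => [->|[-> _]]; ring.
  by move: h0; rewrite e; set u := \int[Pr]_w _; set v := \int[Pr]_w _; lra.
have split2 k (Y : Omega -> R) w : ((1 - b k.+1 w) * Y w) ^+ 2 = ((1 - b k w) * Y w) ^+ 2 + (c k w * Y w) ^+ 2.
  rewrite /c bS phiE; case: ifP => _; case: (b01 k w) => ->; ring.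
have claim k : (k <= m.+1)%N ->
    l ^+ 2 * \int[Pr]_w (1 - b k w) ^+ 2 <= \int[Pr]_w ((1 - b k w) * X m w) ^+ 2.
  elim: k => [_|k IH km].
    rewrite (@eq_Rintegral _ _ _ _ _ (fun=> 0)); last first.
      by move=> w _; rewrite /b big_ord0 subrr expr0n.
    by rewrite Rintegral_cst // mul0r mulr0 isq_ge0.
  have e1 : \int[Pr]_w (1 - b k.+1 w) ^+ 2 = \int[Pr]_w (1 - b k w) ^+ 2 + \int[Pr]_w c k w ^+ 2.
    rewrite -RintegralD //; last 2 first.
    - exact: (sqi_integrable (sb k (ltnW km))).
    - exact: (sqi_integrable (sc k km)).
    by apply: eq_Rintegral => w _; have := split2 k (fun=> 1) w; rewrite !mulr1.
  have e2 : \int[Pr]_w ((1 - b k.+1 w) * X m w) ^+ 2 =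
      \int[Pr]_w ((1 - b k w) * X m w) ^+ 2 + \int[Pr]_w (c k w * X m w) ^+ 2.
    rewrite -RintegralD //; last 2 first.
    - exact: (sqi_integrable (sbX k (ltnW km))).
    - exact: (sqi_integrable (scX k m km (leqnn m))).
    by apply: eq_Rintegral => w _; exact: split2.
  by rewrite e1 e2 mulrDr lerD ?IH ?step // ltnW.
set E := [set w | _].
have bE w : (1 - b m.+1 w) ^+ 2 = \1_E w.
  rewrite indicE; case: (boolP (w \in E)) => [|].
    rewrite inE => -[j [jm lX]]; rewrite /b (bigD1 (Ordinal (jm : (j < m.+1)%N))) //= phiE.
    by rewrite leNgt lX mul0r subr0 expr1n.
  rewrite notin_setE /= => /forallNP h; rewrite /b big1 ?subrr ?expr0n // => i _.
  rewrite phiE leNgt; case: ifPn => // /negPn lX.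
  by case: (h (val i)); split; first by rewrite -ltnS; exact: ltn_ord.
have mE : measurable E.
  have mI : measurable_fun setT (fun w => (1 - b m.+1 w) ^+ 2).
    by apply: measurable_funX; case: (sb m.+1 (leqnn _)).
  rewrite (_ : E = setT `&` (fun w => (1 - b m.+1 w) ^+ 2) @^-1` [set 1]); first exact: mI.
  rewrite setTI; apply/seteqP; split=> w /=; rewrite bE indicE.
    by move=> Ew; rewrite mem_set.
  by case: (boolP (w \in E)) => [|_ /eqP]; rewrite ?inE // eq_sym oner_eq0.
split=> //.
have PE : Pr E = (\int[Pr]_w (1 - b m.+1 w) ^+ 2)%:E.
  rewrite EFin_Rintegral //; last exact: (sqi_integrable (sb _ (leqnn _))).
  under eq_integral do rewrite bE.
  by rewrite integral_indic // setIT.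
rewrite PE lee_fin ler_pdivlMr ?exprn_gt0 // mulrC; apply: (le_trans (claim _ (leqnn _))).
apply: le_Rintegral => //.
- exact: (sqi_integrable (sbX _ (leqnn _))).
- exact: (sqi_integrable (Xs (leqnn m))).
- move=> w _; rewrite exprMn ler_piMl ?sqr_ge0 // bE indicE; by case: (_ \in _).
Qed.

End Maximal.

Section SupIto.
Context d (Omega : measurableType d) (R : realType).
Variable (Pr : probability Omega R).
Variable F : R -> set (set Omega).
Hypothesis hF : usual_filtration Pr F.
Variables (q : nat) (K : 'M[R]_q) (W : R -> Omega -> 'cV[R]_q).
Hypothesis nW : noise Pr F K W.
Local Notation mu := (@lebesgue_measure R).
Local Notation muP := (mu \x Pr)%E.
Local Notation sqO := (sqi Pr setT).
Local Notation sqP := (sqP Pr).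
Local Notation strip t := (`[0, t]%classic `*` [set: Omega] : set (measurableTypeR R * Omega)).
Local Notation gito := (gito Pr F W).
Local Notation strip_int := (strip_int Pr).
Local Notation itop := (itop Pr F W).
Variable T : R.
Hypothesis T0 : 0 < T.

Lemma prim_continuous (g : R -> R) : mu.-integrable `[0, T]%classic (EFin \o g) ->
  {within `[0, T], continuous (fun t => \int[mu]_(r in `[0, t]%classic) g r)}.
Proof.
move=> ig; have := parameterized_integral_continuous (ltW T0) ig.
by [].
Qed.

(** Cauchy-Schwarz in time bounds all [|prim g t|] simultaneously by the square root of [G], to
    which Markov's inequality applies. *)
Lemma prim_sup g : sqP T g ->
  sup_bd Pr T (prim g) (T * strip_int T (fun s w => g s w ^+ 2)).
Proof.
move=> sg l l0; have mI := measurable_itv `[0, T].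
have iG := drift_sq_integrable mI sg.
pose G w := T * \int[mu]_(s in `[0, T]%classic) g s w ^+ 2.
have G0 w : 0 <= G w by rewrite mulr_ge0 ?(ltW T0) // isq_ge0.
have iGG : Pr.-integrable setT (EFin \o G) by exact: (integrableZl measurableT T iG).
have sG2 : \int[Pr]_w G w = T * strip_int T (fun s w => g s w ^+ 2).
  rewrite /G RintegralZl //; congr (_ * _); symmetry.
  exact: (fubini2 mI (sqi_integrable sg)).
have mG : measurable_fun setT G by apply/measurable_EFinP; case/integrableP: iGG.
have sq : sqO (fun w => Num.sqrt (G w)).
  split.
    apply: (measurableT_comp _ mG); apply: continuous_measurable_fun; exact: sqrt_continuous.
  under eq_integral do rewrite sqr_sqrtr //.
  by rewrite -EFin_Rintegral // ltry.
have [E [mE PE hE]] := markov_isq sq l0.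
have [A [mA PA hA]] := drift_section mI (mu_itv (ltW T0)) sg.
exists (E `|` A); split; first exact: measurableU.
  apply: (le_trans (measureU2 Pr mE mA)); rewrite /= PA adde0 (le_trans PE) // lee_fin.
  rewrite (@eq_Rintegral _ _ _ _ _ G) ?sG2 // => w _; exact: sqr_sqrtr.
move=> w /not_orP[nE nA] t t0 tT; apply: le_trans (hE w nE).
have sgw : sqi mu `[0, T]%classic (g ^~ w) by apply: contrapT => h; apply: nA; exact: hA.
rewrite [leRHS]ger0_norm ?sqrtr_ge0 // -[leLHS]sqrtr_sqr ler_wsqrtr //.
have sub : `[0, t]%classic `<=` (`[0, T]%classic : set R).
  by move=> r; rewrite /= !in_itv /= => /andP[-> /le_trans]; exact.
have [sgt le1] := @sqi_subset _ (measurableTypeR R) R mu _ _ _ (measurable_itv `[0, t]) mI sub sgw.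
have s1 := sqi_one (measurable_itv `[0, t]) (mu_itv t0).
have := @ip_CS _ (measurableTypeR R) R mu _ (measurable_itv `[0, t]) _ _ sgt s1.
rewrite /prim; under eq_Rintegral do rewrite mulr1.
move=> /le_trans; apply; rewrite /G mulrC.
apply: ler_pM => //; [exact: isq_ge0|exact: isq_ge0|].
under eq_Rintegral do rewrite expr1n.
rewrite [leLHS](_ : _ = t) //; transitivity (1 * fine (mu `[0, t]%classic)).
  by apply: Rintegral_cst; exact: measurable_itv.
by rewrite mul1r mu_itv.
Qed.

Lemma dyadic_approx (s : R) (e : R) : 0 <= s -> s <= T -> 0 < e ->
  exists k j, (j <= 2 ^ k)%N /\ `|s - gp T (2 ^ k) j| < e.
Proof.
rewrite le_eqVlt => /orP[/eqP <-|s0] sT e0.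
  by exists 0%N, 0%N; rewrite gp0 subrr normr0.
have [k hk] : exists k, T * 2^-1 ^+ k < e.
  have : (fun l => T * (2^-1 : R) ^+ l) @ \oo --> (T * 0 : R).
    by apply: cvgMr; apply: cvg_expr; rewrite ger0_norm //; lra.
  by rewrite mulr0 => /cvgr_lt /(_ _ e0)[M _ hM]; exists M; apply: hM => /=.
have k0 : (0 < 2 ^ k)%N by rewrite expn_gt0.
have [j [h1 h2]] := gp_cell k0 s0 sT.
exists k, j; split; first exact: ltnW.
rewrite gtr0_norm ?subr_gt0 //; apply: le_lt_trans hk.
apply: (@le_trans _ _ (T / (2 ^ k)%:R)); last by rewrite natrX exprVn.
by rewrite -(gpS T (2 ^ k) j) lerD2r.
Qed.

Lemma gp_dyadic k j : gp T (2 ^ k) j = gp T (2 ^ k.+1) (2 * j).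
Proof.
rewrite /gp expnS !natrM; field.
by rewrite natrX expf_neq0 // pnatr_eq0.
Qed.

(** The maximal inequality is applied to the martingale part on dyadic grids. These are nested, so
    the exceptional sets increase and the uniform bound on their probabilities passes to the union;
    continuity of the paths then covers all times. *)
Lemma itop_sup x g h : itop T x g h -> (forall w, {within `[0, T], continuous (fun t => x t w)}) ->
  sup_bd Pr T x (4 * (q%:R * (\sum_i K i i * strip_int T (fun s w => h i s w ^+ 2)) +
                      T * strip_int T (fun s w => g s w ^+ 2))).
Proof.
move=> ix cx; set cM := q%:R * _.
pose M t w := x t w - prim g t w.
suff sM : sup_bd Pr T M cM.
  have := sup_bdD sM (prim_sup (itop_g ix)); apply: sup_bd_ae.
  by apply: nearW => w t _ _; exact: subrK.
have /choice[I hI] : forall t : R, exists I : 'I_q -> Omega -> R, 0 <= t -> t <= T ->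
    (forall i, gito i t (h i) (I i)) /\ {ae Pr, forall w, x t w = prim g t w + \sum_i I i w}.
  move=> t; have [[t0 tT]|nt] := pselect (0 <= t /\ t <= T).
    by have [I hI] := itop_eq ix t0 tT; exists I.
  by exists (fun=> fun=> 0) => t0 tT; case: nt.
pose J t w := \sum_i I t i w.
have sI t : 0 <= t -> t <= T -> forall i, sqO (I t i).
  by move=> t0 tT i; case: ((hI t t0 tT).1 i).
have sJ t : 0 <= t -> t <= T -> sqO (J t) by move=> t0 tT; apply: (sqi_sum measurableT) => i; exact: sI.
have Jad t : 0 <= t -> t <= T -> rv_measurable (F t) (J t).
  move=> t0 tT; apply: (rv_sum (Fsigma hF t0)) => i.
  exact: (gito_rv hF nW t0 ((hI t t0 tT).1 i)).
have TT : 0 <= T by exact: ltW.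
have Jm t Z : 0 <= t -> t <= T -> rv_measurable (F t) Z -> sqO Z ->
    \int[Pr]_w (Z w * J T w) = \int[Pr]_w (Z w * J t w).
  move=> t0 tT Zm sZ; under eq_Rintegral do rewrite mulr_sumr.
  under [RHS]eq_Rintegral do rewrite mulr_sumr.
  rewrite !Rintegral_sumr //; try by move=> i; exact: (sqi_mul measurableT sZ (sI _ _ _ i)).
  apply: eq_bigr => i _.
  exact: (gito_mart hF nW t0 tT ((hI T TT (lexx T)).1 i) ((hI t t0 tT).1 i)).
have JT : \int[Pr]_w J T w ^+ 2 <= cM.
  apply: (le_trans (isq_sum_le measurableT (sI T TT (lexx T)))).
  rewrite card_ord ler_wpM2l //; apply: ler_sum => i _.
  by rewrite (gito_isq hF nW ((hI T TT (lexx T)).1 i)).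
move=> l l0.
have gpk k j : (j <= 2 ^ k)%N -> 0 <= gp T (2 ^ k) j /\ gp T (2 ^ k) j <= T.
  by move=> jk; split; [exact: (gp_ge0 T0)|exact: (gp_leT T0)].
have JmT k j Z : (0 < 2 ^ k)%N -> (j <= 2 ^ k)%N -> rv_measurable (F (gp T (2 ^ k) j)) Z -> sqO Z ->
    \int[Pr]_w (Z w * J (gp T (2 ^ k) (2 ^ k)) w) = \int[Pr]_w (Z w * J (gp T (2 ^ k) j) w).
  by move=> k0 jk; rewrite gpm //; apply: Jm; [exact: (gpk k j jk).1|exact: (gpk k j jk).2].
pose Ek k := [set w | exists j, (j <= 2 ^ k)%N /\ l < `|J (gp T (2 ^ k) j) w|].
have hEk k : measurable (Ek k) /\ (Pr (Ek k) <= (cM / l ^+ 2)%:E)%E.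
  have k0 : (0 < 2 ^ k)%N by rewrite expn_gt0.
  have [mE PE] := @maximal_ineq _ _ _ Pr F hF (2 ^ k) (gp T (2 ^ k)) (fun j => J (gp T (2 ^ k) j))
     (fun j jk => (gpk k j jk).1) (fun i j ij _ => gp_le T0 _ ij)
     (fun j jk => Jad _ (gpk k j jk).1 (gpk k j jk).2) (fun j jk => sJ _ (gpk k j jk).1 (gpk k j jk).2)
     (fun j Z jk => JmT k j Z k0 jk) l l0.
  split=> //; apply: (le_trans PE); rewrite gpm // lee_fin.
  by apply: ler_wpM2r JT; rewrite invr_ge0 exprn_ge0 // ltW.
have mE k := (hEk k).1.
have mU : measurable (\bigcup_k Ek k) by apply: bigcup_measurable => k _; exact: mE.
have EkS k : Ek k `<=` Ek k.+1.
  move=> w [j [jk lJ]]; exists (2 * j)%N; rewrite -gp_dyadic; split=> //.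
  by rewrite expnS leq_mul2l.
have PU : (Pr (\bigcup_k Ek k) <= (cM / l ^+ 2)%:E)%E.
  have nd : {homo Ek : n m / (n <= m)%N >-> (n <= m)%O}.
    apply: homo_leq => [A|A B C|k]; [exact: lexx|exact: le_trans|].
    by rewrite subsetEset; exact: EkS.
  have c1 := nondecreasing_cvg_mu (mu := Pr) mE mU nd.
  rewrite -(cvg_lim _ c1) //; apply: lime_le; first by apply: cvgP c1.
  by near=> k; exact: (hEk k).2.
have [A [mA PA hA]] : {ae Pr, forall w, mu.-integrable `[0, T]%classic (EFin \o (g ^~ w)) /\
    forall k j, (j <= 2 ^ k)%N -> M (gp T (2 ^ k) j) w = J (gp T (2 ^ k) j) w}.
  apply: filterI.
    exact: (fubini_ae2 (measurable_itv `[0, T]) (strip_integrable (measurable_itv `[0, T]) (mu_itv TT) (itop_g ix))).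
  apply/ae_foralln => k; apply/ae_foralln => j.
  have [jk|njk] := pselect (j <= 2 ^ k)%N; last by apply: nearW => w /njk.
  have [g0 gT] := gpk k j jk.
  by apply: filterS (hI _ g0 gT).2 => w e _; rewrite /M e /J addrAC subrr add0r.
exists (\bigcup_k Ek k `|` A); split; first exact: measurableU.
  by apply: (le_trans (measureU2 Pr mU mA)); rewrite /= PA adde0.
move=> w /not_orP[nE nA] s s0 sT.
have [iw MJ] : mu.-integrable `[0, T]%classic (EFin \o (g ^~ w)) /\
    forall k j, (j <= 2 ^ k)%N -> M (gp T (2 ^ k) j) w = J (gp T (2 ^ k) j) w.
  by apply: contrapT => hn; apply: nA; exact: hA.
have cM' : {within `[0, T], continuous (fun t => M t w)}.
  move=> r; apply: cvgB; [exact: cx|exact: (prim_continuous iw)].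
apply/ler_addgt0Pr => e e0.
have /subspace_continuousP/(_ s) := cM'.
rewrite /= in_itv /= s0 sT => /(_ isT) /cvgrPdist_lt /(_ e e0)[dl /= dl0 hd].
have [k [j [jk hj]]] := dyadic_approx s0 sT dl0.
have [g0 gT] := gpk k j jk.
have h1 : `|M s w - M (gp T (2 ^ k) j) w| < e by apply: hd; rewrite //= in_itv /= g0.
have h2 : `|M (gp T (2 ^ k) j) w| <= l.
  by rewrite MJ // leNgt; apply/negP => lM; apply: nE; exists k => //; exists j.
rewrite -(subrK (M (gp T (2 ^ k) j) w) (M s w)) (le_trans (ler_normD _ _)) // addrC lerD // ltW.
Unshelve. all: by end_near.
Qed.

End SupIto.

(** * Approximation of integrands by step processes *)

Section StepApproximation.
Context d (Omega : measurableType d) (R : realType).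
Variable (Pr : probability Omega R).
Variable F : R -> set (set Omega).
Hypothesis hF : usual_filtration Pr F.
Variables (q : nat) (K : 'M[R]_q) (W : R -> Omega -> 'cV[R]_q).
Hypothesis nW : noise Pr F K W.
Local Notation mu := (@lebesgue_measure R).
Local Notation muP := (mu \x Pr)%E.
Local Notation sqO := (sqi Pr setT).
Local Notation sqP := (sqP Pr).
Local Notation strip t := (`[0, t]%classic `*` [set: Omega] : set (measurableTypeR R * Omega)).
Local Notation gito := (gito Pr F W).
Local Notation strip_int := (strip_int Pr).
Local Notation slab_int := (slab_int Pr).
Local Notation itop := (itop Pr F W).
Local Notation velt := (velt Pr F).
Variable T : R.
Hypothesis T0 : 0 < T.

Lemma noise_diag_ge0 i : 0 <= K i i.
Proof.
have r1 : rv_measurable (F 0) (fun=> 1 : R) by exact: (rv_cst (Fsigma hF (lexx 0))).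
have := noise_cov nW i i (lexx 0) (ler01 : 0 <= 1 :> R) r1 (sqO_cst Pr 1) r1 (sqO_cst Pr 1).
rewrite subr0 mulr1 (_ : \int[Pr]_w (1 * 1) = 1); last first.
  by rewrite mulr1 Rintegral_cst // mul1r; exact: (congr1 fine (probability_setT Pr)).
rewrite mulr1 => <-; under eq_Rintegral do rewrite -expr2.
exact: isq_ge0.
Qed.

Lemma strip_int0 f : muP.-integrable (strip 0) (EFin \o (fun z => f z.1 z.2)) -> strip_int 0 f = 0.
Proof.
move=> fi; rewrite /strip_int (fubini1 (measurable_itv `[0, 0]) fi).
by rewrite set_itv1 Rintegral_set1.
Qed.

Lemma slab_sum f m : (0 < m)%N -> muP.-integrable (strip T) (EFin \o (fun z => f z.1 z.2)) ->
  \sum_(j < m) slab_int (gp T m j) (gp T m j.+1) f = strip_int T f.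
Proof.
move=> m0 fi; have fis t : t <= T -> muP.-integrable (strip t) (EFin \o (fun z => f z.1 z.2)).
  move=> tT; apply: (integrableS (mstrip T) (mstrip t) _ fi).
  by move=> z [+ _]; rewrite /= in_itv /= => /andP[z0 zt]; split=> //=; rewrite in_itv /= z0 (le_trans zt).
transitivity (\sum_(j < m) (strip_int (gp T m j.+1) f - strip_int (gp T m j) f)).
  apply: eq_bigr => j _; symmetry; apply: strip_slab; first exact: (gp_ge0 T0).
    exact: (gp_le T0).
  by apply: fis; apply: (gp_leT T0).
rewrite -(big_mkord xpredT (fun j => strip_int (gp T m j.+1) f - strip_int (gp T m j) f)).
rewrite telescope_sumr // gpm // gp0 strip_int0 ?subr0 //.
by apply: fis; exact: ltW.
Qed.

Definition stepp (m : nat) (x : R -> Omega -> R) (s : R) (w : Omega) : R :=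
  \sum_(j < m) x (gp T m j) w * \1_(`]gp T m j, gp T m j.+1]%classic) s.

Lemma stepp_sp m x : (forall t, 0 <= t -> t <= T -> rv_measurable (F t) (x t) /\ sqO (x t)) ->
  exists f : seq (velt T), sp f = stepp m x.
Proof.
move=> hx; have gpT (j : 'I_m) : gp T m j <= T by apply: (gp_leT T0); exact: ltnW.
pose e (j : 'I_m) := @Velt _ _ _ Pr F T (gp T m j) (gp T m j.+1) (x (gp T m j))
  (gp_ge0 T0 m j) (gp_le T0 m (leqnSn j)) (gp_leT T0 (ltn_ord j))
  (hx _ (gp_ge0 T0 m j) (gpT j)).1 (hx _ (gp_ge0 T0 m j) (gpT j)).2.
exists [seq e j | j <- enum 'I_m].
by apply/funext => s; apply/funext => w; rewrite /sp /stepp big_map big_enum.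
Qed.

Lemma slab_sqi s t f : 0 <= s -> t <= T -> sqP T f ->
  sqi muP (`]s, t]%classic `*` setT) (fun z => f z.1 z.2).
Proof.
move=> s0 tT sf; exact: (sqi_subset (mslab s t) (mstrip T) (slab_sub s0 tT) sf).1.
Qed.

(** The increment bound over []s, r]], enlarged to one that does not depend on [r], is integrated
    over [r]. *)
Lemma itop_slab_le x g h s t : itop T x g h -> (forall i, sqP T (h i)) ->
  0 <= s -> s <= t -> t <= T ->
  slab_int s t (fun r w => (x r w - x s w) ^+ 2) <= (t - s) *
   (2 * (T * slab_int s t (fun r w => g r w ^+ 2)) +
    2 * (q%:R * \sum_i K i i * slab_int s t (fun r w => h i r w ^+ 2))).
Proof.
move=> ix hh s0 st tT; set B := 2 * _ + _.
have sT := le_trans st tT.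
have mI : measurable (`]s, t]%classic : set (measurableTypeR R)) by exact: measurable_itv.
have sxs : sqO (x s) by exact: (itop_sqO hF ix).
have sD := sqiB (mslab s t) (slab_sqi s0 tT (itop_x ix)) (slab_sqi s0 tT (sqP_cst T sxs)).
have mD : measurable_fun (`]s, t]%classic `*` setT) (fun z : measurableTypeR R * Omega =>
    ((x z.1 z.2 - x s z.2) ^+ 2)%:E).
  by apply/measurable_EFinP; apply: measurable_funX; case: sD.
rewrite -lee_fin /slab_int (EFin_Rintegral (mslab s t) (sqi_integrable sD)).
rewrite (tonelli1 Pr mI mD); last by move=> z _; rewrite lee_fin sqr_ge0.
apply: (@le_trans _ _ (\int[mu]_(r in `]s, t]) (B%:E))%E).
  apply: ge0_le_integral => //.
  - by move=> r _; apply: integral_ge0 => w _; rewrite lee_fin sqr_ge0.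
  - by apply: (measurable_tonelli1 Pr mI mD) => z _; rewrite lee_fin sqr_ge0.
  - move=> r /=; rewrite in_itv /= => /andP[sr rt].
    have rT := le_trans rt tT; have r0 : 0 <= r by rewrite (le_trans s0) // ltW.
    rewrite -EFin_Rintegral //; last first.
      exact: (sqi_integrable (sqiB measurableT (itop_sqO hF ix r0 rT) sxs)).
    rewrite lee_fin; apply: (le_trans (itop_incr_le hF nW ix s0 (ltW sr) rT)).
    have sub f : sqP T f -> slab_int s r (fun r w => f r w ^+ 2) <= slab_int s t (fun r w => f r w ^+ 2).
      move=> sf; apply: (sqi_subset (mslab s r) (mslab s t) _ (slab_sqi s0 tT sf)).2.
      by move=> z [+ _]; rewrite /= in_itv /= => /andP[z0 zt]; split=> //=; rewrite in_itv /= z0 (le_trans zt).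
    rewrite /B; apply: lerD; apply: ler_wpM2l => //.
      apply: ler_pM.
      + by rewrite subr_ge0 ltW.
      + exact: isq_ge0.
      + by rewrite (le_trans _ rT) // gerBl.
      + exact: sub (itop_g ix).
    apply: ler_wpM2l => //; apply: ler_sum => i _; apply: ler_wpM2l; first exact: noise_diag_ge0.
    exact: sub.
have m1 : mu `]s, t]%classic = (t - s)%:E.
  rewrite lebesgue_measure_itv /= lte_fin; case: ltP => [_|ts]; first by rewrite -EFinD.
  by rewrite (_ : t - s = 0) //; apply/eqP; rewrite subr_eq0 eq_le ts st.
have e1 : (\int[mu]_(_ in `]s, t]) B%:E = B%:E * mu `]s, t]%classic)%E by exact: integral_cst.
by rewrite e1 m1 -EFinM mulrC.
Qed.

Definition step_cst (g : R -> Omega -> R) (h : 'I_q -> R -> Omega -> R) : R :=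
  2 * (T * strip_int T (fun r w => g r w ^+ 2)) +
  2 * (q%:R * \sum_i K i i * strip_int T (fun r w => h i r w ^+ 2)).

Lemma itop_hsqP x g h : itop T x g h -> forall i, sqP T (h i).
Proof.
by move=> ix i; have [I [hI _]] := itop_eq ix (ltW T0) (lexx T); case: (hI i).
Qed.

(** On a cell the error is at most the length [T / m] of the cell times a constant multiple of the
    energies of drift and noise on that same cell. The energies of the cells add up to those of the
    strip. *)
Lemma itop_step_le x g h m : (0 < m)%N -> itop T x g h ->
  strip_int T (fun s w => (x s w - stepp m x s w) ^+ 2) <= T / m%:R * step_cst g h.
Proof.
move=> m0 ix; have hh := itop_hsqP ix.
have [f fE] := @stepp_sp m x (fun t t0 tT => conj (itop_x_ad ix t0 tT) (itop_sqO hF ix t0 tT)).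
have sS : sqP T (stepp m x) by rewrite -fE; exact: sp_sqP.
have sD := sqiB (mstrip T) (itop_x ix) sS.
rewrite -(slab_sum m0 (f := fun s w => (x s w - stepp m x s w) ^+ 2)); last exact: sqi_integrable sD.
have ii g' : sqP T g' -> muP.-integrable (strip T) (EFin \o (fun z => g' z.1 z.2 ^+ 2)).
  by move=> s'; exact: sqi_integrable s'.
rewrite /step_cst -(slab_sum m0 (f := fun s w => g s w ^+ 2) (ii _ (itop_g ix))).
rewrite (eq_bigr (fun i => K i i * \sum_(j < m) slab_int (gp T m j) (gp T m j.+1)
   (fun r w => h i r w ^+ 2))); last by move=> i _; rewrite (slab_sum m0 (f := fun s w => h i s w ^+ 2) (ii _ (hh i))).
apply: (@le_trans _ _ (\sum_(j < m) (T / m%:R) *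
   (2 * (T * slab_int (gp T m j) (gp T m j.+1) (fun r w => g r w ^+ 2)) +
    2 * (q%:R * \sum_i K i i * slab_int (gp T m j) (gp T m j.+1) (fun r w => h i r w ^+ 2))))).
  apply: ler_sum => j _; have g0 := gp_ge0 T0 m j; have gS := gp_le T0 m (leqnSn j).
  have gT := gp_leT T0 (ltn_ord j); rewrite -[in leRHS](gpS T m j).
  apply: le_trans (itop_slab_le ix hh g0 gS gT); rewrite le_eqVlt; apply/orP; left; apply/eqP.
  rewrite /slab_int; apply: eq_Rintegral => z; rewrite inE /= => -[+ _].
  by rewrite in_itv /= => /andP[h1 h2]; rewrite /stepp (gp_sum T0 (fun j => x (gp T m j) z.2) h1 h2).
rewrite -mulr_sumr le_eqVlt; apply/orP; left; apply/eqP; congr (_ * _).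
rewrite big_split /= -!mulr_sumr; congr (_ + 2 * (_ * _)).
by rewrite exchange_big /=; apply: eq_bigr => i _; rewrite mulr_sumr.
Qed.

(** The closure of the simple processes in L^2 of the strip, which is the class of integrands for
    which a stochastic integral can be constructed. It is closed under linear combinations and L^2
    limits, and contains every Ito process by [itop_gapprox]. *)
Definition gapprox H := sqP T H /\ exists f : nat -> seq (velt T),
  l2to muP (strip T) (fun l z => sp (f l) z.1 z.2) (fun z => H z.1 z.2).

Lemma gapprox_close H : sqP T H -> (forall e : R, 0 < e -> exists f : seq (velt T),
    strip_int T (fun s w => (H s w - sp f s w) ^+ 2) <= e) -> gapprox H.
Proof.
move=> sH h; split=> //.
have /choice[f hf] : forall l : nat, exists f : seq (velt T),
    strip_int T (fun s w => (H s w - sp f s w) ^+ 2) <= 2^-1 ^+ l.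
  by move=> l; apply: h; rewrite exprn_gt0.
exists f; rewrite /l2to; apply: (@squeeze_cvgr _ _ _ _ (fun=> 0) (fun l => 2^-1 ^+ l)).
- by near=> l; apply/andP; split; [exact: isq_ge0|exact: hf].
- exact: cvg_cst.
- by apply: cvg_expr; rewrite ger0_norm //; lra.
Unshelve. all: by end_near.
Qed.

Lemma gapprox_ex H e : 0 < e -> gapprox H -> exists f : seq (velt T),
    strip_int T (fun s w => (H s w - sp f s w) ^+ 2) <= e.
Proof.
move=> e0 [sH [f]]; rewrite /l2to => /cvgr_le /(_ _ e0)[M _ hM].
by exists (f M); apply: hM => /=.
Qed.

Lemma gapprox_lin a b H H' : gapprox H -> gapprox H' -> gapprox (fun s w => a * H s w + b * H' s w).
Proof.
move=> [sH [f cf]] [sH' [f' cf']]; split; first exact: (sqi_lin (mstrip T) a b sH sH').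
exists (fun l => [seq scale_velt hF a e | e <- f l] ++ [seq scale_velt hF b e | e <- f' l]).
have := l2to_lin (mstrip T) a b (fun l => sp_sqP T (f l)) sH (fun l => sp_sqP T (f' l)) sH' cf cf'.
rewrite /l2to; under eq_fun do under eq_Rintegral do rewrite -sp_lin.
exact.
Qed.

Lemma gapprox0 : gapprox (fun _ _ => 0).
Proof.
apply: gapprox_close; first exact: sqi0.
move=> e e0; exists [::]; rewrite /strip_int (@eq_Rintegral _ _ _ _ _ (fun=> 0)).
  by rewrite (Rintegral_cst _ (mstrip T)) mul0r ltW.
by move=> z _; rewrite /sp big_nil subrr expr0n.
Qed.

Lemma gapprox_sum (I : Type) (s : seq I) (a : I -> R) (H : I -> R -> Omega -> R) :
  (forall i, gapprox (H i)) -> gapprox (fun r w => \sum_(i <- s) a i * H i r w).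
Proof.
move=> hH; elim: s => [|i s IH].
  rewrite (_ : (fun _ _ => _) = fun _ _ => 0); first exact: gapprox0.
  by apply/funext => r; apply/funext => w; rewrite big_nil.
rewrite (_ : (fun _ _ => _) = fun r w => a i * H i r w + 1 * \sum_(i <- s) a i * H i r w).
  exact: gapprox_lin.
by apply/funext => r; apply/funext => w; rewrite big_cons mul1r.
Qed.

Lemma gapprox_limit (X : nat -> R -> Omega -> R) Y : (forall l, gapprox (X l)) -> sqP T Y ->
  (fun l => strip_int T (fun s w => (Y s w - X l s w) ^+ 2)) @ \oo --> (0 : R) -> gapprox Y.
Proof.
move=> hX sY cY; apply: gapprox_close => // e e0.
have e4 : 0 < e / 4 by rewrite divr_gt0.
have [M _ hM] := cvgr_le _ cY _ e4; have [f hf] := gapprox_ex e4 (hX M).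
exists f; have h1 := hM M (leqnn M).
have sX := (hX M).1.
have := isqD_le (mstrip T) (sqiB (mstrip T) sY sX) (sqiB (mstrip T) sX (sp_sqP T f)).
have -> : \int[muP]_(z in strip T) (Y z.1 z.2 - X M z.1 z.2 + (X M z.1 z.2 - sp f z.1 z.2)) ^+ 2 =
    strip_int T (fun s w => (Y s w - sp f s w) ^+ 2).
  by apply: eq_Rintegral => z _; congr (_ ^+ 2); ring.
move=> /le_trans; apply; move: h1 hf; rewrite /strip_int /=.
by set u := \int[_]_(_ in _) _; set v := \int[_]_(_ in _) _ => h1 h2; lra.
Qed.

Lemma itop_gapprox x g h : itop T x g h -> gapprox x.
Proof.
move=> ix; apply: gapprox_close; first exact: (itop_x ix).
move=> e e0; have [m [m0 hm]] : exists m, (0 < m)%N /\ T / m%:R * step_cst g h <= e.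
  have : (fun l => T * (l.+1%:R)^-1 * step_cst g h) @ \oo --> (T * 0 * step_cst g h).
    by apply: cvgMl; apply: cvgMr; exact: cvg_harmonic.
  rewrite mulr0 mul0r => /cvgr_le /(_ _ e0)[M _ hM].
  by exists M.+1; split=> //; apply: hM => /=.
have [f fE] := @stepp_sp m x (fun t t0 tT => conj (itop_x_ad ix t0 tT) (itop_sqO hF ix t0 tT)).
by exists f; rewrite fE; apply: le_trans hm; exact: itop_step_le.
Qed.

(** Adaptedness is read off the approximation: the primitives at time [t] of the cut simple
    processes are finite [F t]-measurable sums, and they converge in L^2. *)
Lemma prim_rv H (t : R) : 0 <= t -> t <= T -> gapprox H -> rv_measurable (F t) (prim H t).
Proof.
move=> t0 tT [sH [f cf]]; have [sHt _] := sqP_sub tT sH.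
have mI : measurable (`[0, t]%classic : set (measurableTypeR R)) by exact: measurable_itv.
pose X l := prim (sp (f l)) t.
have sX l : sqO (X l) by exact: (drift_sqi mI (mu_itv t0) (sp_sqP t (f l))).1.
have Xad l : rv_measurable (F t) (X l).
  rewrite (_ : X l = fun w => \sum_(e <- map (cut hF t0) (f l))
     (\int[mu]_(s in `[0, t]%classic) \1_(`]va e, vb e]%classic) s) * vx e w).
    apply: (rv_sum (Fsigma hF t0)) => e; apply: (rvZ (Fsigma hF t0)).
    by apply: (velt_meas hF); exact: le_trans (vab e) (vb_le e).
  apply/funext => w; rewrite /X /prim.
  have ind (e : velt t) : mu.-integrable `[0, t]%classic (EFin \o (fun s => \1_(`]va e, vb e]%classic) s)).
    apply: (dominated_integrable mI (g := fun=> 1)).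
    - by apply: measurable_indic; exact: measurable_itv.
    - by move=> s _; rewrite indicE; case: (_ \in _); rewrite ?normr1 ?normr0.
    - have [m1 i1] := sqi_one mI (mu_itv t0).
      by apply: ge0_integrable => //; under eq_integral do rewrite -(expr1n _ 2).
  transitivity (\int[mu]_(s in `[0, t]%classic) (\sum_(e <- map (cut hF t0) (f l))
      vx e w * \1_(`]va e, vb e]%classic) s)).
    apply: eq_Rintegral => s; rewrite inE /= in_itv /= => /andP[s0 st].
    by rewrite -(sp_cut hF t0 (f l) w st).
  rewrite (Rintegral_sumr mI) => [|e]; last exact: (integrableZl mI _ (ind e)).
  by apply: eq_bigr => e _; rewrite (RintegralZl _ mI) // mulrC.
apply: (l2to_rv hF t0 Xad sX (drift_sqi mI (mu_itv t0) sHt).1).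
pose b l := \int[muP]_(z in strip T) (H z.1 z.2 - sp (f l) z.1 z.2) ^+ 2.
have c0 : (fun l => t * b l) @ \oo --> t * 0 by apply: cvgMr; exact: cf.
rewrite mulr0 in c0.
rewrite /l2to; apply: (@squeeze_cvgr _ _ _ _ (fun=> 0) (fun l => t * b l)).
- near=> l; apply/andP; split; first exact: isq_ge0.
  have sD := sqiB (mstrip T) sH (sp_sqP T (f l)).
  have [sDt leD] := sqP_sub (f := fun s w => H s w - sp (f l) s w) tT sD.
  have [sd le1] := drift_sqi mI (mu_itv t0) sDt.
  apply: (@le_trans _ _ (t * strip_int t (fun s w => (H s w - sp (f l) s w) ^+ 2))); last first.
    exact: ler_wpM2l.
  apply: le_trans le1; rewrite le_eqVlt; apply/orP; left; apply/eqP.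
  apply: ae_eq_Rintegral => //.
  + by apply: measurable_funX; case: (sqiB measurableT (drift_sqi mI (mu_itv t0) sHt).1 (sX l)).
  + by apply: measurable_funX; case: sd.
  + apply: filterS (prim_lin 1 (-1) t0 tT sH (sp_sqP T (f l))) => w e _.
    rewrite /X (_ : prim H t w - _ = 1 * prim H t w + -1 * prim (sp (f l)) t w); last by ring.
    rewrite -e; congr (_ ^+ 2); apply: eq_Rintegral => s _; ring.
- exact: cvg_cst.
- exact: c0.
Unshelve. all: by end_near.
Qed.

End StepApproximation.

Section ContinuousIntegral.
Context d (Omega : measurableType d) (R : realType).
Variable (Pr : probability Omega R).
Variable F : R -> set (set Omega).
Hypothesis hF : usual_filtration Pr F.
Variables (q : nat) (K : 'M[R]_q) (W : R -> Omega -> 'cV[R]_q).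
Hypothesis nW : noise Pr F K W.
Local Notation mu := (@lebesgue_measure R).
Local Notation muP := (mu \x Pr)%E.
Local Notation sqO := (sqi Pr setT).
Local Notation sqP := (sqP Pr).
Local Notation strip t := (`[0, t]%classic `*` [set: Omega] : set (measurableTypeR R * Omega)).
Local Notation gito := (gito Pr F W).
Local Notation strip_int := (strip_int Pr).
Local Notation itop := (itop Pr F W).
Local Notation velt := (velt Pr F).
Variable T : R.
Hypothesis T0 : 0 < T.

Lemma gito_ext i t H H' I : (forall s w, 0 <= s -> s <= t -> H s w = H' s w) ->
  gito i t H I -> gito i t H' I.
Proof.
move=> e [sH sI [f [c1 c2]]].
have e' z : strip t z -> H z.1 z.2 = H' z.1 z.2.
  by move=> [+ _]; rewrite /= in_itv /= => /andP[z0 zt]; exact: e.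
split=> //; first exact: (eq_sqi e' sH).
exists f; split=> //; move: c1; rewrite /l2to.
rewrite (_ : (fun l => \int[muP]_(x in strip t) (H x.1 x.2 - _) ^+ 2) =
  (fun l => \int[muP]_(x in strip t) (H' x.1 x.2 - sp (f l) x.1 x.2) ^+ 2)) //.
by apply/funext => l; apply: eq_Rintegral => z; rewrite inE => sz; rewrite e'.
Qed.

Lemma gito0 i t : gito i t (fun _ _ => 0) (fun=> 0).
Proof.
have := gito_sp (Pr := Pr) nW i ([::] : seq (velt t)).
rewrite (_ : sp [::] = fun _ _ => 0); last by apply/funext => s; apply/funext => w; rewrite /sp big_nil.
by rewrite (_ : si W i [::] = fun=> 0) //; apply/funext => w; rewrite /si big_nil.
Qed.

Lemma strip_bound X (C : R) : measurable_fun (strip T) (fun z => X z.1 z.2) ->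
  (forall t, 0 <= t -> t <= T -> sqO (X t) /\ \int[Pr]_w X t w ^+ 2 <= C) ->
  sqP T X /\ strip_int T (fun s w => X s w ^+ 2) <= T * C.
Proof.
move=> mX hX.
have mI : measurable (`[0, T]%classic : set (measurableTypeR R)) by exact: measurable_itv.
have mX2 : measurable_fun (strip T) (fun z => (X z.1 z.2 ^+ 2)%:E).
  by apply/measurable_EFinP; exact: measurable_funX.
have le1 : (\int[muP]_(z in strip T) (X z.1 z.2 ^+ 2)%:E <= (T * C)%:E)%E.
  rewrite (tonelli1 Pr mI mX2); last by move=> z _; rewrite lee_fin sqr_ge0.
  apply: (@le_trans _ _ (\int[mu]_(r in `[0%R, T]) C%:E)%E).
    apply: ge0_le_integral => //.
    - by move=> r _; apply: integral_ge0 => w _; rewrite lee_fin sqr_ge0.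
    - by apply: (measurable_tonelli1 Pr mI mX2) => z _; rewrite lee_fin sqr_ge0.
    - move=> r /=; rewrite in_itv /= => /andP[r0 rT]; have [sX leX] := hX r r0 rT.
      by rewrite -EFin_Rintegral ?lee_fin //; exact: sqi_integrable.
  have e1 : (\int[mu]_(_ in `[0%R, T]) C%:E = C%:E * mu `[0%R, T]%classic)%E by exact: integral_cst.
  by rewrite e1 mu_itv ?(ltW T0) // -EFinM mulrC.
have sX : sqP T X by split=> //; exact: le_lt_trans le1 (ltry _).
split=> //; rewrite -lee_fin /strip_int (EFin_Rintegral (mstrip T)) //.
exact: (sqi_integrable sX).
Qed.

Lemma cont_sqP X (C : R) : (forall t, 0 <= t -> t <= T -> sqO (X t) /\ \int[Pr]_w X t w ^+ 2 <= C) ->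
  (forall w, {within `[0, T], continuous (fun t => X t w)}) ->
  sqP T X /\ strip_int T (fun s w => X s w ^+ 2) <= T * C.
Proof.
move=> hX cX; apply: strip_bound => //.
by apply: (caratheodory_measurable T0) => // t t0 tT; case: (hX t t0 tT) => -[].
Qed.

(** The integral of a simple process as a process in its upper limit; stopping the increments at [s]
    makes its paths inherit the continuity of those of [W]. *)
Definition sic i t (f : seq (velt t)) (s : R) (w : Omega) : R :=
  \sum_(e <- f) vx e w * incr W i (Num.min (va e) s) (Num.min (vb e) s) w.

Lemma sic_cut i t (f : seq (velt t)) s (s0 : 0 <= s) : sic i f s = si W i (map (cut hF s0) f).
Proof.
apply/funext => w; rewrite /sic /si big_map; apply: eq_bigr => e _.
rewrite /cut; case: pselect => /= [h|/negP]; first by rewrite (min_idPl h).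
rewrite -ltNge => h; have h2 : s <= vb e by rewrite (le_trans (ltW h)) // vab.
by rewrite (min_idPr (ltW h)) (min_idPr h2) /incr !subrr !mulr0.
Qed.

Lemma sic_gito i (f : seq (velt T)) t : 0 <= t -> t <= T -> gito i t (sp f) (sic i f t).
Proof.
move=> t0 tT; rewrite (sic_cut _ _ t0).
apply: gito_ext (gito_sp nW i (map (cut hF t0) f)) => s w s0 st.
exact: sp_cut.
Qed.

Hypothesis Wc : forall w i, {within `[0, T], continuous (fun t : R => W t w i 0)}.

Lemma within_sum (I : Type) (s : seq I) (X : I -> R -> R) :
  (forall i, {within `[0, T], continuous (X i)}) ->
  {within `[0, T], continuous (fun t => \sum_(i <- s) X i t)}.
Proof.
move=> hX; elim: s => [|i s IH].
  rewrite (_ : (fun t => _) = fun=> 0); first by move=> t; exact: cvg_cst.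
  by apply/funext => t; rewrite big_nil.
rewrite (_ : (fun t => _) = fun t => X i t + \sum_(j <- s) X j t).
  by move=> t; apply: cvgD; [exact: hX|exact: IH].
by apply/funext => t; rewrite big_cons.
Qed.

Lemma min_lip (a s t : R) : `|Num.min a s - Num.min a t| <= `|s - t|.
Proof.
rewrite /Num.min; case: ltP => h1; case: ltP => h2 //.
- by rewrite subrr normr0.
- by rewrite !ger0_norm; lra.
- by rewrite !ler0_norm; lra.
Qed.

Lemma min_continuous (X : R -> R) (a : R) : 0 <= a -> {within `[0, T], continuous X} ->
  {within `[0, T], continuous (fun t => X (Num.min a t))}.
Proof.
move=> a0 cX; apply/subspace_continuousP => s; rewrite /= in_itv /= => /andP[s0 sT].
have mT (t : R) : 0 <= t -> t <= T -> 0 <= Num.min a t <= T.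
  by move=> t0 tT; rewrite le_min a0 t0 ge_min tT orbT.
have /subspace_continuousP/(_ (Num.min a s)) := cX.
rewrite /= in_itv /= mT // => /(_ isT) /cvgrPdist_lt cs.
apply/cvgrPdist_lt => e e0; have [dl /= dl0 hd] := cs e e0.
exists dl => //= t st; rewrite in_itv /= => /andP[t0 tT]; apply: hd => /=; last by rewrite in_itv /= mT.
by apply: le_lt_trans st; exact: min_lip.
Qed.

Lemma sic_continuous i (f : seq (velt T)) w : {within `[0, T], continuous (fun t => sic i f t w)}.
Proof.
apply: within_sum => e; have b0 : 0 <= vb e := le_trans (va_ge0 e) (vab e).
have cb := @min_continuous (fun t => W t w i 0) _ b0 (@Wc w i).
have ca := @min_continuous (fun t => W t w i 0) _ (va_ge0 e) (@Wc w i).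
by move=> t; apply: cvgMr; apply: cvgB; [exact: cb|exact: ca].
Qed.

(** Puts the difference of two simple integrals into the form of an Ito process without drift and
    with noise in the single direction [i], as [itop_sup] requires. *)
Lemma sic_itop i (f g : seq (velt T)) : itop T (fun t w => sic i f t w - sic i g t w) (fun _ _ => 0)
  (fun j s w => if j == i then sp f s w - sp g s w else 0).
Proof.
have hI t : 0 <= t -> t <= T -> gito i t (fun s w => sp f s w - sp g s w) (fun w => sic i f t w - sic i g t w).
  move=> t0 tT; have := gito_lin hF nW 1 (-1) (sic_gito i f t0 tT) (sic_gito i g t0 tT).
  have e (a b : R) : 1 * a + -1 * b = a - b by ring.
  under eq_fun do under eq_fun do rewrite e; under [in X in gito _ _ _ X]eq_fun do rewrite e.
  exact.
split.
- move=> t t0 tT; exact: (gito_rv hF nW t0 (hI t t0 tT)).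
- by move=> t t0 tT; exact: (rv_cst (Fsigma hF t0)).
- apply: (cont_sqP (C := K i i * strip_int T (fun s w => (sp f s w - sp g s w) ^+ 2)) _ _).1.
  + move=> t t0 tT; split; first by case: (hI t t0 tT).
    rewrite (gito_isq hF nW (hI t t0 tT)) ler_wpM2l ?(noise_diag_ge0 hF nW) //.
    exact: (sqP_sub tT (sqiB (mstrip T) (sp_sqP T f) (sp_sqP T g))).2.
  + by move=> w t; apply: cvgB; exact: sic_continuous.
- exact: sqi0.
- move=> t t0 tT; exists (fun j w => if j == i then sic i f t w - sic i g t w else 0); split.
    move=> j; case: eqP => [->|_]; [exact: hI|exact: gito0].
  apply: nearW => w; rewrite (bigD1 i) //= eqxx big1 => [|j /negPf -> //].
  rewrite addr0 /prim Rintegral_cst ?mul0r ?add0r //; exact: measurable_itv.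
Qed.

(** Simple approximations with errors [64^-l] make successive integrals close in the sense of
    [continuous_limit]; the L^2 limit at each fixed time is an Ito integral of [H]. *)
Lemma gito_continuous i H : gapprox Pr F T H -> exists M : R -> Omega -> R,
  [/\ forall t, 0 <= t -> t <= T -> rv_measurable (F t) (M t),
      forall w, {within `[0, T], continuous (fun t => M t w)} &
      forall t, 0 <= t -> t <= T -> gito i t H (M t)].
Proof.
move=> hH; have sH := hH.1; have Ki0 : 0 <= K i i by exact: (noise_diag_ge0 hF nW).
have /choice[f hf] : forall l : nat, exists f : seq (velt T),
    strip_int T (fun s w => (H s w - sp f s w) ^+ 2) <= 64^-1 ^+ l.
  by move=> l; apply: gapprox_ex => //; rewrite exprn_gt0.
have y0 l : 0 <= (64^-1 : R) ^+ l by exact: exprn_ge0.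
have fstep l : strip_int T (fun s w => (sp (f l.+1) s w - sp (f l) s w) ^+ 2) <= 4 * 64^-1 ^+ l.
  have := isqD_le (mstrip T) (sqiB (mstrip T) (sp_sqP T (f l.+1)) sH) (sqiB (mstrip T) sH (sp_sqP T (f l))).
  have -> : \int[muP]_(z in strip T) (sp (f l.+1) z.1 z.2 - H z.1 z.2 + (H z.1 z.2 - sp (f l) z.1 z.2)) ^+ 2 =
    strip_int T (fun s w => (sp (f l.+1) s w - sp (f l) s w) ^+ 2).
    by apply: eq_Rintegral => z _; congr (_ ^+ 2); ring.
  have -> : \int[muP]_(z in strip T) (sp (f l.+1) z.1 z.2 - H z.1 z.2) ^+ 2 =
    strip_int T (fun s w => (H s w - sp (f l.+1) s w) ^+ 2).
    by apply: eq_Rintegral => z _; rewrite -sqrrN opprB.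
  move=> /le_trans; apply; have h1 := hf l.+1; have h2 := hf l; rewrite exprS in h1.
  move: h1 h2 (y0 l); rewrite /strip_int; set u := \int[_]_(_ in _) _; set v := \int[_]_(_ in _) _ => h1 h2 h3; lra.
(* [itop_sup] costs the factor [4 * q] and [fstep] the factor 4; the added 1 also covers the second
   moments without a case distinction on [q]. *)
pose c := 16 * (q%:R + 1) * K i i.
have c0 : 0 <= c by rewrite /c !mulr_ge0 // addr_ge0.
have gZ l t (t0 : 0 <= t) (tT : t <= T) := sic_gito i (f l) t0 tT.
have [Y [Yad Yc Yl]] : exists Y : R -> Omega -> R,
  [/\ forall t, 0 <= t -> t <= T -> rv_measurable (F t) (Y t),
      forall w, {within `[0, T], continuous (fun t => Y t w)} &
      forall t, 0 <= t -> t <= T -> sqO (Y t) /\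
        forall l, \int[Pr]_w (Y t w - sic i (f l) t w) ^+ 2 <= 4 * c * 64^-1 ^+ l].
  apply: (@continuous_limit _ _ _ Pr F hF T (fun l => sic i (f l)) c c0).
  - by move=> l t t0 tT; exact: (gito_rv hF nW t0 (gZ l t t0 tT)).
  - by move=> l w; exact: sic_continuous.
  - by move=> l t t0 tT; case: (gZ l t t0 tT).
  - move=> l; have cc w : {within `[0, T], continuous (fun t => sic i (f l.+1) t w - sic i (f l) t w)}.
      by move=> t; apply: cvgB; exact: sic_continuous.
    apply: sup_bd_le (itop_sup hF nW T0 (sic_itop i (f l.+1) (f l)) cc).
    rewrite (bigD1 i) //= eqxx big1 => [|j /negPf ->]; last first.
      rewrite /strip_int (@eq_Rintegral _ _ _ _ _ (fun=> 0)) => [|z _]; last by rewrite expr0n.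
      by rewrite (Rintegral_cst _ (mstrip T)) mul0r mulr0.
    have -> : strip_int T (fun _ _ => 0 ^+ 2) = 0.
      rewrite /strip_int (@eq_Rintegral _ _ _ _ _ (fun=> 0)) => [|z _]; last by rewrite expr0n.
      by rewrite (Rintegral_cst _ (mstrip T)) mul0r.
    rewrite mulr0 !addr0; have h1 := ler_wpM2l Ki0 (fstep l).
    have h2 := ler_wpM2l (ler0n R q) h1.
    have h3 : 0 <= K i i * 64^-1 ^+ l by rewrite mulr_ge0.
    rewrite /c; move: h2 h3; rewrite /strip_int; set u := \int[_]_(_ in _) _; set y := 64^-1 ^+ l.
    set k := K i i; set n := q%:R => h2 h3; nra.
  - move=> l t t0 tT; rewrite (gito_dist hF nW (gZ l.+1 t t0 tT) (gZ l t t0 tT)).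
    apply: (@le_trans _ _ (K i i * (4 * 64^-1 ^+ l))).
      apply: ler_wpM2l => //; apply: le_trans (fstep l).
      exact: (sqP_sub tT (sqiB (mstrip T) (sp_sqP T (f l.+1)) (sp_sqP T (f l)))).2.
    rewrite /c mulrA ler_wpM2r // mulrC ler_wpM2r //; have := ler0n R q; lra.
exists Y; split=> // t t0 tT; have [sY leY] := Yl t t0 tT.
have sHt := (sqP_sub tT sH).1.
have cy C : (fun l => C * (64^-1 : R) ^+ l) @ \oo --> (0 : R).
  by rewrite -(mulr0 C); apply: cvgMr; apply: cvg_expr; rewrite ger0_norm //; lra.
split=> //; exists (fun l => map (cut hF t0) (f l)); split; rewrite /l2to.
- apply: (@squeeze_cvgr _ _ _ _ (fun=> 0) (fun l => 1 * 64^-1 ^+ l)); last exact: cy.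
    near=> l; apply/andP; split; first exact: isq_ge0.
    rewrite mul1r; apply: le_trans (hf l).
    have le1 := (sqP_sub (f := fun s w => H s w - sp (f l) s w) tT (sqiB (mstrip T) sH (sp_sqP T (f l)))).2.
    apply: le_trans le1; rewrite le_eqVlt; apply/orP; left; apply/eqP.
    apply: eq_Rintegral => z; rewrite inE => -[+ _]; rewrite /= in_itv /= => /andP[z0 zt].
    by rewrite sp_cut.
  exact: cvg_cst.
- apply: (@squeeze_cvgr _ _ _ _ (fun=> 0) (fun l => 4 * c * 64^-1 ^+ l)); last exact: cy.
    near=> l; apply/andP; split; first exact: isq_ge0.
    by rewrite -(sic_cut i (f l) t0); exact: leY.
  exact: cvg_cst.
Unshelve. all: by end_near.
Qed.

End ContinuousIntegral.

Section MatrixBound.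
Context (R : realType).

(** The squared Frobenius norm times the number of columns. It bounds the square of every coordinate
    of [M *m v] against [sqnorm2 v]; the factor comes from [sqr_sum_le]. *)
Definition mxsq m n (M : 'M[R]_(m, n)) : R := n%:R * \sum_i \sum_j M i j ^+ 2.

Lemma mxsq_ge0 m n (M : 'M[R]_(m, n)) : 0 <= mxsq M.
Proof. by rewrite mulr_ge0 // sumr_ge0 // => i _; apply: sumr_ge0 => j _; exact: sqr_ge0. Qed.

Lemma mulmx_sq_le m n (M : 'M[R]_(m, n)) (v : 'cV[R]_n) c :
  (M *m v) c 0 ^+ 2 <= mxsq M * sqnorm2 v.
Proof.
rewrite mxE; apply: (le_trans (sqr_sum_le (fun j => M c j * v j 0))).
rewrite card_ord /mxsq -mulrA ler_wpM2l //.
apply: (@le_trans _ _ ((\sum_j M c j ^+ 2) * sqnorm2 v)).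
  rewrite mulr_suml; apply: ler_sum => j _; rewrite exprMn ler_wpM2l ?sqr_ge0 //.
  by rewrite /sqnorm2 (bigD1 j) //= lerDl sumr_ge0 // => i _; exact: sqr_ge0.
rewrite ler_wpM2r //; first by apply: sumr_ge0 => i _; exact: sqr_ge0.
rewrite [leRHS](bigD1 c) //= lerDl; apply: sumr_ge0 => i _; apply: sumr_ge0 => j _; exact: sqr_ge0.
Qed.

End MatrixBound.

(** * Picard iteration for linear stochastic equations *)

Section Existence.
Context d (Omega : measurableType d) (R : realType).
Variable (Pr : probability Omega R).
Variable F : R -> set (set Omega).
Hypothesis hF : usual_filtration Pr F.
Variables (q : nat) (K : 'M[R]_q) (W : R -> Omega -> 'cV[R]_q).
Hypothesis nW : noise Pr F K W.
Local Notation mu := (@lebesgue_measure R).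
Local Notation muP := (mu \x Pr)%E.
Local Notation sqO := (sqi Pr setT).
Local Notation sqP := (sqP Pr).
Local Notation strip t := (`[0, t]%classic `*` [set: Omega] : set (measurableTypeR R * Omega)).
Local Notation gito := (gito Pr F W).
Local Notation strip_int := (strip_int Pr).
Local Notation itop := (itop Pr F W).
Local Notation vitop := (vitop Pr F W).
Variable T : R.
Hypothesis T0 : 0 < T.

Lemma strip_mono s t f : s <= t -> (forall z, strip t z -> 0 <= f z.1 z.2) ->
  muP.-integrable (strip t) (EFin \o (fun z => f z.1 z.2)) -> strip_int s f <= strip_int t f.
Proof.
move=> st f0 fi; have sub : strip s `<=` strip t.
  by move=> z [+ _]; rewrite /= in_itv /= => /andP[z0 zs]; split=> //=; rewrite in_itv /= z0 (le_trans zs).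
have fis := integrableS (mstrip t) (mstrip s) sub fi.
rewrite -lee_fin /strip_int (EFin_Rintegral (mstrip s) fis) (EFin_Rintegral (mstrip t) fi).
apply: ge0_subset_integral.
- exact: mstrip.
- exact: mstrip.
- by case/integrableP: fi.
- by move=> z sz; rewrite lee_fin f0.
- exact: sub.
Qed.

Lemma itop_isq_le x g h t : itop T x g h -> 0 <= t -> t <= T ->
  \int[Pr]_w x t w ^+ 2 <= 2 * (T * strip_int t (fun s w => g s w ^+ 2)) +
    2 * (q%:R * \sum_i K i i * strip_int t (fun s w => h i s w ^+ 2)).
Proof.
move=> ix t0 tT; have hh := itop_hsqP T0 ix.
have x0 := itop_zero_ae hF nW (ltW T0) ix.
have -> : \int[Pr]_w x t w ^+ 2 = \int[Pr]_w (x t w - x 0 w) ^+ 2.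
  have s0 := itop_sqO hF ix (lexx 0) (ltW T0); have st := itop_sqO hF ix t0 tT.
  apply: ae_eq_Rintegral => //.
  - by apply: measurable_funX; case: st.
  - by apply: measurable_funX; case: (sqiB measurableT st s0).
  - by apply: filterS x0 => w -> _; rewrite subr0.
apply: (le_trans (itop_incr_le hF nW ix (lexx 0) t0 tT)).
have sub f : sqP T f -> slab_int Pr 0 t (fun r w => f r w ^+ 2) <= strip_int t (fun r w => f r w ^+ 2).
  move=> sf; have sft := (sqP_sub tT sf).1.
  apply: (sqi_subset (mslab 0 t) (mstrip t) _ sft).2.
  by move=> z [+ _]; rewrite /= in_itv /= => /andP[z0 zt]; split=> //=; rewrite in_itv /= zt ltW.
apply: lerD; apply: ler_wpM2l => //.
  rewrite subr0; apply: ler_pM => //; [exact: isq_ge0|exact: sub (itop_g ix)].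
apply: ler_wpM2l => //; apply: ler_sum => i _.
by apply: ler_wpM2l; [exact: (noise_diag_ge0 hF nW)|exact: sub].
Qed.

Hypothesis Wc : forall w i, {within `[0, T], continuous (fun t : R => W t w i 0)}.
Variables (n : nat) (A : 'M[R]_n) (N : 'I_q -> 'M[R]_n).
Implicit Types x D : R -> Omega -> 'cV[R]_n.

(** The mean square Lipschitz constant, per coordinate, of the Picard map on [[0, T]]. *)
Definition lipc : R := 2 * (T * mxsq A) + 2 * (q%:R * \sum_i K i i * mxsq (N i)).

Lemma lipc_ge0 : 0 <= lipc.
Proof.
have h : 0 <= \sum_i K i i * mxsq (N i).
  by apply: sumr_ge0 => i _; rewrite mulr_ge0 ?mxsq_ge0 ?(noise_diag_ge0 hF nW).
apply: addr_ge0; first by rewrite mulr_ge0 // mulr_ge0 ?mxsq_ge0 ?(ltW T0).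
by rewrite mulr_ge0 // mulr_ge0.
Qed.

Definition sqnp (x : R -> Omega -> 'cV[R]_n) : R -> Omega -> R := fun t w => sqnorm2 (x t w).

Lemma sqnp_integrable t x : (forall c, sqP t (fun s w => x s w c 0)) ->
  muP.-integrable (strip t) (EFin \o (fun z => sqnp x z.1 z.2)).
Proof.
move=> hx; apply: (integrable_sumr (mstrip t)) => c; exact: (sqi_integrable (hx c)).
Qed.

Lemma sqnp_mulmx_le t (M : 'M[R]_n) x c : (forall c, sqP t (fun s w => x s w c 0)) ->
  strip_int t (fun s w => (M *m x s w) c 0 ^+ 2) <= mxsq M * strip_int t (sqnp x).
Proof.
move=> hx; have ix := sqnp_integrable hx.
rewrite /strip_int -(RintegralZl _ (mstrip t)) //; apply: le_Rintegral.
- exact: mstrip.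
- exact: (sqi_integrable (sqP_mulmx M hx c)).
- exact: (integrableZl (mstrip t) _ ix).
- by move=> z _; exact: mulmx_sq_le.
Qed.

Lemma strip_sqnp_ge0 t x : 0 <= strip_int t (sqnp x).
Proof. by apply: Rintegral_ge0 => z _; apply: sumr_ge0 => i _; exact: sqr_ge0. Qed.

Lemma lin_isq_le D D' c t : (forall c, sqP T (fun s w => D' s w c 0)) ->
  vitop T D (fun s w => A *m D' s w) (fun i s w => N i *m D' s w) -> 0 <= t -> t <= T ->
  \int[Pr]_w (D t w c 0) ^+ 2 <= lipc * strip_int t (sqnp D').
Proof.
move=> hD vD t0 tT; apply: (le_trans (itop_isq_le (vD c) t0 tT)).
have hDt c' : sqP t (fun s w => D' s w c' 0) by exact: (sqP_sub tT (hD c')).1.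
have -> : lipc * strip_int t (sqnp D') = 2 * (T * (mxsq A * strip_int t (sqnp D'))) +
    2 * (q%:R * ((\sum_i K i i * mxsq (N i)) * strip_int t (sqnp D'))) by rewrite /lipc; ring.
apply: lerD; apply: ler_wpM2l => //.
  by apply: ler_wpM2l; [exact: ltW|exact: sqnp_mulmx_le].
apply: ler_wpM2l => //; rewrite mulr_suml; apply: ler_sum => i _; rewrite -mulrA.
by apply: ler_wpM2l; [exact: (noise_diag_ge0 hF nW)|exact: sqnp_mulmx_le].
Qed.

Lemma lin_sup D D' c : (forall c, sqP T (fun s w => D' s w c 0)) ->
  vitop T D (fun s w => A *m D' s w) (fun i s w => N i *m D' s w) ->
  (forall w, {within `[0, T], continuous (fun t => D t w c 0)}) ->
  sup_bd Pr T (fun t w => D t w c 0) (4 * lipc * strip_int T (sqnp D')).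
Proof.
move=> hD vD cD; apply: sup_bd_le (itop_sup hF nW T0 (vD c) cD).
rewrite -mulrA ler_wpM2l //.
have h1 : T * strip_int T (fun s w => (A *m D' s w) c 0 ^+ 2) <= T * mxsq A * strip_int T (sqnp D').
  by rewrite -mulrA; apply: ler_wpM2l; [exact: ltW|exact: sqnp_mulmx_le].
have h2 : q%:R * (\sum_i K i i * strip_int T (fun s w => (N i *m D' s w) c 0 ^+ 2)) <=
    q%:R * (\sum_i K i i * mxsq (N i)) * strip_int T (sqnp D').
  rewrite -mulrA ler_wpM2l // mulr_suml; apply: ler_sum => i _; rewrite -mulrA.
  by apply: ler_wpM2l; [exact: (noise_diag_ge0 hF nW)|exact: sqnp_mulmx_le].
apply: (le_trans (lerD h2 h1)); rewrite addrC -mulrDl ler_wpM2r ?strip_sqnp_ge0 //.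
rewrite /lipc -mulrDr ler_peMl //; last by rewrite ler1n.
rewrite addr_ge0 // mulr_ge0 ?mxsq_ge0 ?(ltW T0) //.
by apply: sumr_ge0 => i _; rewrite mulr_ge0 ?mxsq_ge0 ?(noise_diag_ge0 hF nW).
Qed.

Variables (f beta : R -> Omega -> 'cV[R]_n).
Hypothesis fs : forall c, sqP T (fun s w => f s w c 0).
Hypothesis fad : forall t, 0 <= t -> t <= T -> forall c, rv_measurable (F t) (fun w => f t w c 0).
Hypothesis bad : forall t, 0 <= t -> t <= T -> forall c, rv_measurable (F t) (fun w => beta t w c 0).
Hypothesis bc : forall w c, {within `[0, T], continuous (fun t => beta t w c 0)}.
Hypothesis be : forall t, 0 <= t -> t <= T -> forall c,
  {ae Pr, forall w, beta t w c 0 = prim (fun s w => f s w c 0) t w}.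

(** The invariants of the Picard iterates. Approximability is what makes the stochastic integrals of
    the next iterate exist, and adaptedness of its drift integral rests on it as well. *)
Record cap (x : R -> Omega -> 'cV[R]_n) : Prop := Cap {
  cap_ad : forall t, 0 <= t -> t <= T -> forall c, rv_measurable (F t) (fun w => x t w c 0);
  cap_c : forall w c, {within `[0, T], continuous (fun t => x t w c 0)};
  cap_ap : forall c, gapprox Pr F T (fun s w => x s w c 0) }.

Lemma gapprox_mulmx (M : 'M[R]_n) x : (forall c, gapprox Pr F T (fun s w => x s w c 0)) ->
  forall c, gapprox Pr F T (fun s w => (M *m x s w) c 0).
Proof.
move=> hx c; have := gapprox_sum hF (index_enum 'I_n) (M c) hx.
by congr (gapprox _ _ _ _); apply/funext => s; apply/funext => w; rewrite mxE.
Qed.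

(** The new iterate is put together from continuous versions of the stochastic integrals and from
    [beta], the continuous adapted version of the primitive of the forcing. Being an Ito process it
    is approximable again. *)
Lemma picard x : cap x -> exists x', cap x' /\
  vitop T x' (fun s w => A *m x s w + f s w) (fun i s w => N i *m x s w).
Proof.
move=> hx; have TT := ltW T0.
have hA := gapprox_mulmx A (cap_ap hx).
have hN i := gapprox_mulmx (N i) (cap_ap hx).
have /choice[M hM] : forall ic : 'I_q * 'I_n, exists M : R -> Omega -> R,
  [/\ forall t, 0 <= t -> t <= T -> rv_measurable (F t) (M t),
      forall w, {within `[0, T], continuous (fun t => M t w)} &
      forall t, 0 <= t -> t <= T -> gito ic.1 t (fun s w => (N ic.1 *m x s w) ic.2 0) (M t)].
  by move=> [i c]; exact: (gito_continuous hF nW T0 Wc i (hN i c)).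
pose pA c := prim (fun s w => (A *m x s w) c 0).
pose x' t w : 'cV[R]_n := \col_c (beta t w c 0 + pA c t w + \sum_i M (i, c) t w).
have xE t w c : x' t w c 0 = beta t w c 0 + pA c t w + \sum_i M (i, c) t w by rewrite mxE.
have cAx c w : {within `[0, T], continuous (fun t => (A *m x t w) c 0)}.
  rewrite (_ : (fun t => _) = fun t => \sum_j A c j * x t w j 0); last by apply/funext => t; rewrite mxE.
  by apply: within_sum => j t; apply: cvgMr; exact: (cap_c hx).
have cpA c w : {within `[0, T], continuous (fun t => pA c t w)}.
  apply: (prim_continuous T0 (g := fun s => (A *m x s w) c 0)).
  apply: continuous_compact_integrable; [exact: segment_compact|exact: cAx].
have x'c w c : {within `[0, T], continuous (fun t => x' t w c 0)}.
  rewrite (_ : (fun t => _) = fun t => beta t w c 0 + pA c t w + \sum_i M (i, c) t w); last first.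
    by apply/funext => t; rewrite xE.
  move=> t; apply: cvgD; first by apply: cvgD; [exact: bc|exact: cpA].
  have cM := @within_sum _ T _ (index_enum 'I_q) (fun i t => M (i, c) t w)
    (fun i => let: And3 _ h _ := hM (i, c) in h w).
  exact: cM.
have x'ad t : 0 <= t -> t <= T -> forall c, rv_measurable (F t) (fun w => x' t w c 0).
  move=> t0 tT c; under eq_fun do rewrite xE; apply: (rvD (Fsigma hF t0)).
    apply: (rvD (Fsigma hF t0)); [exact: bad|exact: (prim_rv hF t0 tT (hA c))].
  by apply: (rv_sum (Fsigma hF t0)) => i; have [h _ _] := hM (i, c); exact: h.
have sbeta c : sqP T (fun s w => beta s w c 0).
  apply: (cont_sqP T0 (C := T * strip_int T (fun s w => f s w c 0 ^+ 2)) _ _).1.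
    move=> t t0 tT; have mI : measurable (`[0, t]%classic : set (measurableTypeR R)) by exact: measurable_itv.
    have [sft le1] := sqP_sub tT (fs c).
    have [sd led] := drift_sqi mI (mu_itv t0) sft.
    have mb : measurable_fun setT (fun w => beta t w c 0).
      exact: (rv_measurable_fun (Fmeas hF t0) (bad t0 tT c)).
    have sb : sqO (fun w => beta t w c 0).
      apply: ae_eq_sqi sd => //; apply: filterS (be t0 tT c) => w -> _ //.
    split=> //; apply: (@le_trans _ _ (\int[Pr]_w (prim (fun s w => f s w c 0) t w) ^+ 2)).
      rewrite le_eqVlt; apply/orP; left; apply/eqP; apply: ae_eq_Rintegral => //.
      - by apply: measurable_funX; case: sb.
      - by apply: measurable_funX; case: sd.
      - by apply: filterS (be t0 tT c) => w -> _.
    apply: (le_trans led); apply: ler_pM => //; exact: isq_ge0.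
  by move=> w; exact: bc.
have sM c : sqP T (fun s w => \sum_i M (i, c) s w).
  apply: (sqi_sum (mstrip T)) => i; have [_ Mc Mi] := hM (i, c).
  apply: (cont_sqP T0 (C := K i i * strip_int T (fun s w => (N i *m x s w) c 0 ^+ 2)) _ _).1 => //.
  move=> t t0 tT; split; first by case: (Mi t t0 tT).
  rewrite (gito_isq hF nW (Mi t t0 tT)) ler_wpM2l ?(noise_diag_ge0 hF nW) //.
  exact: (sqP_sub tT (hN i c).1).2.
have vx : vitop T x' (fun s w => A *m x s w + f s w) (fun i s w => N i *m x s w).
  move=> c; split.
  - by move=> t t0 tT; exact: x'ad.
  - move=> t t0 tT; under eq_fun do rewrite mxE; apply: (rvD (Fsigma hF t0)); last exact: fad.
    by apply: (rv_mulmx hF) => // c'; exact: (cap_ad hx).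
  - apply: (eq_sqi _ (sqiD (mstrip T) (sqiD (mstrip T) (sbeta c) (sqP_prim TT (hA c).1)) (sM c))).
    by move=> z _; rewrite xE.
  - by apply: (eq_sqi _ (sqiD (mstrip T) (hA c).1 (fs c))) => z _; rewrite [RHS]mxE.
  - move=> t t0 tT; exists (fun i w => M (i, c) t w); split.
      by move=> i; have [_ _ h] := hM (i, c); exact: h.
    apply: filterS2 (be t0 tT c) (prim_lin 1 1 t0 tT (hA c).1 (fs c)) => w e1 e2.
    rewrite xE e1 (addrC (prim _ t w)) -(mul1r (pA c t w)) -[X in _ + X + _]mul1r -e2.
    by congr (_ + _); apply: eq_Rintegral => s _; rewrite !mul1r [RHS]mxE.
exists x'; split=> //; split=> // c; exact: (itop_gapprox hF nW T0 (vx c)).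
Qed.

Lemma strip_le t x (b : R -> R) : (forall c, sqP t (fun s w => x s w c 0)) -> 0 <= t ->
  (forall s c, 0 <= s -> s <= t -> sqO (fun w => x s w c 0)) ->
  (forall s, 0 <= s -> s <= t -> \sum_c \int[Pr]_w x s w c 0 ^+ 2 <= b s) ->
  mu.-integrable `[0, t]%classic (EFin \o b) ->
  strip_int t (sqnp x) <= \int[mu]_(s in `[0, t]%classic) b s.
Proof.
move=> hx t0 sx xb bi; have mI : measurable (`[0, t]%classic : set (measurableTypeR R)) by exact: measurable_itv.
have ix := sqnp_integrable hx.
have x0 z : 0 <= sqnp x z.1 z.2 by apply: sumr_ge0 => i _; exact: sqr_ge0.
have mx : measurable_fun (strip t) (EFin \o (fun z => sqnp x z.1 z.2)) by case/integrableP: ix.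
rewrite -lee_fin /strip_int (EFin_Rintegral (mstrip t) ix) (EFin_Rintegral mI bi).
rewrite (tonelli1 Pr mI mx); last by move=> z _; rewrite lee_fin x0.
apply: ge0_le_integral => //.
- by move=> r _; apply: integral_ge0 => w _; rewrite lee_fin (x0 (r, w)).
- by apply: (measurable_tonelli1 Pr mI mx) => z _; rewrite lee_fin x0.
- by case/integrableP: bi.
- move=> r; rewrite /= in_itv /= => /andP[r0 rt].
  have ir c : Pr.-integrable setT (EFin \o (fun w => x r w c 0 ^+ 2)).
    exact: (sqi_integrable (sx r c r0 rt)).
  rewrite -(EFin_Rintegral measurableT (f := fun w => sqnp x r w)); last first.
    exact: (integrable_sumr measurableT).
  by rewrite lee_fin /sqnp /sqnorm2 (Rintegral_sumr measurableT) //; exact: xb.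
Qed.

Lemma cap0 : cap (fun _ _ => 0).
Proof.
split.
- move=> t t0 tT c; under eq_fun do rewrite mxE; exact: (rv_cst (Fsigma hF t0)).
- by move=> w c t; exact: cvg_cst.
- move=> c; have := gapprox0 Pr F T.
  by congr (gapprox _ _ _ _); apply/funext => s; apply/funext => w; rewrite mxE.
Qed.

Lemma vitop_diff x y (f1 f2 : R -> Omega -> 'cV[R]_n) :
  vitop T x (fun s w => A *m f1 s w + f s w) (fun i s w => N i *m f1 s w) ->
  vitop T y (fun s w => A *m f2 s w + f s w) (fun i s w => N i *m f2 s w) ->
  vitop T (fun s w => x s w - y s w) (fun s w => A *m (f1 s w - f2 s w))
    (fun i s w => N i *m (f1 s w - f2 s w)).
Proof.
move=> vx vy; have := vitop_lin hF nW 1 (-1) vx vy.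
by congr (vitop _ _ _ _); repeat (apply/funext => ?); rewrite ?mulmxBr !scale1r !scaleN1r ?opprD // addrACA subrr addr0.
Qed.

(** The forcing cancels in differences of iterates, so these satisfy the homogeneous recursion, to
    which [lin_isq_le] and [lin_sup] apply. *)
Theorem sde_exists : exists Y : R -> Omega -> 'cV[R]_n,
  vitop T Y (fun s w => A *m Y s w + f s w) (fun i s w => N i *m Y s w) /\
  forall w c, {within `[0, T], continuous (fun t => Y t w c 0)}.
Proof.
have TT := ltW T0.
have /choice[Phi hPhi] : forall x : {x | cap x}, exists x' : {x | cap x},
    vitop T (sval x') (fun s w => A *m sval x s w + f s w) (fun i s w => N i *m sval x s w).
  by move=> [x cx]; have [x' [cx' vx]] := picard cx; exists (exist _ x' cx').
pose Xs l := iter l Phi (exist _ _ cap0); pose X l := sval (Xs l).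
have capX l : cap (X l) by exact: (svalP (Xs l)).
have vX l : vitop T (X l.+1) (fun s w => A *m X l s w + f s w) (fun i s w => N i *m X l s w).
  exact: hPhi.
pose D l s w := X l.+1 s w - X l s w.
have vD l : vitop T (D l.+1) (fun s w => A *m D l s w) (fun i s w => N i *m D l s w).
  exact: vitop_diff (vX l.+1) (vX l).
have sX l t c : t <= T -> sqP t (fun s w => X l s w c 0).
  by move=> tT; exact: (sqP_sub tT (cap_ap (capX l) c).1).1.
have sD l t c : t <= T -> sqP t (fun s w => D l s w c 0).
  move=> tT; apply: (eq_sqi _ (sqiB (mstrip t) (sX l.+1 t c tT) (sX l t c tT))) => z _.
  by rewrite !mxE.
have sOX l t c : 0 <= t -> t <= T -> sqO (fun w => X l t w c 0).
  move=> t0 tT; case: l => [|l]; last exact: (itop_sqO hF (vX l c) t0 tT).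
  by apply: (eq_sqi _ (sqi0 Pr setT)) => w _; rewrite mxE.
have sOD l t c : 0 <= t -> t <= T -> sqO (fun w => D l t w c 0).
  move=> t0 tT; apply: (eq_sqi _ (sqiB measurableT (sOX l.+1 t c t0 tT) (sOX l t c t0 tT))) => w _.
  by rewrite !mxE.
pose C1 := n%:R * lipc + 1.
have C10 : 0 < C1 by rewrite ltr_pwDr // mulr_ge0 ?lipc_ge0.
(* Under the weight [expR (2 * b * t)] with [2 * b = 64 * C1] one Picard step contracts by the
   factor 1/64, the rate asked for by [continuous_limit]. [C1] sums the Lipschitz constant over the
   coordinates, plus 1 to be positive. *)
pose b := 32 * C1; have b0 : 0 < b by rewrite mulr_gt0.
pose a := strip_int T (sqnp (D 0)).
have a0 : 0 <= a by exact: strip_sqnp_ge0.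
have y0 l : 0 <= (64^-1 : R) ^+ l by exact: exprn_ge0.
have psi l : forall t, 0 <= t -> t <= T -> strip_int t (sqnp (D l)) <= a * 64^-1 ^+ l * expR (2 * b * t).
  elim: l => [|l IH] t t0 tT.
    rewrite expr0 mulr1; apply: (@le_trans _ _ a).
      apply: strip_mono => //; last by apply: sqnp_integrable => c; exact: sD.
      by move=> z _; apply: sumr_ge0 => i _; exact: sqr_ge0.
    by rewrite ler_peMr // -expR0 ler_expR !mulr_ge0 // ltW.
  have [ie ee] := integral_expR b0 t0.
  have mI : measurable (`[0, t]%classic : set (measurableTypeR R)) by exact: measurable_itv.
  apply: (@le_trans _ _ (\int[mu]_(s in `[0, t]%classic) (C1 * (a * 64^-1 ^+ l) * expR (2 * b * s)))).
    apply: strip_le => //.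
    - by move=> c; exact: sD.
    - by move=> s c s0 st; apply: sOD => //; exact: le_trans tT.
    - move=> s s0 st; have sT := le_trans st tT.
      have hD c : sqP T (fun s w => D l s w c 0) by exact: sD.
      apply: (@le_trans _ _ (\sum_(c < n) lipc * strip_int s (sqnp (D l)))).
        by apply: ler_sum => c _; exact: (lin_isq_le c hD (vD l)).
      rewrite sumr_const card_ord -[leLHS]mulr_natl.
      apply: (@le_trans _ _ (C1 * strip_int s (sqnp (D l)))).
        by rewrite mulrA ler_wpM2r ?strip_sqnp_ge0 // /C1 lerDl.
      by rewrite -[leRHS]mulrA; apply: ler_wpM2l; [exact: ltW|exact: IH].
    - exact: (integrableZl mI _ ie).
  rewrite (RintegralZl _ mI) // ee exprS.
  have e0 := expR_ge0 (2 * b * t).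
  rewrite (_ : _ * _ = a * (64^-1 * 64^-1 ^+ l) * (expR (2 * b * t) - 1)); last first.
    by rewrite /b; field; rewrite gt_eqF.
  by rewrite ler_wpM2l ?mulr_ge0 // gerBl.
pose a' := a * expR (2 * b * T).
have a'0 : 0 <= a' by rewrite mulr_ge0 // expR_ge0.
have psiT l : strip_int T (sqnp (D l)) <= a' * 64^-1 ^+ l.
  by apply: (le_trans (psi l T TT (lexx T))); rewrite /a' mulrAC.
pose c4 := 4 * lipc * a'.
have c40 : 0 <= c4 by rewrite !mulr_ge0 ?lipc_ge0.
have /choice[Yc hYc] : forall c : 'I_n, exists Y : R -> Omega -> R,
  [/\ forall t, 0 <= t -> t <= T -> rv_measurable (F t) (Y t),
      forall w, {within `[0, T], continuous (fun t => Y t w)} &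
      forall t, 0 <= t -> t <= T -> sqO (Y t) /\
        forall l, \int[Pr]_w (Y t w - X l.+1 t w c 0) ^+ 2 <= 4 * c4 * 64^-1 ^+ l].
  move=> c; have hD l c' : sqP T (fun s w => D l s w c' 0) by exact: sD.
  have DE l t w : D l t w c 0 = X l.+1 t w c 0 - X l t w c 0 by rewrite !mxE.
  apply: (@continuous_limit _ _ _ Pr F hF T (fun l t w => X l.+1 t w c 0) c4 c40).
  - by move=> l t t0 tT; exact: (cap_ad (capX l.+1)).
  - by move=> l w; exact: (cap_c (capX l.+1)).
  - by move=> l t t0 tT; exact: sOX.
  - move=> l; have cD w : {within `[0, T], continuous (fun t => D l.+1 t w c 0)}.
      rewrite (_ : (fun t => _) = fun t => X l.+2 t w c 0 - X l.+1 t w c 0); last by apply/funext => t.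
      by move=> t; apply: cvgB; exact: (cap_c (capX _)).
    have := lin_sup (hD l) (vD l) cD.
    under [in X in sup_bd _ _ X _]eq_fun do under eq_fun do rewrite DE.
    apply: sup_bd_le; rewrite /c4 -(mulrA (4 * lipc)); apply: ler_wpM2l; last exact: psiT.
    by rewrite mulr_ge0 ?lipc_ge0.
  - move=> l t t0 tT; under eq_Rintegral do rewrite -DE.
    apply: (le_trans (lin_isq_le c (hD l) (vD l) t0 tT)).
    have h1 : strip_int t (sqnp (D l)) <= a' * 64^-1 ^+ l.
      apply: (le_trans _ (psiT l)); apply: strip_mono => //; last exact: sqnp_integrable.
      by move=> z _; apply: sumr_ge0 => i _; exact: sqr_ge0.
    apply: (le_trans (ler_wpM2l lipc_ge0 h1)); rewrite /c4 -!mulrA ler_peMl ?ler1n //.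
    by rewrite !mulr_ge0 ?lipc_ge0.
pose Y t w : 'cV[R]_n := \col_c Yc c t w.
have YE t w c : Y t w c 0 = Yc c t w by rewrite mxE.
pose B l : R := 4 * c4 * 64^-1 ^+ l.
have By0 l : 0 <= B l by rewrite /B mulr_ge0 // mulr_ge0.
have cB : B @ \oo --> (0 : R).
  by rewrite -(mulr0 (4 * c4)); apply: cvgMr; apply: cvg_expr; rewrite ger0_norm //; lra.
have sOY t c : 0 <= t -> t <= T -> sqO (fun w => Y t w c 0).
  by move=> t0 tT; under eq_fun do rewrite YE; have [_ _ h] := hYc c; case: (h t t0 tT).
have dY l t c : 0 <= t -> t <= T -> \int[Pr]_w (Y t w c 0 - X l.+1 t w c 0) ^+ 2 <= B l.
  by move=> t0 tT; under eq_Rintegral do rewrite YE; have [_ _ h] := hYc c; exact: (h t t0 tT).2.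
have cY w c : {within `[0, T], continuous (fun t => Y t w c 0)}.
  rewrite (_ : (fun t => _) = fun t => Yc c t w); last by apply/funext => t; exact: YE.
  by have [_ h _] := hYc c; exact: h.
have dYX l c : sqP T (fun s w => Y s w c 0 - X l.+1 s w c 0) /\
    strip_int T (fun s w => (Y s w c 0 - X l.+1 s w c 0) ^+ 2) <= T * B l.
  apply: (cont_sqP T0) => [t t0 tT|w t]; last by apply: cvgB; [exact: cY|exact: (cap_c (capX _))].
  by split; [exact: (sqiB measurableT (sOY t c t0 tT) (sOX l.+1 t c t0 tT))|exact: dY].
have sY c : sqP T (fun s w => Y s w c 0).
  apply: (eq_sqi _ (sqiD (mstrip T) (dYX 0%N c).1 (sX 1%N T c (lexx T)))) => z _; exact: subrK.
have capY : cap Y.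
  split=> //; first by move=> t t0 tT c; under eq_fun do rewrite YE; have [h _ _] := hYc c; exact: h.
  move=> c; apply: (gapprox_limit (X := fun l s w => X l.+1 s w c 0)) => //.
    by move=> l; exact: (cap_ap (capX l.+1)).
  apply: (@squeeze_cvgr _ _ _ _ (fun=> 0) (fun l => T * B l)).
  - by near=> l; apply/andP; split; [exact: isq_ge0|exact: (dYX l c).2].
  - exact: cvg_cst.
  - by rewrite -(mulr0 T); exact: cvgMr.
(* The equation for [Y] is obtained from one more Picard step: its result [Y'] agrees almost surely
   with [Y] at each time, both being close to the same late iterates. *)
have [Y' [capY' vY']] := picard capY.
have eY c t : 0 <= t -> t <= T -> {ae Pr, forall w, Y' t w c 0 = Y t w c 0}.
  move=> t0 tT; have sOY' : sqO (fun w => Y' t w c 0) by exact: (itop_sqO hF (vY' c) t0 tT).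
  have sdiff := sqiB measurableT sOY' (sOY t c t0 tT).
  have le1 l : \int[Pr]_w (Y' t w c 0 - Y t w c 0) ^+ 2 <= (2 * lipc * (n%:R * T) + 2) * B l.
    have sE c' : sqP T (fun s w => (Y s w - X l.+1 s w) c' 0).
      by apply: (eq_sqi _ (dYX l c').1) => z _; rewrite !mxE.
    have h1 := lin_isq_le c sE (vitop_diff vY' (vX l.+1)) t0 tT.
    have h2 : strip_int t (sqnp (fun s w => Y s w - X l.+1 s w)) <= n%:R * T * B l.
      apply: (@le_trans _ _ (strip_int T (sqnp (fun s w => Y s w - X l.+1 s w)))).
        apply: strip_mono => //; last exact: sqnp_integrable.
        by move=> z _; apply: sumr_ge0 => i _; exact: sqr_ge0.
      rewrite /strip_int /sqnp /sqnorm2 (Rintegral_sumr (mstrip T)) => [|c']; last first.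
        exact: (sqi_integrable (sE c')).
      apply: (@le_trans _ _ (\sum_(c' < n) T * B l)); last by rewrite sumr_const card_ord -[leLHS]mulr_natl mulrA.
      apply: ler_sum => c' _; apply: le_trans (dYX l c').2; rewrite le_eqVlt; apply/orP; left; apply/eqP.
      by apply: eq_Rintegral => z _; rewrite !mxE.
    have h3 := isqD_le measurableT (sqiB measurableT sOY' (sOX l.+2 t c t0 tT))
       (sqiB measurableT (sOX l.+2 t c t0 tT) (sOY t c t0 tT)).
    have e1 : \int[Pr]_w (Y' t w c 0 - X l.+2 t w c 0 + (X l.+2 t w c 0 - Y t w c 0)) ^+ 2 =
        \int[Pr]_w (Y' t w c 0 - Y t w c 0) ^+ 2.
      by apply: eq_Rintegral => w _; congr (_ ^+ 2); ring.
    have e2 : \int[Pr]_w (X l.+2 t w c 0 - Y t w c 0) ^+ 2 = \int[Pr]_w (Y t w c 0 - X l.+2 t w c 0) ^+ 2.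
      by apply: eq_Rintegral => w _; rewrite -sqrrN opprB.
    have e3 : \int[Pr]_w (Y' t w c 0 - X l.+2 t w c 0) ^+ 2 = \int[Pr]_w ((Y' t w - X l.+2 t w) c 0) ^+ 2.
      by apply: eq_Rintegral => w _; rewrite !mxE.
    have h4 := dY l.+1 t c t0 tT.
    have h5 : B l.+1 <= B l by rewrite /B exprS; have := By0 l; rewrite /B; set y := 4 * c4 => hy; have := y0 l; nra.
    rewrite e1 e2 e3 in h3; apply: (le_trans h3).
    have h6 := le_trans h1 (ler_wpM2l lipc_ge0 h2).
    have -> : (2 * lipc * (n%:R * T) + 2) * B l = 2 * (lipc * (n%:R * T * B l)) + 2 * B l by ring.
    apply: lerD; first by rewrite ler_wpM2l.
    by rewrite ler_wpM2l // (le_trans h4).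
  have z0 : \int[Pr]_w (Y' t w c 0 - Y t w c 0) ^+ 2 = 0.
    apply/eqP; rewrite eq_le isq_ge0 andbT.
    have c1 : (fun l => (2 * lipc * (n%:R * T) + 2) * B l) @ \oo --> (2 * lipc * (n%:R * T) + 2) * 0.
      exact: cvgMr.
    rewrite mulr0 in c1; rewrite -(cvg_lim _ c1) //; apply: limr_ge; first exact: cvgP c1.
    by near=> l; exact: le1.
  by apply: filterS (isq_eq0_ae sdiff z0) => w /eqP; rewrite subr_eq0 => /eqP.
exists Y; split=> // c; have [a1 a2 a3 a4 a5] := vY' c; split=> //.
  by move=> t t0 tT; exact: (cap_ad capY).
move=> t t0 tT; have [I [hI eI]] := a5 t t0 tT; exists I; split=> //.
by apply: filterS2 eI (eY c t t0 tT) => w -> <-.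
Unshelve. all: by end_near.
Qed.

End Existence.

Lemma within_coord (R : realType) n (D : set R) (z : R -> 'cV[R]_n) (i : 'I_n) :
  {within D, continuous z} -> {within D, continuous (fun t => z t i 0)}.
Proof.
move=> cz; rewrite (_ : (fun t => _) = (fun M : 'cV[R]_n => M i 0) \o z) //.
apply/subspace_continuousP => t tD; have /subspace_continuousP/(_ t tD) h := cz.
by apply: (cvg_comp _ _ h); exact: coord_continuous.
Qed.

(** * Forced systems and stochastic state equations *)

Section ContinuousNoise.
Context d (Omega : measurableType d) (R : realType).
Variable (Pr : probability Omega R).
Variable F : R -> set (set Omega).
Hypothesis hF : usual_filtration Pr F.
Variables (q : nat) (K : 'M[R]_q) (W : R -> Omega -> 'cV[R]_q).
Hypothesis nW : noise Pr F K W.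
Local Notation mu := (@lebesgue_measure R).
Local Notation muP := (mu \x Pr)%E.
Local Notation sqO := (sqi Pr setT).
Local Notation sqP := (sqP Pr).
Local Notation strip t := (`[0, t]%classic `*` [set: Omega] : set (measurableTypeR R * Omega)).
Local Notation strip_int := (strip_int Pr).
Local Notation velt := (velt Pr F).

Lemma noise_modification (A : set Omega) (W' : R -> Omega -> 'cV[R]_q) :
  measurable A -> Pr A = 0%E -> (forall t w, W' t w = if w \in A then 0 else W t w) ->
  noise Pr F K W' /\ forall i t H I, gito Pr F W' i t H I -> gito Pr F W i t H I.
Proof.
move=> mA PA WE; have ae (P : Omega -> Prop) : (forall w, ~ A w -> P w) -> {ae Pr, forall w, P w}.
  by move=> h; exists A; split=> // w /= nP; apply: contrapT => nA; exact: nP (h w nA).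
have WW t w : ~ A w -> W' t w = W t w by move=> nA; rewrite WE memNset.
have Wad t i : 0 <= t -> rv_measurable (F t) (fun w => W' t w i 0).
  move=> t0; apply: (rv_ae_eq (Fsigma hF t0) (Fnull hF t0) (noise_adapted nW i t0)).
  by apply: ae => w nA; rewrite WW.
have iWm i a b : 0 <= a -> a <= b -> measurable_fun setT (incr W' i a b).
  move=> a0 ab; have b0 := le_trans a0 ab; apply: (measurable_funB (f := fun w => W' b w i 0)).
    exact: (rv_measurable_fun (Fmeas hF b0) (Wad b i b0)).
  exact: (rv_measurable_fun (Fmeas hF a0) (Wad a i a0)).
have iW i a b : {ae Pr, forall w, incr W' i a b w = incr W i a b w}.
  by apply: ae => w nA; rewrite /incr !WW.
have s' a b i xi : 0 <= a -> a <= b -> rv_measurable (F a) xi -> sqO xi ->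
    sqO (fun w => xi w * incr W' i a b w).
  move=> a0 ab xm sx; apply: ae_eq_sqi (noise_sqi nW i a0 ab xm sx) => //.
    by apply: measurable_funM; [case: sx|exact: iWm].
  by apply: filterS (iW i a b) => w -> _.
have nW' : noise Pr F K W'.
  split=> //.
  - move=> a b i Z xi a0 ab Zm sZ xm sx; rewrite -(noise_mean nW i a0 ab Zm sZ xm sx).
    apply: ae_eq_Rintegral => //.
    + by apply: measurable_funM; [case: sZ|case: (s' a b i xi a0 ab xm sx)].
    + by apply: measurable_funM; [case: sZ|case: (noise_sqi nW i a0 ab xm sx)].
    + by apply: filterS (iW i a b) => w -> _.
  - move=> a b i j xi eta a0 ab xm sx em se; rewrite -(noise_cov nW i j a0 ab xm sx em se).
    apply: ae_eq_Rintegral => //.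
    + by apply: measurable_funM; [case: (s' a b i xi a0 ab xm sx)|case: (s' a b j eta a0 ab em se)].
    + by apply: measurable_funM; [case: (noise_sqi nW i a0 ab xm sx)|case: (noise_sqi nW j a0 ab em se)].
    + by apply: filterS2 (iW i a b) (iW j a b) => w -> -> _.
split=> // i t H I [sH sI [f [c1 c2]]]; split=> //; exists f; split=> //.
move: c2; rewrite /l2to (_ : (fun l => _) = (fun l => \int[Pr]_w (I w - si W i (f l) w) ^+ 2)) //.
apply/funext => l; apply: ae_eq_Rintegral => //.
- by apply: measurable_funX; case: (sqiB measurableT sI (si_sqi nW' i (f l))).
- by apply: measurable_funX; case: (sqiB measurableT sI (si_sqi nW i (f l))).
- apply: ae => w nA _; congr ((_ - _) ^+ 2); rewrite /si; apply: eq_bigr => e _.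
  by rewrite /incr !WW.
Qed.

(** The Wiener process is continuous almost surely, whereas the construction asks for continuity of
    every path; the bad paths are replaced by 0. Integrals against the modification are integrals
    against [W], which carries the solution back. *)
Lemma continuous_noise (hW : wiener Pr F K W) : exists W', [/\ noise Pr F K W',
  forall T w i, {within `[0, T], continuous (fun t : R => W' t w i 0)} &
  forall i t H I, gito Pr F W' i t H I -> gito Pr F W i t H I].
Proof.
case: hW => _ [_ [A [mA PA hA]]] _ _ _.
pose W' t w := if w \in A then 0 else W t w.
have [nW' g] := noise_modification mA PA (fun t w => erefl (W' t w)).
exists W'; split=> // T w i.
case: (boolP (w \in A)) => [wA|nA].
  rewrite (_ : (fun t => _) = fun=> 0) => [t|]; first exact: cvg_cst.
  by apply/funext => t; rewrite /W' wA mxE.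
have cW : {within `[0, +oo[, continuous (fun t => W t w)}.
  by apply: contrapT => h; move: nA; rewrite notin_setE; apply; exact: hA.
rewrite (_ : (fun t => _) = fun t => W t w i 0); last first.
  by apply/funext => t; rewrite /W' (negbTE nA).
apply: within_coord; apply: continuous_subspaceW cW => t.
by rewrite /= !in_itv /= => /andP[-> _].
Qed.

(** Paths are continuous wherever the section of [f] is integrable, and [beta] is 0 on the remaining
    null set. Adaptedness is inherited from the given versions by completeness. *)
Lemma continuous_primitive T f : 0 < T -> sqP T f ->
  (forall t, 0 <= t -> t <= T -> exists X, rv_measurable (F t) X /\ {ae Pr, forall w, X w = prim f t w}) ->
  exists beta : R -> Omega -> R,
  [/\ forall t, 0 <= t -> t <= T -> rv_measurable (F t) (beta t),
      forall w, {within `[0, T], continuous (fun t => beta t w)} &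
      forall t, 0 <= t -> t <= T -> {ae Pr, forall w, beta t w = prim f t w}].
Proof.
move=> T0 sf hX.
have [A [mA PA hA]] := fubini_ae2 (measurable_itv `[0, T])
  (strip_integrable (measurable_itv `[0, T]) (mu_itv (ltW T0)) sf).
pose beta t w := if w \in A then 0 else prim f t w.
have bE t : {ae Pr, forall w, beta t w = prim f t w}.
  exists A; split=> // w /= nP; apply: contrapT => nA; apply: nP.
  by rewrite /beta memNset.
exists beta; split=> //.
- move=> t t0 tT; have [X [Xm Xe]] := hX t t0 tT.
  apply: (rv_ae_eq (Fsigma hF t0) (Fnull hF t0) Xm).
  by apply: filterS2 Xe (bE t) => w -> ->.
- move=> w; case: (boolP (w \in A)) => [wA|nA].
    rewrite (_ : (fun t => _) = fun=> 0) => [t|]; first exact: cvg_cst.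
    by apply/funext => t; rewrite /beta wA.
  rewrite (_ : (fun t => _) = fun t => prim f t w); last by apply/funext => t; rewrite /beta (negbTE nA).
  apply: (prim_continuous T0 (g := f ^~ w)).
  by apply: contrapT => h; move: nA; rewrite notin_setE; apply; exact: hA.
Qed.

End ContinuousNoise.

Section ForcedSystem.
Context d (Omega : measurableType d) (R : realType).
Variable (Pr : probability Omega R).
Variable F : R -> set (set Omega).
Hypothesis hF : usual_filtration Pr F.
Variables (q : nat) (K : 'M[R]_q) (W : R -> Omega -> 'cV[R]_q).
Hypothesis hW : wiener Pr F K W.
Let nW := wiener_noise hF hW.

(* The drift integrals of the forcing term need not be adapted for a control that is only
   adapted and jointly measurable; here they are, since they can be read off the process x. *)
Lemma forced_exists T n (x g f : R -> Omega -> 'cV[R]_n) h (A M L : 'M[R]_n) (N : 'I_q -> 'M[R]_n) :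
  0 < T -> vitop Pr F W T x g h ->
  (forall t w, f t w = L *m g t w + M *m x t w) ->
  exists Y, vitop Pr F W T Y (fun s w => A *m Y s w + f s w) (fun i s w => N i *m Y s w) /\
  forall w c, {within `[0, T], continuous (fun t => Y t w c 0)}.
Proof.
move=> T0 vx fE; have [W' [nW' cW' gW']] := continuous_noise hF nW hW.
have vL := vitop_mulmx hF nW L vx.
have gM c : gapprox Pr F T (fun s w => (M *m x s w) c 0).
  apply: (gapprox_mulmx hF) => c'; exact: (itop_gapprox hF nW T0 (vx c')).
have sf c : sqP Pr T (fun s w => f s w c 0).
  apply: (eq_sqi _ (sqiD (mstrip T) (itop_g (vL c)) (gM c).1)) => z _.
  by rewrite fE [RHS]mxE.
have fad t : 0 <= t -> t <= T -> forall c, rv_measurable (F t) (fun w => f t w c 0).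
  move=> t0 tT c; under eq_fun do rewrite fE mxE; apply: (rvD (Fsigma hF t0)).
    exact: (itop_g_ad (vL c) t0 tT).
  by apply: (rv_mulmx hF) => // c'; exact: (itop_x_ad (vx c') t0 tT).
have /choice[beta hb] : forall c : 'I_n, exists beta : R -> Omega -> R,
  [/\ forall t, 0 <= t -> t <= T -> rv_measurable (F t) (beta t),
      forall w, {within `[0, T], continuous (fun t => beta t w)} &
      forall t, 0 <= t -> t <= T -> {ae Pr, forall w, beta t w = prim (fun s w => f s w c 0) t w}].
  move=> c; apply: (continuous_primitive hF T0 (sf c)) => t t0 tT.
  have [I [hI eI]] := itop_eq (vL c) t0 tT.
  (* The equation of [L *m x] expresses the primitive of [L *m g] as that process minus its
     stochastic integrals; the primitive of [M *m x] is adapted because [x] is approximable. *)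
  exists (fun w => ((L *m x t w) c 0 - \sum_i I i w) + prim (fun s w => (M *m x s w) c 0) t w); split.
    apply: (rvD (Fsigma hF t0)); last exact: (prim_rv hF t0 tT (gM c)).
    apply: (rvB (Fsigma hF t0)); first exact: (itop_x_ad (vL c) t0 tT).
    by apply: (rv_sum (Fsigma hF t0)) => i; exact: (gito_rv hF nW t0 (hI i)).
  apply: filterS2 eI (prim_lin 1 1 t0 tT (itop_g (vL c)) (gM c).1) => w -> e2.
  rewrite addrK -[X in X + _]mul1r -[X in _ + X]mul1r -e2.
  by apply: eq_Rintegral => s _; rewrite !mul1r fE [RHS]mxE.
pose b t w : 'cV[R]_n := \col_c beta c t w.
have bE t w c : b t w c 0 = beta c t w by rewrite mxE.
have [Y [vY cY]] := @sde_exists _ _ _ Pr F hF _ K W' nW' T T0 (cW' T) n A N f b sf fad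
  (fun t t0 tT c => let: And3 h _ _ := hb c in
     eq_ind_r (fun X => rv_measurable (F t) X) (h t t0 tT) (funext (fun w => bE t w c)))
  (fun w c => let: And3 _ h _ := hb c in
     eq_ind_r (fun X => {within `[0, T], continuous X}) (h w) (funext (fun t => bE t w c)))
  (fun t t0 tT c => let: And3 _ _ h := hb c in
     eq_ind_r (fun X => {ae Pr, forall w, X w = prim (fun s w => f s w c 0) t w}) (h t t0 tT) (funext (fun w => bE t w c))).
exists Y; split=> // c; have [a1 a2 a3 a4 a5] := vY c; split=> // t t0 tT.
have [I [hI eI]] := a5 t t0 tT; exists I; split=> // i; exact: gW'.
Qed.

End ForcedSystem.

(** * From approximable integrands back to bounded simple ones *)

Section Truncation.
Context d (T : measurableType d) (R : realType).
Variable (mu : {measure set T -> \bar R}).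

(** The coefficients in [simple_data] are bounded, those of [velt] only square integrable; clipping
    passes from the second kind to the first. *)
Definition clip (k : nat) (y : R) : R := Num.max (- k%:R) (Num.min k%:R y).

Lemma clip_bound k y : `|clip k y| <= k%:R.
Proof.
rewrite ler_norml /clip le_max lexx /= ge_max ge_min lexx /= andbT.
by rewrite (@le_trans _ _ 0) // oppr_le0.
Qed.

Lemma clip_id k y : `|y| <= k%:R -> clip k y = y.
Proof.
by rewrite ler_norml => /andP[y1 y2]; rewrite /clip (min_idPr y2) (max_idPr y1).
Qed.

Lemma measurable_clip k : measurable_fun setT (clip k).
Proof.
have m1 : measurable_fun setT (fun y : R => Num.min (k%:R : R) y) by exact: measurable_minr.
exact: (@measurable_maxr _ _ _ setT (fun=> - k%:R) _ _ m1).
Qed.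

Lemma clip_dist k y : `|y - clip k y| <= `|y|.
Proof.
have k0 : 0 <= k%:R :> R by [].
rewrite /clip; case: (leP k%:R y) => h.
  have -> : Num.max (- k%:R) k%:R = k%:R :> R by apply: max_r; lra.
  rewrite !ger0_norm; lra.
case: (leP (- k%:R) y) => h2; first by rewrite subrr normr0.
rewrite !ltr0_norm; lra.
Qed.

Lemma clip_approx X (e : R) : sqi mu setT X -> 0 < e ->
  exists k, \int[mu]_x (X x - clip k (X x)) ^+ 2 <= e.
Proof.
move=> sX e0; have mX : measurable_fun setT X by case: sX.
have mD k : measurable_fun setT (fun x => X x - clip k (X x)).
  by apply: measurable_funB => //; exact: (measurableT_comp (measurable_clip k) mX).
have sD k : sqi mu setT (fun x => X x - clip k (X x)).
  by apply: (dominated_sqi measurableT _ _ sX) => // x _; exact: clip_dist.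
have := @dominated_cvg _ _ _ mu setT measurableT (fun k x => ((X x - clip k (X x)) ^+ 2)%:E)
  (fun=> 0%E) (fun x => (X x ^+ 2)%:E).
move=> /(_ _ _ _ _ _)-H.
have {}H : ((fun k => \int[mu]_x ((X x - clip k (X x)) ^+ 2)%:E) @ \oo --> 0)%E.
  rewrite -(integral0 mu setT); apply: H => //.
  - by move=> k; apply/measurable_EFinP; exact: measurable_funX.
  - move=> x _; apply: cvg_near_cst.
    have [M _ hM] := nbhs_infty_ger (`|X x|); exists M => // k /= Mk.
    by rewrite clip_id ?subrr ?expr0n //; exact: hM.
  - exact: (sqi_integrable sX).
  - move=> k x _; rewrite lee_fin ger0_norm ?sqr_ge0 //.
    by rewrite -[leLHS](real_normK (num_real _)) -[leRHS](real_normK (num_real _)) lerXn2r ?nnegrE // clip_dist.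
have {}H : (fun k => \int[mu]_x (X x - clip k (X x)) ^+ 2) @ \oo --> (0 : R) by exact: (fine_cvg H).
have [M _ hM] := cvgr_le _ H _ e0; exists M; exact: (hM M (leqnn M)).
Qed.

End Truncation.

Section ItoIntegral.
Context d (Omega : measurableType d) (R : realType).
Variable (Pr : probability Omega R).
Variable F : R -> set (set Omega).
Hypothesis hF : usual_filtration Pr F.
Variables (q : nat) (K : 'M[R]_q) (W : R -> Omega -> 'cV[R]_q).
Hypothesis nW : noise Pr F K W.
Local Notation mu := (@lebesgue_measure R).
Local Notation muP := (mu \x Pr)%E.
Local Notation sqO := (sqi Pr setT).
Local Notation sqP := (sqP Pr).
Local Notation strip t := (`[0, t]%classic `*` [set: Omega] : set (measurableTypeR R * Omega)).
Local Notation strip_int := (strip_int Pr).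
Local Notation gito := (gito Pr F W).
Local Notation velt := (velt Pr F).
Local Notation itop := (itop Pr F W).
Local Notation vitop := (vitop Pr F W).

(** At time 0 the empty partition serves, since the integral vanishes in L^2 by the isometry. The
    grids used otherwise need a positive horizon. *)
Lemma gito_is_ito0 i H I : gito i 0 H I -> is_ito_integral Pr F (fun s w => W s w i 0) H 0 I.
Proof.
move=> hI; have [sH sI _] := hI; split; first by case: sI.
exists (fun=> 0%N), (fun _ _ => 0), (fun _ _ _ => 0); split.
- by move=> l; split.
- rewrite (_ : (fun l => _) = fun=> 0%E); first exact: cvg_cst.
  by apply/funext => l; apply: integral0_eq => w _; rewrite set_itv1 integral_set1.
- have e : (\int[Pr]_w (I w ^+ 2)%:E)%E = 0%E.
    rewrite -EFin_Rintegral //; last exact: sqi_integrable sI.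
    rewrite (gito_isq hF nW hI) strip_int0 ?mulr0 //; exact: sqi_integrable sH.
  under eq_fun do under eq_integral do rewrite /simple_integral big_ord0 subr0.
  rewrite e; exact: cvg_cst.
Qed.

Lemma itop_clipped_step t H g h (l : nat) : 0 < t -> itop t H g h ->
  exists (tau : nat -> R) (xi : nat -> Omega -> R),
    simple_data F t l.+1 tau xi /\
    strip_int t (fun s w => (H s w - simple_process l.+1 tau xi s w) ^+ 2) <=
      2 * (t / l.+1%:R * step_cst Pr K t g h) + 2 * (t * (l.+1%:R)^-1).
Proof.
move=> t0 iH; set m := l.+1; have m0 : (0 < m)%N by [].
have gT j : (j <= m)%N -> gp t m j <= t by exact: gp_leT t0 _ _.
have sO j : (j <= m)%N -> sqO (H (gp t m j)).
  by move=> jm; apply: (itop_sqO hF iH); [exact: gp_ge0 t0 _ _|exact: gT].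
(* A tolerance of [1 / m] at every grid point contributes at most [t / m] to the error over the
   strip. *)
have /choice[k hk] : forall j, exists k, (j <= m)%N ->
    \int[Pr]_w (H (gp t m j) w - clip k (H (gp t m j) w)) ^+ 2 <= (m%:R)^-1.
  move=> j; case: (leqP j m) => [jm|_]; last by exists 0%N.
  have [k hk] := clip_approx (sO j jm) (e := (m%:R)^-1) ltac:(by rewrite invr_gt0 ltr0n).
  by exists k.
pose xi j w := clip (k j) (H (gp t m j) w).
have sd : simple_data F t m (gp t m) xi.
  split.
  - exact: gp0.
  - exact: gpm.
  - by move=> j _; exact: (gp_le t0).
  - move=> j jm; exact: (rv_comp (Fsigma hF (gp_ge0 t0 m j)) (measurable_clip (k j))
      (itop_x_ad iH (gp_ge0 t0 m j) (gT j (ltnW jm)))).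
  - by move=> j _; exists (k j)%:R => w; exact: clip_bound.
exists (gp t m), xi; split=> //.
have sS : sqP t (simple_process m (gp t m) xi).
  apply: (eq_sqi _ (sp_sqP t (simple_velts (Pr := Pr) hF sd))) => z _.
  exact: sp_simple_velts.
have [f fE] := @stepp_sp _ _ _ Pr F t t0 m H
  (fun s s0 st => conj (itop_x_ad iH s0 st) (itop_sqO hF iH s0 st)).
have sT : sqP t (stepp t m H) by rewrite -fE; exact: sp_sqP.
have := isqD_le (mstrip t) (sqiB (mstrip t) (itop_x iH) sT) (sqiB (mstrip t) sT sS).
have -> : \int[muP]_(z in strip t) (H z.1 z.2 - stepp t m H z.1 z.2 +
    (stepp t m H z.1 z.2 - simple_process m (gp t m) xi z.1 z.2)) ^+ 2 =
  strip_int t (fun s w => (H s w - simple_process m (gp t m) xi s w) ^+ 2).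
  by apply: eq_Rintegral => z _; congr (_ ^+ 2); ring.
move=> /le_trans; apply; apply: lerD; apply: ler_wpM2l => //.
  exact: (itop_step_le hF nW t0 m0 iH).
apply: (strip_bound t0 (X := fun s w => stepp t m H s w - simple_process m (gp t m) xi s w) _ _).2.
  by case: (sqiB (mstrip t) sT sS).
move=> s; rewrite le_eqVlt => /orP[/eqP <- _|s0 st].
  have z w : stepp t m H 0 w - simple_process m (gp t m) xi 0 w = 0.
    rewrite /stepp /simple_process !big1 ?subrr // => j _;
      by rewrite indicE memNset ?mulr0 //= in_itv /= ltNge gp_ge0.
  split; first by apply: (eq_sqi _ (sqi0 Pr setT)) => w _; rewrite z.
  under eq_Rintegral do rewrite z expr0n.
  by rewrite Rintegral_cst // mul0r invr_ge0.
have [j [h1 h2]] := gp_cell m0 s0 st; have jm : (j <= m)%N by exact: ltnW.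
have e w : stepp t m H s w - simple_process m (gp t m) xi s w = H (gp t m j) w - xi j w.
  rewrite /stepp /simple_process (gp_sum t0 (fun j => H (gp t m j) w) h1 h2).
  by rewrite (gp_sum t0 (fun j => xi j w) h1 h2).
have mxi : measurable_fun setT (xi j).
  by apply: (measurableT_comp (measurable_clip _)); case: (sO j jm).
split.
  apply: (eq_sqi (f := fun w => H (gp t m j) w - xi j w)); first by move=> w _; rewrite e.
  apply: (dominated_sqi measurableT _ _ (sO j jm)).
    by apply: measurable_funB => //; case: (sO j jm).
  by move=> w _; exact: clip_dist.
by under eq_Rintegral do rewrite e; exact: hk.
Qed.

(** A converse of [ito_gito] for integrands that are Ito processes, by which the constructed
    solutions qualify for [is_state]. By the isometry the clipped step processes may replace
    whatever sequence defined the integral. *)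
Lemma gito_is_ito i t H I g h : 0 <= t -> itop t H g h -> gito i t H I ->
  is_ito_integral Pr F (fun s w => W s w i 0) H t I.
Proof.
rewrite le_eqVlt => /orP[/eqP <- _|t0 iH hI]; first exact: gito_is_ito0.
have [sH sI _] := hI; split; first by case: sI.
have /choice[txi htxi] : forall l : nat, exists txi : (nat -> R) * (nat -> Omega -> R),
    simple_data F t l.+1 txi.1 txi.2 /\
    strip_int t (fun s w => (H s w - simple_process l.+1 txi.1 txi.2 s w) ^+ 2) <=
      2 * (t / l.+1%:R * step_cst Pr K t g h) + 2 * (t * (l.+1%:R)^-1).
  by move=> l; have [tau [xi hl]] := itop_clipped_step l t0 iH; exists (tau, xi).
pose tau l := (txi l).1; pose xi l := (txi l).2.
have sd l : simple_data F t l.+1 (tau l) (xi l) by case: (htxi l).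
pose f l := simple_velts (Pr := Pr) hF (sd l).
have spf l : sp (f l) = simple_process l.+1 (tau l) (xi l).
  by apply/funext => s; apply/funext => w; exact: sp_simple_velts.
have cf : l2to muP (strip t) (fun l z => sp (f l) z.1 z.2) (fun z => H z.1 z.2).
  have c1 : (fun l => 2 * (t * (l.+1%:R)^-1 * step_cst Pr K t g h) + 2 * (t * (l.+1%:R)^-1)) @ \oo -->
      2 * (t * 0 * step_cst Pr K t g h) + 2 * (t * 0 : R).
    apply: cvgD; apply: cvgMr; first apply: cvgMl; by apply: cvgMr; exact: cvg_harmonic.
  rewrite !(mulr0, mul0r, addr0) in c1.
  rewrite /l2to; apply: (@squeeze_cvgr _ _ _ _ (fun=> 0)
    (fun l => 2 * (t * (l.+1%:R)^-1 * step_cst Pr K t g h) + 2 * (t * (l.+1%:R)^-1))).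
  - near=> l; apply/andP; split; first exact: isq_ge0.
    by rewrite spf; exact: (htxi l).2.
  - exact: cvg_cst.
  - exact: c1.
have ci := gito_approx hF nW hI cf.
exists (fun l => l.+1), tau, xi; split=> //.
- have := l2to_EFin (mstrip t) (fun l => sp_sqP t (f l)) sH cf.
  rewrite (_ : (fun l => _) = (fun l => \int[Pr]_w \int[mu]_(s in `[0%R, t])
            ((H s w - simple_process l.+1 (tau l) (xi l) s w) ^+ 2)%:E)%E) //.
  apply/funext => l; rewrite tonelli2 /=.
  + by under eq_integral do under eq_integral do rewrite spf.
  + exact: measurable_itv.
  + apply/measurable_EFinP; apply: measurable_funX.
    by case: (sqiB (mstrip t) sH (sp_sqP t (f l))).
  + by move=> z _; rewrite lee_fin sqr_ge0.
- have := l2to_EFin measurableT (fun l => si_sqi nW i (f l)) sI ci.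
  by under eq_fun do under eq_integral do rewrite si_simple_velts.
Unshelve. all: by end_near.
Qed.

Lemma within_col n (D : set R) (z : R -> 'cV[R]_n) :
  (forall c, {within D, continuous (fun t => z t c 0)}) -> {within D, continuous z}.
Proof.
move=> hz; rewrite (_ : z = fun t => \sum_c z t c 0 *: delta_mx c 0); last first.
  apply/funext => t; rewrite {1}[z t]matrix_sum_delta; apply: eq_bigr => c _.
  by rewrite big_ord1.
elim: (index_enum _) => [|c s IH].
  by rewrite (_ : (fun t => _) = fun=> 0); [move=> t; exact: cvg_cst|apply/funext => t; rewrite big_nil].
rewrite (_ : (fun t => _) = fun t => z t c 0 *: delta_mx c 0 + \sum_(c <- s) z t c 0 *: delta_mx c 0).
  by move=> t; apply: cvgD; [apply: cvgZl; exact: hz|exact: IH].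
by apply/funext => t; rewrite big_cons.
Qed.

Lemma sqP_L2sq n t (v : R -> Omega -> 'cV[R]_n) : (forall c, sqP t (fun s w => v s w c 0)) ->
  L2sq Pr `[0, t] v = (strip_int t (fun s w => sqnorm2 (v s w)))%:E.
Proof.
move=> hv; rewrite (L2sq_strip Pr (measurable_itv `[0, t])); last by move=> i; case: (hv i).
rewrite /strip_int EFin_Rintegral //; first exact: mstrip.
apply: (integrable_sumr (mstrip t)) => c; exact: (sqi_integrable (hv c)).
Qed.

Lemma vitop_state n m T (A : 'M[R]_n) (B : 'M[R]_(n, m)) (N : 'I_q -> 'M[R]_n) u z : 0 <= T ->
  vitop T z (fun s w => A *m z s w + B *m u s w) (fun i s w => N i *m z s w) ->
  {ae Pr, forall w c, {within `[0, T], continuous (fun t => z t w c 0)}} ->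
  is_state Pr F W `[0, T] A B N 0 u z.
Proof.
move=> T0 vz cz; split.
- split; last by move=> i; case: (itop_x (vz i)).
  by move=> t; rewrite /= in_itv /= => /andP[t0 tT] i; exact: (itop_x_ad (vz i)).
- by apply: filterS cz => w h; exact: within_col.
- move=> t; rewrite /= in_itv /= => /andP[t0 tT]; rewrite sqP_L2sq ?ltry // => c.
  exact: (sqP_sub tT (itop_x (vz c))).1.
- move=> t; rewrite /= in_itv /= => /andP[t0 tT].
  have /choice[I hI] := fun c => itop_eq (vz c) t0 tT.
  exists (fun i w => \col_c I c i w); split.
    move=> i c; have vN := vitop_mulmx hF nW (N i) vz.
    rewrite (_ : (fun w => _) = I c i); last by apply/funext => w; rewrite mxE.
    exact: (gito_is_ito t0 (itop_sub tT (vN c)) ((hI c).1 i)).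
  have : {ae Pr, forall w c, z t w c 0 = prim (fun s w => (A *m z s w + B *m u s w) c 0) t w + \sum_i I c i w}.
    apply: filter_forall => c; exact: (hI c).2.
  apply: filterS => w h; apply/matrixP => c j; rewrite !ord1 !mxE add0r summxE h.
  by congr (_ + _); apply: eq_bigr => i _; rewrite mxE.
Qed.

End ItoIntegral.

(** * Truncation in balanced coordinates *)

Section Algebra.
Context (R : realType).

Definition dotc m (a b : 'cV[R]_m) : R := \sum_i a i 0 * b i 0.

Lemma dotcE m (a b : 'cV[R]_m) : dotc a b = (a^T *m b) 0 0.
Proof. by rewrite mxE; apply: eq_bigr => i _; rewrite mxE. Qed.

Lemma dotcc m (a : 'cV[R]_m) : dotc a a = sqnorm2 a.
Proof. by apply: eq_bigr => i _; rewrite expr2. Qed.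

Lemma dotcC m (a b : 'cV[R]_m) : dotc a b = dotc b a.
Proof. by apply: eq_bigr => i _; rewrite mulrC. Qed.

Lemma dotcDr m (a b c : 'cV[R]_m) : dotc a (b + c) = dotc a b + dotc a c.
Proof. by rewrite /dotc -big_split; apply: eq_bigr => i _; rewrite mxE mulrDr. Qed.

Lemma dotcDl m (a b c : 'cV[R]_m) : dotc (b + c) a = dotc b a + dotc c a.
Proof. by rewrite dotcC dotcDr !(dotcC a). Qed.

Lemma dotcZr m (k : R) (a b : 'cV[R]_m) : dotc a (k *: b) = k * dotc a b.
Proof. by rewrite /dotc mulr_sumr; apply: eq_bigr => i _; rewrite mxE mulrCA. Qed.

Lemma dotc0 m (a : 'cV[R]_m) : dotc a 0 = 0.
Proof. by rewrite /dotc big1 // => i _; rewrite [X in _ * X]mxE mulr0. Qed.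

Lemma dotc_mulmx m n (a : 'cV[R]_m) (M : 'M[R]_(m, n)) (b : 'cV[R]_n) :
  dotc a (M *m b) = dotc (M^T *m a) b.
Proof. by rewrite !dotcE trmx_mul trmxK mulmxA. Qed.

Lemma cVD m (a b : 'cV[R]_m) c : (a + b) c 0 = a c 0 + b c 0.
Proof. by rewrite mxE. Qed.

Lemma cVB m (a b : 'cV[R]_m) c : (a - b) c 0 = a c 0 - b c 0.
Proof. by rewrite !mxE. Qed.

Lemma sqnorm2_ge0 m (a : 'cV[R]_m) : 0 <= sqnorm2 a.
Proof. by apply: sumr_ge0 => i _; exact: sqr_ge0. Qed.

Lemma sqnorm2D m (a b : 'cV[R]_m) : sqnorm2 (a + b) = sqnorm2 a + 2 * dotc a b + sqnorm2 b.
Proof. by rewrite -!dotcc dotcDr !dotcDl (dotcC b a); ring. Qed.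

Lemma sqnorm2_col_mx m p (a : 'cV[R]_m) (b : 'cV[R]_p) :
  sqnorm2 (col_mx a b) = sqnorm2 a + sqnorm2 b.
Proof.
by rewrite /sqnorm2 big_split_ord; congr (_ + _); apply: eq_bigr => i _; rewrite ?col_mxEu ?col_mxEd.
Qed.

Lemma dotc_diag n (d : 'rV[R]_n) (a b : 'cV[R]_n) :
  dotc a (diag_mx d *m b) = \sum_c d 0 c * (a c 0 * b c 0).
Proof.
apply: eq_bigr => c _; rewrite mul_diag_mx mxE; ring.
Qed.

Lemma quad_formE n (M : 'M[R]_n) (v : 'cV[R]_n) : quad_form M v = dotc v (M *m v).
Proof. by rewrite /quad_form dotcE mulmxA. Qed.

Lemma quad_form_tr n m (M : 'M[R]_(m, n)) (v : 'cV[R]_n) :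
  quad_form (M^T *m M) v = sqnorm2 (M *m v).
Proof. by rewrite quad_formE -mulmxA dotc_mulmx trmxK dotcc. Qed.

Lemma quad_formD n (M M' : 'M[R]_n) v : quad_form (M + M') v = quad_form M v + quad_form M' v.
Proof. by rewrite !quad_formE mulmxDl dotcDr. Qed.

Lemma quad_formN n (M : 'M[R]_n) v : quad_form (- M) v = - quad_form M v.
Proof. by rewrite !quad_formE -scaleN1r -scalemxAl dotcZr mulN1r. Qed.

Variables (q : nat) (K : 'M[R]_q).

(** The congruence [xi = S z] turns the form of the generalised Lyapunov operator into the drift of
    a diagonal form, in the shape of [vitop_diag]. *)
Lemma lyap_diag n (S A : 'M[R]_n) (N : 'I_q -> 'M[R]_n) (d : 'rV[R]_n) (xi : 'cV[R]_n) : S \in unitmx ->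
  quad_form (gen_lyap A N K (S^T *m diag_mx d *m S)) (invmx S *m xi) =
  \sum_c d 0 c * (2 * (xi c 0 * ((S *m A *m invmx S) *m xi) c 0) +
     kap K (fun i => ((S *m N i *m invmx S) *m xi) c 0)).
Proof.
move=> uS; set z := invmx S *m xi; set X := S^T *m _ *m S.
have Sz : S *m z = xi by rewrite mulmxA mulmxV // mul1mx.
have XE a b : dotc a (X *m b) = \sum_c d 0 c * ((S *m a) c 0 * (S *m b) c 0).
  by rewrite /X -!mulmxA dotc_mulmx trmxK dotc_diag.
have bal (M : 'M[R]_n) : S *m (M *m z) = (S *m M *m invmx S) *m xi by rewrite /z !mulmxA.
rewrite quad_formE /gen_lyap !mulmxDl !dotcDr.
have -> : dotc z (A^T *m X *m z) = \sum_c d 0 c * (((S *m A *m invmx S) *m xi) c 0 * xi c 0).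
  by rewrite -mulmxA dotc_mulmx trmxK XE Sz bal.
have -> : dotc z (X *m A *m z) = \sum_c d 0 c * (xi c 0 * ((S *m A *m invmx S) *m xi) c 0).
  by rewrite -mulmxA XE Sz bal.
have -> : dotc z ((\sum_i \sum_j K i j *: ((N i)^T *m X *m N j)) *m z) =
    \sum_c d 0 c * kap K (fun i => ((S *m N i *m invmx S) *m xi) c 0).
  transitivity (\sum_i \sum_j K i j * \sum_c d 0 c *
      (((S *m N i *m invmx S) *m xi) c 0 * ((S *m N j *m invmx S) *m xi) c 0)).
    rewrite mulmx_suml; elim/big_rec2: _ => [|i a b _ IH].
      exact: dotc0.
    rewrite dotcDr IH; congr (_ + _); rewrite mulmx_suml; elim/big_rec2: _ => [|j a' b' _ IH'].
      exact: dotc0.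
    rewrite dotcDr IH'; congr (_ + _); rewrite -scalemxAl dotcZr; congr (_ * _).
    by rewrite -2!mulmxA dotc_mulmx trmxK XE !bal.
  under eq_bigr do under eq_bigr do rewrite mulr_sumr.
  under eq_bigr do rewrite exchange_big /=.
  rewrite exchange_big /=; apply: eq_bigr => c _; rewrite /kap mulr_sumr; apply: eq_bigr => i _.
  by rewrite mulr_sumr; apply: eq_bigr => j _; ring.
by rewrite -!big_split /=; apply: eq_bigr => c _; ring.
Qed.

Lemma kap_parallelogram y y' : kap K (fun i => y i - y' i) + kap K (fun i => y i + y' i) =
  2 * kap K y + 2 * kap K y'.
Proof.
rewrite /kap !mulr_sumr -!big_split /=; apply: eq_bigr => i _.
rewrite !mulr_sumr -!big_split /=; apply: eq_bigr => j _; ring.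
Qed.

Hypothesis kap_ge0 : forall y, 0 <= kap K y.

Section Balanced.
Variables (n m p : nat) (A : 'M[R]_n) (N : 'I_q -> 'M[R]_n) (B : 'M[R]_(n, m)) (C : 'M[R]_(p, n)).
Variable sigma : 'I_n -> R.
Hypothesis sigma0 : forall c, 0 < sigma c.

Definition dg (d : 'I_n -> R) : 'M[R]_n := diag_mx (\row_c d c).
(** The generator of the uncontrolled system with drift matrix [M], applied to the quadratic form
    with diagonal [d]. *)
Definition lypt (M : 'M[R]_n) (d : 'I_n -> R) (xi : 'cV[R]_n) : R :=
  \sum_c d c * (2 * (xi c 0 * (M *m xi) c 0) + kap K (fun i => (N i *m xi) c 0)).

Lemma dotc_dg d (a b : 'cV[R]_n) : \sum_c d c * (a c 0 * b c 0) = dotc (dg d *m a) b.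
Proof.
rewrite dotcC dotc_diag; apply: eq_bigr => c _; rewrite mxE; ring.
Qed.

Hypothesis riccati : forall xi, lypt A sigma xi + sqnorm2 (C *m xi) - sqnorm2 (B^T *m (dg sigma *m xi)) = 0.
Hypothesis ineq : forall xi, lypt A (fun c => (sigma c)^-1) xi - sqnorm2 (C *m xi) +
  sqnorm2 (B^T *m (dg (fun c => (sigma c)^-1) *m xi)) <= 0.

Definition fbk : 'M[R]_(m, n) := B^T *m dg sigma.
Definition AQ : 'M[R]_n := A - B *m fbk.
Definition X c := sigma c + (sigma c)^-1.

Lemma lypt_AQ d xi : lypt AQ d xi = lypt A d xi - 2 * dotc (B^T *m (dg d *m xi)) (fbk *m xi).
Proof.
rewrite -dotc_mulmx -dotc_dg /lypt mulr_sumr -sumrB; apply: eq_bigr => c _.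
by rewrite /AQ mulmxBl -mulmxA cVB; ring.
Qed.

Lemma lypt_sigma xi : lypt AQ sigma xi = - sqnorm2 (C *m xi) - sqnorm2 (fbk *m xi).
Proof. by rewrite lypt_AQ mulmxA -/fbk dotcc; have := riccati xi; rewrite mulmxA -/fbk; lra. Qed.

Lemma lyptD M d d' xi : lypt M (fun c => d c + d' c) xi = lypt M d xi + lypt M d' xi.
Proof. by rewrite /lypt -big_split; apply: eq_bigr => c _ /=; rewrite mulrDl. Qed.

Lemma dgD d d' : dg (fun c => d c + d' c) = dg d + dg d'.
Proof. by apply/matrixP => i j; rewrite !mxE; case: (i == j); rewrite ?mulr1n ?mulr0n ?addr0. Qed.

(** When the Riccati equation and the inequality are added, the output terms cancel. With f and g
    the images of [xi] under B^T Sigma and B^T Sigma^-1, what remains is - |f|^2 - 2 f.g - |g|^2;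
    the feedback in [AQ] supplies the mixed term. *)
Lemma lypt_X xi : lypt AQ X xi <= - sqnorm2 (B^T *m (dg X *m xi)).
Proof.
have hf : B^T *m (dg sigma *m xi) = fbk *m xi by rewrite mulmxA.
rewrite /X lyptD lypt_sigma lypt_AQ dgD mulmxDl mulmxDr sqnorm2D hf (dotcC (fbk *m xi)).
by have := ineq xi; set a := dotc _ _; set b := sqnorm2 (_ *m (_ *m _)); lra.
Qed.

(** Truncated systems stay in dimension [n] with their last coordinates zero, so that states of
    different levels can be added and subtracted. *)
Definition proj (k : nat) : 'M[R]_n := dg (fun c => (c < k)%:R).

Lemma projE k (x : 'cV[R]_n) c : (proj k *m x) c 0 = if (c < k)%N then x c 0 else 0.
Proof. by rewrite mul_diag_mx !mxE; case: (c < k)%N; rewrite ?mul1r ?mul0r. Qed.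

(* The Lyapunov function e^T Sigma e + th s^T X s with e = x - x' and s = x + x' decreases up to
   the supply rate 4 th |v|^2; th X_k = sigma_k makes the terms in coordinate k cancel. *)
Lemma step_pointwise (k : 'I_n) (x x' : 'cV[R]_n) (v : 'cV[R]_m) (th : R) (ge gs : 'cV[R]_n) (he hs : 'I_q -> 'cV[R]_n) :
  proj k.+1 *m x = x -> proj k *m x' = x' -> th = sigma k / X k ->
  ge = proj k.+1 *m (AQ *m x + B *m v) - proj k *m (AQ *m x' + B *m v) ->
  gs = proj k.+1 *m (AQ *m x + B *m v) + proj k *m (AQ *m x' + B *m v) ->
  (forall i, he i = proj k.+1 *m (N i *m x) - proj k *m (N i *m x')) ->
  (forall i, hs i = proj k.+1 *m (N i *m x) + proj k *m (N i *m x')) ->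
  \sum_c sigma c * (2 * ((x - x') c 0 * ge c 0) + kap K (fun i => he i c 0)) +
  th * \sum_c X c * (2 * ((x + x') c 0 * gs c 0) + kap K (fun i => hs i c 0)) <=
  4 * th * sqnorm2 v - (sqnorm2 (C *m (x - x')) + sqnorm2 (fbk *m (x - x'))).
Proof.
move=> hx hx' thE geE' gsE' heE' hsE'.
have X0 c : 0 < X c by rewrite /X addr_gt0 ?invr_gt0.
have th0 : 0 <= th by rewrite thE divr_ge0 ?ltW.
have thX E : th * (X k * E) = sigma k * E by rewrite thE mulrA divfK // gt_eqF.
have x0 (c : 'I_n) : (k < c)%N -> x c 0 = 0 by move=> kc; rewrite -hx projE ltnS leqNgt kc.
have x'0 (c : 'I_n) : (k <= c)%N -> x' c 0 = 0 by move=> kc; rewrite -hx' projE ltnNge kc.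
set e := x - x'; set s := x + x'.
have percoord c : sigma c * (2 * (e c 0 * ge c 0) + kap K (fun i => he i c 0)) +
    th * (X c * (2 * (s c 0 * gs c 0) + kap K (fun i => hs i c 0))) <=
    sigma c * (2 * (e c 0 * (AQ *m e) c 0) + kap K (fun i => (N i *m e) c 0)) +
    th * (X c * (2 * (s c 0 * (AQ *m s) c 0) + kap K (fun i => (N i *m s) c 0))) +
    4 * th * (X c * (s c 0 * (B *m v) c 0)).
  have geE : ge c 0 = (if (c < k.+1)%N then (AQ *m x) c 0 + (B *m v) c 0 else 0) -
      (if (c < k)%N then (AQ *m x') c 0 + (B *m v) c 0 else 0).
    by rewrite geE' cVB !projE !cVD.
  have gsE : gs c 0 = (if (c < k.+1)%N then (AQ *m x) c 0 + (B *m v) c 0 else 0) +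
      (if (c < k)%N then (AQ *m x') c 0 + (B *m v) c 0 else 0).
    by rewrite gsE' [LHS]cVD !projE !cVD.
  have heE i : he i c 0 = (if (c < k.+1)%N then (N i *m x) c 0 else 0) -
      (if (c < k)%N then (N i *m x') c 0 else 0).
    by rewrite heE' cVB !projE.
  have hsE i : hs i c 0 = (if (c < k.+1)%N then (N i *m x) c 0 else 0) +
      (if (c < k)%N then (N i *m x') c 0 else 0).
    by rewrite hsE' cVD !projE.
  have eE M : (M *m e) c 0 = (M *m x) c 0 - (M *m x') c 0 :> R.
    by rewrite /e mulmxBr cVB.
  have sE M : (M *m s) c 0 = (M *m x) c 0 + (M *m x') c 0 :> R.
    by rewrite /s mulmxDr cVD.
  have ec : e c 0 = x c 0 - x' c 0 by rewrite /e cVB.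
  have sc : s c 0 = x c 0 + x' c 0 by rewrite /s cVD.
  have kE : kap K (fun i => (N i *m e) c 0) = kap K (fun i => (N i *m x) c 0 - (N i *m x') c 0).
    by congr (kap K _); apply/funext => i; exact: eE.
  have kS : kap K (fun i => (N i *m s) c 0) = kap K (fun i => (N i *m x) c 0 + (N i *m x') c 0).
    by congr (kap K _); apply/funext => i; exact: sE.
  rewrite kE kS eE sE geE gsE ec sc.
  (* Below [k] both states follow the closed loop and equality holds. Above [k] both states vanish,
     and only nonnegative noise terms remain on the right. *)
  case: (ltngtP c k) => ck.
  - rewrite (_ : (fun i => he i c 0) = (fun i => (N i *m x) c 0 - (N i *m x') c 0)); last first.
      by apply/funext => i; rewrite heE ck ltnS ltnW.
    rewrite (_ : (fun i => hs i c 0) = (fun i => (N i *m x) c 0 + (N i *m x') c 0)); last first.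
      by apply/funext => i; rewrite hsE ck ltnS ltnW.
    by rewrite ltnS (ltnW ck) le_eqVlt; apply/orP; left; apply/eqP; ring.
  - rewrite (x0 c ck) (x'0 c (ltnW ck)).
    rewrite (_ : (fun i => he i c 0) = fun=> 0); last first.
      by apply/funext => i; rewrite heE ltnS leqNgt ck /= ltnNge (ltnW ck) subrr.
    rewrite (_ : (fun i => hs i c 0) = fun=> 0); last first.
      by apply/funext => i; rewrite hsE ltnS leqNgt ck /= ltnNge (ltnW ck) addr0.
    have -> : kap K (fun=> 0) = 0 by rewrite /kap big1 // => i _; rewrite big1 // => j _; ring.
    rewrite subrr addr0 !(mul0r, mulr0, add0r, addr0).
    by rewrite addr_ge0 // mulr_ge0 ?kap_ge0 // ?mulr_ge0 ?kap_ge0 ?ltW.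
  (* Here [x'] vanishes and does not move. As e and s carry the same weight [sigma k], the terms in
     [AQ *m x'] cancel between them, and by the parallelogram law the noise of [x'] only enlarges
     the right side. *)
  - have {}ck : c = k by exact: val_inj.
    rewrite (_ : (fun i => he i c 0) = (fun i => (N i *m x) k 0)); last first.
      by apply/funext => i; rewrite heE ck ltnSn ltnn subr0.
    rewrite (_ : (fun i => hs i c 0) = (fun i => (N i *m x) k 0)); last first.
      by apply/funext => i; rewrite hsE ck ltnSn ltnn addr0.
    have := kap_parallelogram (fun i => (N i *m x) k 0) (fun i => (N i *m x') k 0).
    have := kap_ge0 (fun i => (N i *m x') k 0).
    rewrite !ck ltnSn (x'0 k (leqnn k)) !subr0 !addr0 -(mulrA 4) !thX.
    set k1 := kap K _; set k2 := kap K _; set k3 := kap K _; set k4 := kap K _ => k10 par.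
    by have s0 := mulr_ge0 (ltW (sigma0 k)) k10; nra.
have sum1 := ler_sum (index_enum 'I_n) (fun c (_ : true) => percoord c).
rewrite !big_split /= -!mulr_sumr -/(lypt AQ sigma e) -/(lypt AQ X s) dotc_dg dotc_mulmx in sum1.
apply: (le_trans sum1); rewrite lypt_sigma.
have h1 := ler_wpM2l th0 (lypt_X s).
(* Completing the square: the cross term [4 * th] times the product of B^T X s and [v] is absorbed
   by the dissipation of s up to [4 * th * sqnorm2 v]. *)
have h2 : 0 <= th * sqnorm2 (B^T *m (dg X *m s) + (-2) *: v) by rewrite mulr_ge0 ?sqnorm2_ge0.
have h3 : sqnorm2 ((-2) *: v) = 4 * sqnorm2 v.
  by rewrite -!dotcc dotcZr dotcC dotcZr; ring.
rewrite sqnorm2D dotcZr h3 in h2; move: h1 h2.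
by set a := dotc _ _; set b := sqnorm2 _; set l := lypt _ _ _; nra.
Qed.

End Balanced.
End Algebra.

(** * The chain of truncated closed loops *)

Section ClosedLoop.
Context d (Omega : measurableType d) (R : realType).
Variable (Pr : probability Omega R).
Variable F : R -> set (set Omega).
Hypothesis hF : usual_filtration Pr F.
Variables (q : nat) (K : 'M[R]_q) (W : R -> Omega -> 'cV[R]_q).
Hypothesis hW : wiener Pr F K W.
Local Notation mu := (@lebesgue_measure R).
Local Notation muP := (mu \x Pr)%E.
Local Notation sqO := (sqi Pr setT).
Local Notation sqP := (sqP Pr).
Local Notation strip t := (`[0, t]%classic `*` [set: Omega] : set (measurableTypeR R * Omega)).
Local Notation strip_int := (strip_int Pr).
Local Notation vitop := (vitop Pr F W).
Let nW := wiener_noise hF hW.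

(** The form is the second moment of the combination, with coefficients [y], of the increments over
    [[0, 1]]. *)
Lemma kap_ge0 y : 0 <= kap K y.
Proof.
have rc (a : R) : rv_measurable (F 0) (fun=> a) by exact: (rv_cst (Fsigma hF (lexx 0))).
have s1 i := noise_sqi nW i (lexx 0) (ler01 : 0 <= 1 :> R) (rc (y i)) (sqO_cst Pr (y i)).
have -> : kap K y = \int[Pr]_w (\sum_i y i * incr W i 0 1 w) ^+ 2; last exact: isq_ge0.
transitivity (\int[Pr]_w (\sum_i \sum_j ((y i * incr W i 0 1 w) * (y j * incr W j 0 1 w)))).
  rewrite (Rintegral_sumr measurableT) => [|i]; last first.
    apply: (integrable_sumr measurableT) => j; exact: (sqi_mul measurableT (s1 i) (s1 j)).
  apply: eq_bigr => i _; rewrite (Rintegral_sumr measurableT) => [|j]; last first.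
    exact: (sqi_mul measurableT (s1 i) (s1 j)).
  apply: eq_bigr => j _.
  rewrite (noise_cov nW i j (lexx 0) (ler01 : 0 <= 1 :> R) (rc _) (sqO_cst Pr _) (rc _) (sqO_cst Pr _)).
  by rewrite subr0 mulr1 Rintegral_cst // (congr1 fine (probability_setT Pr)) mulr1.
apply: eq_Rintegral => w _; rewrite expr2 mulr_suml; apply: eq_bigr => i _.
by rewrite mulr_sumr.
Qed.

Definition energy t n (x : R -> Omega -> 'cV[R]_n) : R := strip_int t (fun s w => sqnorm2 (x s w)).

Lemma energy_integrable t n (x : R -> Omega -> 'cV[R]_n) : (forall c, sqP t (fun s w => x s w c 0)) ->
  muP.-integrable (strip t) (EFin \o (fun z => sqnorm2 (x z.1 z.2))).
Proof.
by move=> hx; apply: (integrable_sumr (mstrip t)) => c; exact: (sqi_integrable (hx c)).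
Qed.

Lemma energy_ge0 t n (x : R -> Omega -> 'cV[R]_n) : 0 <= energy t x.
Proof. by apply: Rintegral_ge0 => z _; exact: sqnorm2_ge0. Qed.

Lemma sqP_add t n (x y : R -> Omega -> 'cV[R]_n) :
  (forall c, sqP t (fun s w => x s w c 0)) -> (forall c, sqP t (fun s w => y s w c 0)) ->
  forall c, sqP t (fun s w => (x s w + y s w) c 0).
Proof.
by move=> hx hy c; apply: (eq_sqi _ (sqiD (mstrip t) (hx c) (hy c))) => z _; rewrite cVD.
Qed.

Lemma sqP_subtract t n (x y : R -> Omega -> 'cV[R]_n) :
  (forall c, sqP t (fun s w => x s w c 0)) -> (forall c, sqP t (fun s w => y s w c 0)) ->
  forall c, sqP t (fun s w => (x s w - y s w) c 0).
Proof.
by move=> hx hy c; apply: (eq_sqi _ (sqiB (mstrip t) (hx c) (hy c))) => z _; rewrite cVB.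
Qed.

(** Minkowski's inequality in squared form: Young's inequality with the weights [1 + b / a] and
    [1 + a / b], which are exact for norms in the ratio of [a] to [b]. *)
Lemma energy_triangle t n (x y : R -> Omega -> 'cV[R]_n) (a b V : R) :
  (forall c, sqP t (fun s w => x s w c 0)) -> (forall c, sqP t (fun s w => y s w c 0)) ->
  0 < a -> 0 < b -> energy t x <= a ^+ 2 * V -> energy t y <= b ^+ 2 * V ->
  energy t (fun s w => x s w + y s w) <= (a + b) ^+ 2 * V.
Proof.
move=> hx hy a0 b0 hX hY; have ix := energy_integrable hx; have iy := energy_integrable hy.
apply: (@le_trans _ _ ((1 + b / a) * energy t x + (1 + a / b) * energy t y)).
  rewrite /energy /strip_int -(RintegralL (mstrip t)) //; apply: le_Rintegral.
  - exact: mstrip.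
  - exact: (energy_integrable (sqP_add hx hy)).
  - exact: (integrable_lin (mstrip t)).
  - move=> z _; rewrite sqnorm2D.
    have h : 0 <= sqnorm2 (b *: x z.1 z.2 - a *: y z.1 z.2) by exact: sqnorm2_ge0.
    have ab : 0 < a * b by exact: mulr_gt0.
    move: h; rewrite -scaleNr sqnorm2D dotcZr (dotcC (b *: _)) dotcZr.
    rewrite -![sqnorm2 (_ *: _)]dotcc !dotcZr ![dotc (_ *: _) _]dotcC !dotcZr !dotcc (dotcC (y _ _)).
    set X := sqnorm2 _; set Y := sqnorm2 (y _ _); set Z := dotc _ _ => h.
    rewrite -subr_ge0 -(pmulr_rge0 _ ab).
    apply: (le_trans h); rewrite le_eqVlt; apply/orP; left; apply/eqP.
    by field; rewrite !gt_eqF.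
apply: (@le_trans _ _ ((1 + b / a) * (a ^+ 2 * V) + (1 + a / b) * (b ^+ 2 * V))).
  by apply: lerD; apply: ler_wpM2l => //; rewrite addr_ge0 // divr_ge0 ?ltW.
by rewrite le_eqVlt; apply/orP; left; apply/eqP; field; rewrite !gt_eqF.
Qed.

Variable T : R.
Hypothesis T0 : 0 < T.
Variables (n m p : nat) (A : 'M[R]_n) (N : 'I_q -> 'M[R]_n) (B : 'M[R]_(n, m)) (C : 'M[R]_(p, n)).
Variable sigma : 'I_n -> R.
Hypothesis sigma0 : forall c, 0 < sigma c.
Hypothesis riccati : forall xi, lypt K N A sigma xi + sqnorm2 (C *m xi) -
  sqnorm2 (B^T *m (dg sigma *m xi)) = 0.
Hypothesis ineq : forall xi, lypt K N A (fun c => (sigma c)^-1) xi - sqnorm2 (C *m xi) +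
  sqnorm2 (B^T *m (dg (fun c => (sigma c)^-1) *m xi)) <= 0.
Local Notation fbk := (fbk B sigma).
Local Notation AQ := (AQ A B sigma).

Variables (u : R -> Omega -> 'cV[R]_m) (x : R -> Omega -> 'cV[R]_n).
Hypothesis hx : vitop T x (fun t w => A *m x t w + B *m u t w) (fun i t w => N i *m x t w).
Hypothesis hu : forall c, sqP T (fun s w => u s w c 0).

Definition clv t w := u t w + fbk *m x t w.

Let sx t c : t <= T -> sqP t (fun s w => x s w c 0).
Proof. by move=> tT; exact: (sqP_sub tT (itop_x (hx c))).1. Qed.

Let su t c : t <= T -> sqP t (fun s w => u s w c 0).
Proof. by move=> tT; exact: (sqP_sub tT (hu c)).1. Qed.

Lemma clv_sqP t : t <= T -> forall c, sqP t (fun s w => clv s w c 0).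
Proof.
by move=> tT; apply: sqP_add => c; [exact: su|apply: sqP_mulmx => c'; exact: sx].
Qed.

(** The control acts on the storage function through twice its product with the feedback, which is
    precisely the mixed term of the square of [clv]. *)
Lemma energy_balance t : 0 <= t -> t <= T ->
  energy t clv = energy t u + energy t (fun s w => C *m x s w) +
    \sum_c sigma c * \int[Pr]_w x t w c 0 ^+ 2.
Proof.
move=> t0 tT; have [-> iJ] := vitop_diag hF nW sigma hx t0 tT.
have iu := energy_integrable (fun c => su c tT).
have iy := energy_integrable (sqP_mulmx C (fun c => sx c tT)).
have iuy := integrable_lin (mstrip t) 1 1 iu iy.
rewrite /energy /strip_int -(RintegralD (mstrip t) iu iy).
rewrite -RintegralD //; last 2 first.
- exact: mstrip.
- by apply: (eq_integrable (mstrip t)) iuy => z _; rewrite /= !mul1r.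
apply: eq_Rintegral => z _; move: (z.1) (z.2) => s w.
have := riccati (x s w); rewrite mulmxA -/fbk.
have -> : lypt K N A sigma (x s w) = \sum_c sigma c * (2 * (x s w c 0 * (A *m x s w + B *m u s w) c 0) +
    kap K (fun i => (N i *m x s w) c 0)) - 2 * dotc (fbk *m x s w) (u s w).
  rewrite /fbk -mulmxA -[B^T *m _]/(B^T *m _) -dotc_mulmx -dotc_dg mulr_sumr -sumrB; apply: eq_bigr => c _.
  by rewrite cVD; ring.
rewrite /clv sqnorm2D (dotcC (u s w)); set a := \sum_c _; set b := dotc _ _; set c := sqnorm2 _.
by set e := sqnorm2 _; set f := sqnorm2 _; lra.
Qed.

Local Notation proj := (@proj R n).

(** The input is [clv], formed with the state of the full loop, at every level. Two neighbouring
    levels thus differ by the truncation of one coordinate only. *)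
Record level (k : nat) (y : R -> Omega -> 'cV[R]_n) : Prop := Level {
  level_ito : vitop T y (fun t w => proj k *m (AQ *m y t w + B *m clv t w))
    (fun i t w => proj k *m (N i *m y t w));
  level_proj : forall t w, proj k *m y t w = y t w }.

Lemma level_full : level n x.
Proof.
have pn (y : 'cV[R]_n) : proj n *m y = y by apply/colP => c; rewrite projE ltn_ord.
split=> //; move: hx; congr (vitop _ _ _ _); apply/funext => t; last first.
  by apply/funext => s; apply/funext => w; rewrite pn.
apply/funext => w; rewrite pn /clv /AQ mulmxBl mulmxDr -!mulmxA addrACA.
by rewrite addNr addr0.
Qed.

(** The equation is solved with coefficients projected on both sides, and its solution is projected
    afterwards, which gives [level_proj] for every [t] and [w]. *)
Lemma level_exists k : exists y, level k y /\ forall w c, {within `[0, T], continuous (fun t => y t w c 0)}.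
Proof.
(* The forcing is expressed through the drift and the state of [x], the form for which
   [forced_exists] knows its primitive to be adapted. *)
have fE t w : proj k *m (B *m clv t w) =
    proj k *m (A *m x t w + B *m u t w) + proj k *m (B *m fbk - A) *m x t w.
  rewrite -mulmxA -mulmxDr; congr (_ *m _); rewrite mulmxBl -mulmxA /clv mulmxDr.
  by rewrite [A *m _ + _]addrC -addrA [A *m _ + _]addrC subrK.
have [Y [vY cY]] := forced_exists hF hW (f := fun t w => proj k *m (B *m clv t w))
  (proj k *m AQ *m proj k) (M := proj k *m (B *m fbk - A)) (L := proj k) (fun i => proj k *m N i *m proj k) T0 hx
  fE.
have pp (y : 'cV[R]_n) : proj k *m (proj k *m y) = proj k *m y.
  by apply/colP => c; rewrite !projE; case: (c < k)%N.
exists (fun t w => proj k *m Y t w); split; first split=> //.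
  have := vitop_mulmx hF nW (proj k) vY; congr (vitop _ _ _ _); apply/funext => t; last first.
    by apply/funext => s; apply/funext => w; rewrite -!mulmxA pp.
  by apply/funext => w; rewrite mulmxDr -!mulmxA !pp mulmxDr.
move=> w c; case: (ltnP c k) => ck.
  rewrite (_ : (fun t => _) = fun t => Y t w c 0); first exact: cY.
  by apply/funext => t; rewrite projE ck.
rewrite (_ : (fun t => _) = fun=> 0) => [t|]; first exact: cvg_cst.
by apply/funext => t; rewrite projE ltnNge ck.
Qed.

Definition Cc : 'M[R]_(p + m, n) := col_mx C fbk.

Lemma level_sqP k y : level k y -> forall c, sqP T (fun s w => y s w c 0).
Proof. by move=> ly c; exact: (itop_x (level_ito ly c)). Qed.

(** [step_pointwise] is integrated over the strip: the Lyapunov function starts at 0 and is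
    nonnegative at time [T], so the supply dominates the energy of the output. The square of the
    constant is [4 * th], with [th = sigma k ^+ 2 / (1 + sigma k ^+ 2)]. *)
Lemma level_step (k : 'I_n) y y' : level k.+1 y -> level k y' ->
  energy T (fun s w => Cc *m (y s w - y' s w)) <=
    (2 * (sigma k / Num.sqrt (1 + sigma k ^+ 2))) ^+ 2 * energy T clv.
Proof.
move=> ly ly'; set th := sigma k / X sigma k; have TT := ltW T0.
have X0 c : 0 < X sigma c by rewrite /X addr_gt0 ?invr_gt0.
have thE : (2 * (sigma k / Num.sqrt (1 + sigma k ^+ 2))) ^+ 2 = 4 * th.
  have h1 : 0 < 1 + sigma k ^+ 2 by rewrite ltr_pwDl // sqr_ge0.
  rewrite !exprMn exprVn sqr_sqrtr ?ltW // /th /X; field.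
  by rewrite !gt_eqF //= addrC.
rewrite thE.
have ve := vitop_lin hF nW 1 (-1) (level_ito ly) (level_ito ly').
have vs := vitop_lin hF nW 1 1 (level_ito ly) (level_ito ly').
have [eE iE] := vitop_diag hF nW sigma ve TT (lexx T).
have [eS iS] := vitop_diag hF nW (X sigma) vs TT (lexx T).
have posE : 0 <= \sum_c sigma c * \int[Pr]_w (1 *: y T w + -1 *: y' T w) c 0 ^+ 2.
  by apply: sumr_ge0 => c _; rewrite mulr_ge0 ?isq_ge0 // ltW.
have posS : 0 <= th * \sum_c X sigma c * \int[Pr]_w (1 *: y T w + 1 *: y' T w) c 0 ^+ 2.
  apply: mulr_ge0; first by rewrite divr_ge0 ?ltW.
  by apply: sumr_ge0 => c _; rewrite mulr_ge0 ?isq_ge0 // ltW.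
have pos := addr_ge0 posE posS; rewrite eE eS in pos.
have iv := energy_integrable (clv_sqP (lexx T)).
have iC := energy_integrable (sqP_mulmx Cc (sqP_subtract (level_sqP ly) (level_sqP ly'))).
rewrite -subr_ge0; apply: (le_trans pos).
rewrite /energy /strip_int (_ : 4 * th * _ - _ = 4 * th * \int[muP]_(z in strip T) sqnorm2 (clv z.1 z.2) +
  -1 * \int[muP]_(z in strip T) sqnorm2 (Cc *m (y z.1 z.2 - y' z.1 z.2))); last by rewrite mulN1r.
rewrite -(RintegralL (mstrip T)) // -[X in X + _]mul1r -(RintegralL (mstrip T)) //.
apply: le_Rintegral.
- exact: mstrip.
- exact: (integrable_lin (mstrip T)).
- exact: (integrable_lin (mstrip T)).
- move=> [s w] _ /=; rewrite mul1r mulN1r /Cc mul_col_mx sqnorm2_col_mx.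
  have := step_pointwise (v := clv s w) kap_ge0 sigma0 riccati ineq (level_proj ly s w) (level_proj ly' s w)
    (erefl th) (erefl _) (erefl _) (fun i => erefl) (fun i => erefl).
  apply: le_trans; rewrite le_eqVlt; apply/orP; left; apply/eqP.
  congr (_ + _ * _); apply: eq_bigr => c _; congr (_ * (_ + kap K _)); try (apply/funext => i);
    by rewrite !scale1r ?scaleN1r.
Qed.

(** The induction starts with one removed coordinate, not with none, because [energy_triangle] asks
    for positive bounds. *)
Lemma level_telescope j (k : nat) y : (k + j.+1 = n)%N -> level k y ->
  energy T (fun s w => Cc *m (x s w - y s w)) <=
    (2 * \sum_(c < n | (k <= c)%N) (sigma c / Num.sqrt (1 + sigma c ^+ 2))) ^+ 2 * energy T clv.
Proof.
have th0 c : 0 < sigma c / Num.sqrt (1 + sigma c ^+ 2).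
  by rewrite divr_gt0 // sqrtr_gt0 ltr_pwDl // sqr_ge0.
elim: j k y => [|j IH] k y kn ly.
  have kn' : (k < n)%N by rewrite -kn addn1.
  have -> : \sum_(c < n | (k <= c)%N) (sigma c / Num.sqrt (1 + sigma c ^+ 2)) =
      sigma (Ordinal kn') / Num.sqrt (1 + sigma (Ordinal kn') ^+ 2).
    rewrite (bigD1 (Ordinal kn')) //= big1 ?addr0 // => c /andP[kc ne].
    move: ne; rewrite -val_eqE /= eqn_leq kc andbT -ltnNge => ck.
    by have := ltn_ord c; rewrite -{2}kn addn1 ltnS leqNgt ck.
  apply: (level_step (k := Ordinal kn')) => //=; rewrite -addn1 kn; exact: level_full.
have kn' : (k < n)%N by rewrite -kn addnS ltnS leq_addr.
have [y1 [ly1 _]] := level_exists k.+1.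
have h1 := IH k.+1 y1 (eq_trans (addSnnS _ _) kn) ly1.
have h2 := level_step (k := Ordinal kn') ly1 ly.
have -> : \sum_(c < n | (k <= c)%N) (sigma c / Num.sqrt (1 + sigma c ^+ 2)) =
    \sum_(c < n | (k.+1 <= c)%N) (sigma c / Num.sqrt (1 + sigma c ^+ 2)) +
    sigma (Ordinal kn') / Num.sqrt (1 + sigma (Ordinal kn') ^+ 2).
  rewrite (bigD1 (Ordinal kn')) //= addrC; congr (_ + _); apply: eq_bigl => c.
  by rewrite ltn_neqAle eq_sym -val_eqE andbC.
have sum0 : 0 < \sum_(c < n | (k.+1 <= c)%N) (sigma c / Num.sqrt (1 + sigma c ^+ 2)).
  have kn1 : (k.+1 < n)%N by rewrite -kn !addnS !ltnS leq_addr.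
  rewrite (bigD1 (Ordinal kn1)) //=; apply: ltr_pwDl; first exact: th0.
  by apply: sumr_ge0 => c _; rewrite ltW.
have a0 := mulr_gt0 (ltr0n R 2) sum0; have b0 := mulr_gt0 (ltr0n R 2) (th0 (Ordinal kn')).
rewrite mulrDr.
have := energy_triangle (sqP_mulmx Cc (sqP_subtract (fun c => sx c (lexx T)) (level_sqP ly1)))
  (sqP_mulmx Cc (sqP_subtract (level_sqP ly1) (level_sqP ly))) a0 b0 h1 h2.
congr (_ <= _); apply: eq_Rintegral => z _.
by rewrite -mulmxDr addrA subrK.
Qed.

End ClosedLoop.

(** * Balanced coordinates and the reduced matrices *)

Section Balancing.
Context (R : realType).

Section Leading.
Variables (r n : nat) (hr : (r < n)%N).

Definition lead_rows (v : 'cV[R]_n) : 'cV[R]_r := rowsub (lead_ord hr) v.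

Lemma sum_lead (f : 'I_n -> R) : (forall c : 'I_n, (r <= c)%N -> f c = 0) ->
  \sum_c f c = \sum_(j < r) f (lead_ord hr j).
Proof.
move=> f0; rewrite /lead_ord -(big_ord_narrow (ltnW hr)) (bigID (fun c : 'I_n => (c < r)%N)) /=.
by rewrite [X in _ + X]big1 ?addr0 // => c; rewrite -leqNgt; exact: f0.
Qed.

Lemma lead_rowsD (a b : 'cV[R]_n) : lead_rows (a + b) = lead_rows a + lead_rows b.
Proof. by apply/colP => i; rewrite !mxE. Qed.

Lemma lead_rowsE : lead_rows = mulmx (rowsub (lead_ord hr) 1%:M).
Proof. by apply/funext => v; rewrite /lead_rows rowsubE. Qed.

Lemma lead_rows_proj (y : 'cV[R]_n) : lead_rows (proj R n r *m y) = lead_rows y.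
Proof. by apply/colP => i; rewrite [LHS]mxE [RHS]mxE projE /= ltn_ord. Qed.

Lemma trunc_mx_lead (M : 'M[R]_n) (y : 'cV[R]_n) : proj R n r *m y = y ->
  trunc_mx hr M *m lead_rows y = lead_rows (M *m y).
Proof.
move=> py; apply/colP => i; rewrite [RHS]mxE !mxE (sum_lead (f := fun j => M _ j * y j 0)).
  by apply: eq_bigr => j _; rewrite !mxE.
by move=> c rc; rewrite -py projE ltnNge rc mulr0.
Qed.

Lemma trunc_cols_lead p (M : 'M[R]_(p, n)) (y : 'cV[R]_n) : proj R n r *m y = y ->
  trunc_cols hr M *m lead_rows y = M *m y.
Proof.
move=> py; apply/colP => i; rewrite [RHS]mxE !mxE (sum_lead (f := fun j => M _ j * y j 0)).
  by apply: eq_bigr => j _; rewrite !mxE.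
by move=> c rc; rewrite -py projE ltnNge rc mulr0.
Qed.

Lemma trunc_rows_lead m (M : 'M[R]_(n, m)) (v : 'cV[R]_m) :
  trunc_rows hr M *m v = lead_rows (M *m v).
Proof. by apply/colP => i; rewrite [RHS]mxE !mxE; apply: eq_bigr => j _; rewrite !mxE. Qed.

End Leading.

Variables (q n m p : nat) (K : 'M[R]_q) (A : 'M[R]_n) (N : 'I_q -> 'M[R]_n).
Variables (B : 'M[R]_(n, m)) (C : 'M[R]_(p, n)) (P Q S : 'M[R]_n) (sigma : 'I_n -> R).
Hypothesis sigma0 : forall c, 0 < sigma c.
Hypothesis uS : S \in unitmx.
Hypothesis SP : S *m P *m S^T = dg sigma.
Hypothesis SQ : (invmx S)^T *m Q *m invmx S = dg sigma.
Local Notation A' := (S *m A *m invmx S).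
Local Notation N' := (fun i => S *m N i *m invmx S).
Local Notation B' := (S *m B).
Local Notation C' := (C *m invmx S).

Lemma QE : Q = S^T *m dg sigma *m S.
Proof.
rewrite -SQ !mulmxA -trmx_mul mulVmx // trmx1 mul1mx -mulmxA mulVmx //.
by rewrite mulmx1.
Qed.

Lemma dgM (d d' : 'I_n -> R) : dg d *m dg d' = dg (fun c => d c * d' c).
Proof. by rewrite /dg mulmx_diag; congr diag_mx; apply/rowP => c; rewrite !mxE. Qed.

Lemma invmxPE : invmx P = S^T *m dg (fun c => (sigma c)^-1) *m S.
Proof.
set Pi := S^T *m _ *m S; have PPi : P *m Pi = 1%:M.
  have e : P *m S^T = invmx S *m dg sigma by rewrite -SP !mulmxA mulVmx // mul1mx.
  rewrite /Pi !mulmxA e -(mulmxA (invmx S)) dgM.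
  have -> : dg (fun c => sigma c * (sigma c)^-1) = 1%:M :> 'M[R]_n.
    by apply/matrixP => i j; rewrite !mxE mulfV // gt_eqF.
  by rewrite mulmx1 mulVmx.
have [uP _] := mulmx1_unit PPi.
by rewrite -[RHS](mulKmx uP) PPi mulmx1.
Qed.

Lemma dgT (d : 'I_n -> R) : (dg d)^T = dg d.
Proof. by rewrite /dg tr_diag_mx. Qed.

Lemma quad_feedback (d : 'I_n -> R) (X := S^T *m dg d *m S) xi :
  quad_form (X *m B *m B^T *m X) (invmx S *m xi) = sqnorm2 (B'^T *m (dg d *m xi)).
Proof.
have XT : X^T = X by rewrite /X !trmx_mul trmxK dgT mulmxA.
rewrite (_ : X *m B *m B^T *m X = (B^T *m X)^T *m (B^T *m X)); last first.
  by rewrite trmx_mul trmxK XT !mulmxA.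
rewrite quad_form_tr /X -!mulmxA [S *m (invmx S *m xi)]mulmxA mulmxV // mul1mx.
by rewrite trmx_mul !mulmxA.
Qed.

Lemma quad_output xi : quad_form (C^T *m C) (invmx S *m xi) = sqnorm2 (C' *m xi).
Proof. by rewrite quad_form_tr mulmxA. Qed.

Lemma lypt_balanced (d : 'I_n -> R) xi :
  quad_form (gen_lyap A N K (S^T *m dg d *m S)) (invmx S *m xi) = lypt K N' A' d xi.
Proof.
by rewrite (lyap_diag K A N _ _ uS) /lypt; apply: eq_bigr => c _; rewrite !mxE.
Qed.

Lemma balanced_riccati : gen_lyap A N K Q + C^T *m C - Q *m B *m B^T *m Q = 0 ->
  forall xi, lypt K N' A' sigma xi + sqnorm2 (C' *m xi) - sqnorm2 (B'^T *m (dg sigma *m xi)) = 0.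
Proof.
move=> ric xi; have := congr1 (fun M => quad_form M (invmx S *m xi)) ric.
rewrite 2!quad_formD quad_formN quad_output QE quad_feedback lypt_balanced => ->.
by rewrite quad_formE mul0mx dotc0.
Qed.

Lemma balanced_inequality : negsemidef (gen_lyap A N K (invmx P) - C^T *m C
    + invmx P *m B *m B^T *m invmx P) ->
  forall xi, lypt K N' A' (fun c => (sigma c)^-1) xi - sqnorm2 (C' *m xi) +
    sqnorm2 (B'^T *m (dg (fun c => (sigma c)^-1) *m xi)) <= 0.
Proof.
move=> [_ h] xi; have := h (invmx S *m xi).
by rewrite 2!quad_formD quad_formN quad_output invmxPE quad_feedback lypt_balanced.
Qed.

Lemma quad_form_Q (v : 'cV[R]_n) : quad_form Q v = \sum_c sigma c * (S *m v) c 0 ^+ 2.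
Proof.
rewrite quad_formE QE -!mulmxA dotc_mulmx trmxK dotc_diag.
by apply: eq_bigr => c _; rewrite [(\row__ _) _ _]mxE expr2.
Qed.

End Balancing.

Section Norms.
Context d (Omega : measurableType d) (R : realType).
Variable (Pr : probability Omega R).
Local Notation mu := (@lebesgue_measure R).
Local Notation muP := (mu \x Pr)%E.
Local Notation sqP := (sqP Pr).
Local Notation strip t := (`[0, t]%classic `*` [set: Omega] : set (measurableTypeR R * Omega)).
Local Notation strip_int := (strip_int Pr).

Lemma L2norm_energy T n (v : R -> Omega -> 'cV[R]_n) : (forall c, sqP T (fun s w => v s w c 0)) ->
  L2norm Pr `[0, T] v = (Num.sqrt (energy Pr T v))%:E.
Proof.
by move=> hv; rewrite /L2norm (sqP_L2sq hv) poweR_EFin powR12_sqrt //; exact: energy_ge0.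
Qed.

(** Serves to find times at which the mean of [G] is small: otherwise its integral would grow
    linearly with the horizon. *)
Lemma strip_lower (s t e : R) G : 0 <= s -> s <= t ->
  muP.-integrable (strip t) (EFin \o (fun z => G z.1 z.2)) -> (forall r w, 0 <= G r w) ->
  (forall r, s <= r -> r <= t -> (e%:E <= \int[Pr]_w (G r w)%:E)%E) -> 0 <= e ->
  e * (t - s) <= strip_int t G.
Proof.
move=> s0 st iG G0 hG e0; have mI : measurable (`[0, t]%classic : set (measurableTypeR R)) by exact: measurable_itv.
have mG : measurable_fun (strip t) (EFin \o (fun z => G z.1 z.2)) by case/integrableP: iG.
rewrite -lee_fin /strip_int (EFin_Rintegral (mstrip t) iG) (tonelli1 Pr mI mG); last first.
  by move=> z _; rewrite lee_fin.
have m1 : mu `[s, t]%classic = (t - s)%:E.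
  rewrite lebesgue_measure_itv /= lte_fin; case: ltP => [_|ts]; first by rewrite -EFinD.
  by rewrite (_ : t - s = 0) //; apply/eqP; rewrite subr_eq0 eq_le ts st.
have e1 : (\int[mu]_(_ in `[s, t]) e%:E = e%:E * mu `[s, t]%classic)%E.
  by apply: integral_cst; exact: measurable_itv.
rewrite EFinM -m1 -e1.
have sub : `[s, t]%classic `<=` (`[0, t]%classic : set R).
  by move=> r; rewrite /= !in_itv /= => /andP[sr ->]; rewrite (le_trans s0 sr).
have mf : measurable_fun (`[0, t]%classic : set (measurableTypeR R)) (fun r => (\int[Pr]_w (G r w)%:E)%E).
  by apply: (measurable_tonelli1 Pr mI mG) => z _; rewrite lee_fin.
have mIs : measurable (`[s, t]%classic : set (measurableTypeR R)) by exact: measurable_itv.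
apply: (@le_trans _ _ (\int[mu]_(r in `[s, t]) \int[Pr]_w (G r w)%:E)%E).
  apply: ge0_le_integral => //.
  - exact: measurable_funS mf.
  - by move=> r; rewrite /= in_itv /= => /andP[sr rt]; exact: hG.
apply: ge0_subset_integral => //.
by move=> r _; apply: integral_ge0 => w _; rewrite lee_fin.
Qed.

End Norms.

Theorem corollary5p4 (d : measure_display) (Omega : measurableType d)
  (R : realType) (Pr : probability Omega R)
  (F : R -> set (set Omega)) (hF : usual_filtration Pr F)
  (q : nat) (K : 'M[R]_q) (W : R -> Omega -> 'cV[R]_q) (hW : wiener Pr F K W)
  (n m p : nat) (A : 'M[R]_n) (N : 'I_q -> 'M[R]_n)
  (B : 'M[R]_(n, m)) (C : 'M[R]_(p, n))
  (hstab : stabilizable Pr F W A B N) (hobs : observable Pr F W A C N)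
  (P : 'M[R]_n) (hP : posdef P)
  (hPineq : negsemidef (gen_lyap A N K (invmx P) - C^T *m C
                          + invmx P *m B *m B^T *m invmx P))
  (Q : 'M[R]_n) (hQ : posdef Q)
  (hQric : stabilizing_riccati Pr F W K A B C N Q)
  (r : nat) (hr1 : (1 <= r)%N) (hrn : (r < n)%N)
  (sigma : 'I_n -> R)
  (hsigma_pos : forall k, 0 < sigma k)
  (hsigma_mono : forall i j : 'I_n, (i <= j)%N -> sigma j <= sigma i)
  (hsigma_eig : char_poly (P *m Q) = \prod_(k < n) ('X - (sigma k ^+ 2)%:P))
  (Sb : 'M[R]_n) (hSb : Sb \in unitmx)
  (hSbP : Sb *m P *m Sb^T = diag_mx (\row_k sigma k))
  (hSbQ : (invmx Sb)^T *m Q *m invmx Sb = diag_mx (\row_k sigma k))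
  (Ar : 'M[R]_r) (hAr : Ar = trunc_mx hrn (Sb *m A *m invmx Sb))
  (Nr : 'I_q -> 'M[R]_r)
  (hNr : forall i, Nr i = trunc_mx hrn (Sb *m N i *m invmx Sb))
  (Br : 'M[R]_(r, m)) (hBr : Br = trunc_rows hrn (Sb *m B))
  (Cr : 'M[R]_(p, r)) (hCr : Cr = trunc_cols hrn (C *m invmx Sb))
  (T : R) (hT : 0 < T)
  (gammaT : R) (hgamma_pos : 0 < gammaT)
  (hgamma : forall (w : R -> Omega -> 'cV[R]_m) (z : R -> Omega -> 'cV[R]_r),
     in_L2 Pr F `[0, T] w ->
     is_state Pr F W `[0, T] Ar Br Nr 0 w z ->
     (L2norm Pr `[0%R, T] (fun t o => (Cr *m z t o)%R)
        <= gammaT%:E * L2norm Pr `[0%R, T] w)%E)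
  (u : R -> Omega -> 'cV[R]_m) (hu : in_L2 Pr F `[0, T] u)
  (x : R -> Omega -> 'cV[R]_n) (hx : is_state Pr F W `[0, T] A B N 0 u x)
  (xr : R -> Omega -> 'cV[R]_r)
  (hxr : is_state Pr F W `[0, T] Ar Br Nr 0 u xr) :
  let y := fun t o => C *m x t o in
  let yr := fun t o => Cr *m xr t o in
  let bound := 2 * (1 + gammaT) *
    \sum_(k < n | (r <= k)%N) (sigma k / Num.sqrt (1 + sigma k ^+ 2)) in
  (L2norm Pr `[0%R, T] (fun t o => (y t o - yr t o)%R)
     <= bound%:E *
        (L2sq Pr `[0%R, T] (fun t o => col_mx (u t o) (y t o))
           + 'E_Pr[fun o => quad_form Q (x T o)]) `^ 2^-1)%E
  /\
  (in_L2 Pr F `[0, +oo[ u -> is_state Pr F W `[0, +oo[ A B N 0 u x ->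
   in_L2 Pr F `[0, +oo[ x ->
   (L2norm Pr `[0%R, T] (fun t o => (y t o - yr t o)%R)
      <= bound%:E *
         L2norm Pr `[0%R, +oo[ (fun t o => col_mx (u t o) (y t o)))%E).
Proof.
move=> y yr bound; have T0 := ltW hT; have nW := wiener_noise hF hW.
pose A' := Sb *m A *m invmx Sb; pose N' i := Sb *m N i *m invmx Sb.
pose B' := Sb *m B; pose C' := C *m invmx Sb.
have ric := balanced_riccati hSb hSbQ hQric.1 : forall xi, lypt K N' A' sigma xi +
  sqnorm2 (C' *m xi) - sqnorm2 (B'^T *m (dg sigma *m xi)) = 0.
have ine := balanced_inequality hsigma_pos hSb hSbP hPineq : forall xi,
  lypt K N' A' (fun c => (sigma c)^-1) xi - sqnorm2 (C' *m xi) +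
  sqnorm2 (B'^T *m (dg (fun c => (sigma c)^-1) *m xi)) <= 0.
pose xb t w := Sb *m x t w.
have invS (v : 'cV[R]_n) : invmx Sb *m (Sb *m v) = v by rewrite mulmxA mulVmx // mul1mx.
have yE t w : C *m x t w = C' *m xb t w by rewrite /C' /xb -mulmxA invS.
have balanced_state t (D D' : set (measurableTypeR R)) : measurable D -> measurable D' ->
    `[0, t]%classic `<=` D -> `[0, t]%classic `<=` D' -> 0 <= t ->
    in_L2 Pr F D' u -> is_state Pr F W D A B N 0 u x ->
    vitop Pr F W t xb (fun s w => A' *m xb s w + B' *m u s w) (fun i s w => N' i *m xb s w) /\
    (forall c, sqP Pr t (fun s w => u s w c 0)).
  move=> mD mD' tD tD' t0 hu' hx'.
  have [vx su] := state_vitop hF nW mD mD' tD tD' t0 hu' hx'; split=> //.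
  have := vitop_mulmx hF nW Sb vx; congr (vitop _ _ _ _ _ _).
    by apply/funext => s; apply/funext => w; rewrite /xb /A' -!mulmxA invS mulmxDr /B' mulmxA.
  by apply/funext => i; apply/funext => s; apply/funext => w; rewrite /xb /N' -!mulmxA invS.
have mT : measurable (`[0, T]%classic : set (measurableTypeR R)) by exact: measurable_itv.
have [vxb su] := balanced_state T _ _ mT mT (fun=> id) (fun=> id) T0 hu hx.
have [vxr _] := state_vitop hF nW mT mT (fun=> id) (fun=> id) T0 hu hxr.
pose v := clv B' sigma u xb; pose V := energy Pr T v.
have V0 : 0 <= V by exact: energy_ge0.
pose Th := \sum_(k < n | (r <= k)%N) (sigma k / Num.sqrt (1 + sigma k ^+ 2)).
have Th0 : 0 < Th.
  have th0 c : 0 < sigma c / Num.sqrt (1 + sigma c ^+ 2).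
    by rewrite divr_gt0 // sqrtr_gt0 ltr_pwDl // sqr_ge0.
  rewrite /Th (bigD1 (Ordinal hrn)) //=; apply: ltr_pwDl; first exact: th0.
  by apply: sumr_ge0 => c _; exact: ltW (th0 c).
have boundE : bound = 2 * Th + gammaT * (2 * Th) by rewrite /bound -/Th; ring.
(* Both claims of the theorem follow from this bound by estimating the closed-loop input energy
   [V]. *)
have main : (L2norm Pr `[0%R, T] (fun t o => (y t o - yr t o)%R) <= (bound * Num.sqrt V)%:E)%E.
  have [yk [lk ck]] := level_exists hF hW hT sigma vxb r (A := A') (N := N') (B := B').
  have pk t w := level_proj lk t w.
  (* The leading part of [yk] is the state of the reduced system under the control
     [v - fbk B' sigma *m yk = u + w], so that [z] is its state under [w]. *)
  pose w := fun t o => fbk B' sigma *m (xb t o - yk t o).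
  pose z := fun t o => lead_rows hrn (yk t o) - xr t o.
  have sxb c : sqP Pr T (fun s w => xb s w c 0) by exact: (itop_x (vxb c)).
  have syk := level_sqP lk.
  have sw := sqP_mulmx (fbk B' sigma) (sqP_subtract sxb syk).
  have rnj : (r + (n - r.+1).+1 = n)%N by rewrite -subSn // subSS subnKC // ltnW.
  have tele := level_telescope hF hW hT hsigma_pos ric ine vxb su rnj lk.
  rewrite -/Th -/v -/V in tele.
  have sCc := energy_integrable (sqP_mulmx (Cc B' C' sigma) (sqP_subtract sxb syk)).
  have eC : energy Pr T (fun t o => C' *m (xb t o - yk t o)) <= (2 * Th) ^+ 2 * V.
    apply: le_trans tele; apply: le_Rintegral => //.
    - exact: mstrip.
    - exact: (energy_integrable (sqP_mulmx C' (sqP_subtract sxb syk))).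
    - by move=> s _; rewrite mul_col_mx sqnorm2_col_mx lerDl sqnorm2_ge0.
  have eB : energy Pr T w <= (2 * Th) ^+ 2 * V.
    apply: le_trans tele; apply: le_Rintegral => //.
    - exact: mstrip.
    - exact: (energy_integrable sw).
    - by move=> s _; rewrite mul_col_mx sqnorm2_col_mx lerDr sqnorm2_ge0.
  have vz : vitop Pr F W T z (fun s o => Ar *m z s o + Br *m w s o) (fun i s o => Nr i *m z s o).
    have vk := vitop_mulmx hF nW (rowsub (lead_ord hrn) 1%:M) (level_ito lk).
    have := vitop_lin hF nW 1 (-1) vk vxr; congr (vitop _ _ _ _ _ _).
    - apply/funext => s; apply/funext => o.
      by rewrite -lead_rowsE scale1r scaleN1r.
    - apply/funext => s; apply/funext => o.
      have aux1 (a b c e : 'cV[R]_n) : a - b + (c + e) = a + (e - b) + c.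
        by apply/matrixP => i j; rewrite !mxE; ring.
      have aux2 (a b c e : 'cV[R]_r) : a + b + c - (e + c) = a - e + b.
        by apply/matrixP => i j; rewrite !mxE; ring.
      have key : AQ A' B' sigma *m yk s o + B' *m v s o = A' *m yk s o + B' *m w s o + B' *m u s o.
        by rewrite /AQ mulmxBl -(mulmxA B') /v /clv mulmxDr /w 2!mulmxBr; exact: aux1.
      rewrite -lead_rowsE lead_rows_proj scale1r scaleN1r key !lead_rowsD.
      rewrite -(trunc_mx_lead _ _ (pk s o)) -!trunc_rows_lead -hBr -hAr.
      by rewrite aux2 /z mulmxBr.
    - apply/funext => i; apply/funext => s; apply/funext => o.
      rewrite -lead_rowsE lead_rows_proj scale1r scaleN1r hNr /z mulmxBr.
      by rewrite (trunc_mx_lead _ _ (pk s o)).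
  have wL2 : in_L2 Pr F `[0, T] w.
    split; last by rewrite (L2norm_energy sw) ltry.
    split; last by move=> i; case: (sw i).
    move=> t; rewrite /= in_itv /= => /andP[t0 tT] i.
    apply: (rv_mulmx hF) => // c; under eq_fun do rewrite cVB; apply: (rvB (Fsigma hF t0)).
      exact: (itop_x_ad (vxb c) t0 tT).
    exact: (itop_x_ad (level_ito lk c) t0 tT).
  have zst : is_state Pr F W `[0, T] Ar Br Nr 0 w z.
    apply: (vitop_state hF nW T0 vz); case: hxr => _ cxr _ _; apply: filterS cxr => o co c.
    rewrite (_ : (fun t => _) = fun t => yk t o (lead_ord hrn c) 0 - xr t o c 0); last first.
      by apply/funext => t; rewrite /z cVB mxE.
    move=> t; apply: cvgB; first exact: ck.
    have {}co := within_coord (i := c) co.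
    exact: co.
  have sz c : sqP Pr T (fun s w => z s w c 0) by exact: (itop_x (vz c)).
  have eZ : energy Pr T (fun t o => Cr *m z t o) <= (gammaT * (2 * Th)) ^+ 2 * V.
    have := hgamma w z wL2 zst.
    rewrite (L2norm_energy (sqP_mulmx Cr sz)) (L2norm_energy sw) -EFinM lee_fin => h.
    rewrite -[leLHS]sqr_sqrtr ?energy_ge0 // exprMn -mulrA.
    apply: (@le_trans _ _ ((gammaT * Num.sqrt (energy Pr T w)) ^+ 2)).
      by rewrite lerXn2r // ?nnegrE ?sqrtr_ge0 // mulr_ge0 ?sqrtr_ge0 // ltW.
    by rewrite exprMn sqr_sqrtr ?energy_ge0 // ler_wpM2l ?sqr_ge0.
  have Th20 : 0 < 2 * Th by rewrite mulr_gt0.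
  have tri := energy_triangle (sqP_mulmx C' (sqP_subtract sxb syk)) (sqP_mulmx Cr sz)
    Th20 (mulr_gt0 hgamma_pos Th20) eC eZ.
  have yyr : (fun t o => y t o - yr t o) = (fun t o => C' *m (xb t o - yk t o) + Cr *m z t o).
    apply/funext => t; apply/funext => o; rewrite /y /yr yE /z hCr !mulmxBr.
    by rewrite (trunc_cols_lead _ _ (pk t o)) -/C' addrA subrK.
  rewrite yyr (L2norm_energy (sqP_add (sqP_mulmx C' (sqP_subtract sxb syk)) (sqP_mulmx Cr sz))).
  rewrite lee_fin boundE -[leRHS]ger0_norm; last first.
    by rewrite mulr_ge0 ?sqrtr_ge0 // ltW // addr_gt0 // mulr_gt0.
  by rewrite -sqrtr_sqr ler_wsqrtr // exprMn sqr_sqrtr.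
have bound0 : 0 <= bound.
  by rewrite boundE ltW // addr_gt0 ?mulr_gt0.
pose qT t := \sum_c sigma c * \int[Pr]_o xb t o c 0 ^+ 2.
have qI (t : R) : 0 <= t -> vitop Pr F W t xb (fun s w => A' *m xb s w + B' *m u s w)
    (fun i s w => N' i *m xb s w) ->
    (\int[Pr]_o (\sum_c sigma c * xb t o c 0 ^+ 2)%:E = (qT t)%:E)%E.
  move=> t0 vt; have sO c : sqi Pr setT (fun o => xb t o c 0) by exact: (itop_sqO hF (vt c) t0 (lexx t)).
  rewrite /qT.
  have iq c : Pr.-integrable setT (EFin \o (fun o => sigma c * xb t o c 0 ^+ 2)).
    exact: (integrableZl measurableT _ (sqi_integrable (sO c))).
  rewrite -EFin_Rintegral //; last exact: (integrable_sumr measurableT).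
  rewrite (Rintegral_sumr measurableT) //; congr (_%:E); apply: eq_bigr => c _.
  by rewrite RintegralZl //; exact: (sqi_integrable (sO c)).
have qTE : ('E_Pr[fun o => quad_form Q (x T o)] = (qT T)%:E)%E.
  by rewrite unlock -qI //; apply: eq_integral => o _; rewrite (quad_form_Q hSb hSbQ).
have balance (t : R) : 0 < t -> vitop Pr F W t xb (fun s w => A' *m xb s w + B' *m u s w)
    (fun i s w => N' i *m xb s w) -> (forall c, sqP Pr t (fun s w => u s w c 0)) ->
    (forall c, sqP Pr t (fun s w => col_mx (u s w) (y s w) c 0)) /\
    energy Pr t v = energy Pr t (fun s w => col_mx (u s w) (y s w)) + qT t.
  move=> t0 vt ut; have sy := sqP_mulmx C' (fun c => itop_x (vt c)).
  have suy c : sqP Pr t (fun s w => col_mx (u s w) (y s w) c 0).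
    case: (split_ordP c) => j ->.
      by apply: (eq_sqi _ (ut j)) => z _; rewrite col_mxEu.
    by apply: (eq_sqi _ (sy j)) => z _; rewrite col_mxEd -yE.
  split=> //; rewrite (energy_balance hF hW ric vt ut (ltW t0) (lexx t)); congr (_ + _).
  rewrite /energy /strip_int -(RintegralD (mstrip t)); last 2 first.
  - exact: (energy_integrable ut).
  - exact: (energy_integrable sy).
  by apply: eq_Rintegral => z _; rewrite sqnorm2_col_mx /y yE.
have [suy balT] := balance T hT vxb su.
split.
  apply: (le_trans main); rewrite (sqP_L2sq suy) qTE -EFinD -balT poweR_EFin powR12_sqrt //.
move=> hu0 hx0 hx2; apply: (le_trans main).
rewrite /L2norm; set LI := L2sq Pr `[0%R, +oo[ _.
have mI : measurable (`[0%R, +oo[%classic : set (measurableTypeR R)) by exact: measurable_itv.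
have sub t : `[0%R, t]%classic `<=` (`[0%R, +oo[%classic : set (measurableTypeR R)).
  by move=> s; rewrite /= !in_itv /= andbT => /andP[].
have stT t : T <= t -> vitop Pr F W t xb (fun s w => A' *m xb s w + B' *m u s w)
    (fun i s w => N' i *m xb s w) /\ (forall c, sqP Pr t (fun s w => u s w c 0)).
  by move=> Tt; exact: (balanced_state t _ _ mI mI (@sub t) (@sub t) (le_trans T0 Tt) hu0 hx0).
pose half : set (measurableTypeR R * Omega) := `[0%R, +oo[%classic `*` setT.
have L2sub k t (g : R -> Omega -> 'cV[R]_k) :
    (forall i, measurable_fun half (fun z => g z.1 z.2 i 0)) ->
    (L2sq Pr `[0%R, t] g <= L2sq Pr `[0%R, +oo[ g)%E.
  move=> mg; have ss : (`[0%R, t]%classic `*` setT : set (measurableTypeR R * Omega)) `<=` half.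
    by move=> z [z1 z2]; split=> //; exact: sub z1.
  have mS := measurable_strip (Omega := Omega) mI.
  rewrite (L2sq_strip Pr mI mg) L2sq_strip; last 2 first.
  - exact: measurable_itv.
  - by move=> i; exact: measurable_funS (mg i).
  apply: ge0_subset_integral => //; first exact: mstrip.
  - apply/measurable_EFinP; apply: measurable_sum => i; exact: measurable_funX.
  - by move=> z _; rewrite lee_fin sqnorm2_ge0.
have mux k : measurable_fun half (fun z => col_mx (u z.1 z.2) (y z.1 z.2) k 0).
  case: (split_ordP k) => j ->; under eq_fun do rewrite ?col_mxEu ?col_mxEd.
    by case: hu0 => -[_ h] _; exact: h.
  under eq_fun do rewrite /y mxE; apply: measurable_sum => i; apply: measurable_funM => //.
  by case: hx2 => -[_ h] _; exact: h.
(* [V] is at most the energy of [v] up to a later time [t] with [qT t <= e]; the energy balance at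
   that [t] bounds it by [LI] plus [e]. *)
have VLI : (V%:E <= LI)%E.
  apply/lee_addgt0Pr => /= e e0.
  have [t [Tt qt]] : exists t, T <= t /\ qT t <= e.
    have Lx : (L2sq Pr `[0%R, +oo[ x < +oo)%E by apply: L2norm_lty; case: hx2.
    have Lx0 : (0 <= L2sq Pr `[0%R, +oo[ x)%E.
      by apply: integral_ge0 => o _; apply: integral_ge0 => s _; rewrite lee_fin sqnorm2_ge0.
    pose L := fine (L2sq Pr `[0%R, +oo[ x).
    have LE : (L2sq Pr `[0%R, +oo[ x = L%:E)%E by rewrite /L fineK // ge0_fin_numE.
    have L0 : 0 <= L by exact: fine_ge0.
    (* By [mulmx_sq_le], [cS] bounds the form of [Q] at [x] against the squared norm of [x]. *)
    pose cS := (\sum_c sigma c) * mxsq Sb.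
    have cS0 : 0 <= cS.
      by rewrite mulr_ge0 ?mxsq_ge0 // sumr_ge0 // => c _; rewrite ltW.
    apply: contrapT => /forallNP nq.
    (* If [qT] exceeded [e] on all of [[T, t]], its integral would be at least
       [e * (t - T) = cS * L + 1], whereas it is at most [cS * L]. *)
    pose t := T + (cS * L + 1) / e.
    have Tt : T <= t.
      have d0 : 0 <= cS * L + 1 by rewrite addr_ge0 // mulr_ge0.
      rewrite lerDl; exact: divr_ge0 d0 (ltW e0).
    have [vt ut] := stT t Tt; have sxt c := itop_x (vt c).
    pose G (s : R) o := \sum_c sigma c * xb s o c 0 ^+ 2.
    have sx c : sqP Pr t (fun s o => x s o c 0).
      by apply: (eq_sqi _ (sqP_mulmx (invmx Sb) sxt c)) => z _; rewrite invS.
    have iG : ((@lebesgue_measure R) \x Pr)%E.-integrable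
        (`[0, t]%classic `*` [set: Omega] : set (measurableTypeR R * Omega)) (EFin \o (fun z => G z.1 z.2)).
      apply: (integrable_sumr (mstrip t)) => c.
      exact: (integrableZl (mstrip t) _ (sqi_integrable (sxt c))).
    have G0 s o : 0 <= G s o.
      by apply: sumr_ge0 => c _; rewrite mulr_ge0 ?sqr_ge0 // ltW.
    have low := strip_lower (e := e) T0 Tt iG G0 _ (ltW e0).
    have {}low : e * (t - T) <= strip_int Pr t G.
      apply: low => s Ts st; rewrite qI; last 2 first.
      - exact: le_trans Ts.
      - exact: (stT s Ts).1.
      rewrite lee_fin leNgt; apply/negP => qe; apply: (nq s); split=> //; exact: ltW.
    have up : strip_int Pr t G <= cS * energy Pr t x.
      rewrite /energy /strip_int -(RintegralZl _ (mstrip t)); last exact: (energy_integrable sx).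
      apply: le_Rintegral => //; first exact: mstrip.
        exact: (integrableZl (mstrip t) _ (energy_integrable sx)).
      move=> z _; rewrite /G /cS -mulrA mulr_suml; apply: ler_sum => c _.
      by apply: ler_wpM2l; [exact: ltW|exact: mulmx_sq_le].
    have eL : energy Pr t x <= L.
      rewrite -lee_fin -LE -(sqP_L2sq sx); apply: L2sub => i; by case: hx2 => -[_ h] _; exact: h.
    have := le_trans low (le_trans up (ler_wpM2l cS0 eL)).
    rewrite /t addrAC subrr add0r mulrC divfK ?gt_eqF // leNgt; move/negP; apply.
    by rewrite ltrDl.
  have t0 : 0 < t by exact: lt_le_trans Tt.
  have [vt ut] := stT t Tt; have [suyt balt] := balance t t0 vt ut.
  have VVt : V <= energy Pr t v.
    apply: (strip_mono (f := fun s o => sqnorm2 (v s o)) Tt) => [z _|]; first exact: sqnorm2_ge0.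
    exact: (energy_integrable (clv_sqP sigma vt ut (lexx t))).
  apply: (@le_trans _ _ (energy Pr t v)%:E); first by rewrite lee_fin.
  rewrite balt EFinD; apply: leeD; last by rewrite lee_fin.
  by rewrite -(sqP_L2sq suyt); exact: L2sub.
rewrite EFinM; apply: lee_wpmul2l; first by rewrite lee_fin.
rewrite -(powR12_sqrt V0) -poweR_EFin; apply: gt0_ler_poweR => //.
- by rewrite in_itv /= lee_fin V0 leey.
- by rewrite in_itv /= leey andbT (le_trans _ VLI) // lee_fin.
Qed.
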